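(* Let $(T_h,S_h,\mathbf u_h,P_h)$ be a solution of the stabilized semi-discrete finite element method defined in the context (no-slip boundary conditions for $\mathbf u_h$, homogeneous Neumann boundary conditions for the tracers $T_h,S_h$, no restoring term). Then the following stability estimate holds: $$ \begin{aligned} &\partial_t\Big(\tfrac12\|\mathbf u_h\|^2+\big(g(y-\overline y),\,-\alpha_T T_h+\beta_S S_h\big)\Big) +\tfrac12\big\|\nu^{1/2}\big(\nabla\mathbf u_h+(\nabla\mathbf u_h)^\top\big)\big\|^2\\ &\quad+\tfrac12\big\|\mathbf N_h^{1/4}\big(\nabla\mathbf u_h+(\nabla\mathbf u_h)^\top\big)\mathbf N_h^{1/4}\big\|^2 +\big\|\sqrt{\gamma_h}\,\nabla\cdot\mathbf u_h\big\|^2\\ &\quad+\tfrac12\big\|\mathbf N_{h,vms}^{1/4}\big(\nabla\mathbf u_h+(\nabla\mathbf u_h)^\top-\Pi_h\nabla\mathbf u_h-(\Pi_h\nabla\mathbf u_h)^\top\big)\mathbf N_{h,vms}^{1/4}\big\|^2\\ &=-\big(\nabla\cdot((\kappa_T\mathbb I+\mathbf K_{T,h})\hat{\mathbf y}),\,g\alpha_T T_h\big)+\big(\nabla\cdot((\kappa_S\mathbb I+\mathbf K_{S,h})\hat{\mathbf y}),\,g\beta_S S_h\big)\\ &\quad+\big(\mathbf n\cdot((\kappa_T\mathbb I+\mathbf K_{T,h})\hat{\mathbf y}),\,g\alpha_T T_h\big)_{\partial\Omega}-\big(\mathbf n\cdot((\kappa_S\mathbb I+\mathbf K_{S,h})\hat{\mathbf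 y}),\,g\beta_S S_h\big)_{\partial\Omega}. \end{aligned} $$
   Context: **Notation.** $\Omega\subset\mathbb R^d$ ($d=2$ or $3$) is a bounded Lipschitz domain exactly covered by a conforming simplicial mesh $\mathcal T_h$; $\mathbf n$ is the outward unit normal. $(\cdot,\cdot)$ and $\|\cdot\|$ are the $L^2(\Omega)$ inner product and norm for scalars, vectors and matrices (for matrices, with integrand $A:B=\sum_{i,j}A_{ij}B_{ij}$), and $(\cdot,\cdot)_{\partial\Omega}$ is the $L^2(\partial\Omega)$ inner product. For a vector field, $(\nabla\mathbf u)_{ij}=\partial_{x_i}u_j$, so $\mathbf u\cdot\nabla\mathbf u=(\nabla\mathbf u)^\top\mathbf u$, while $(\nabla\mathbf u)\mathbf u$ is the vector with $i$th entry $\sum_j(\partial_{x_i}u_j)u_j$. $y=x_2$ is the second Cartesian coordinate, $\hat{\mathbf y}=\nabla y$ the corresponding unit vector, and $\overline w=\frac1{|\Omega|}\int_\Omega w\,d\mathbf x$ denotes the mean of $w$ over $\Omega$. $\mathbb I$ is the $d\times d$ identity matrix. **Finite element spaces.** For an integer $k\ge1$ let $\mathbb P^k_h=\{v\in C^0(\overline\Omega):v|_K\in\mathbb P_k\ \forall K\in\mathcal T_h\}$, where $\mathbb P_k$ are the polynomials of total degree at most $k$. The velocity, pressure and tracer spaces are $\mathcal V_h=\{\mathbf v\in[\mathbb P^{k+1}_h]^d:\mathbf v=0\text{ on }\partial\Omega\}$, $Q_{0,h}=\{q\in\mathbb P^k_h:\int_\Omega q\,d\mathbf x=0\}$, $\mathcal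 M_h=\mathbb P^k_h$. **Physical data.** $g,\rho_0>0$, $\alpha_T,\beta_S,T_0,S_0$ are real constants; $\nu\ge0$ is the kinematic viscosity; $\kappa_T,\kappa_S\ge0$ are the diffusivities (constants, or Lipschitz functions on $\overline\Omega$). The discrete density perturbation is $\delta\rho_h=\rho_0(-\alpha_T(T_h-T_0)+\beta_S(S_h-S_0))$. **Stabilization coefficients.** For $\phi\in\{T,S\}$ let $\sigma_{\phi,h},\sigma_{\mathbf u,h}\in\mathcal M_h$ be discontinuity indicators with values in $[0,1]$, let $h\in\mathcal M_h$ be a nonnegative mesh-size function, and let $C_{\max},C_{\max,vms}\ge0$ be constants. Define diagonal matrices $\mathbf K_{\phi,h}=\mathrm{diag}(\kappa_{\phi,h,i})_{i=1}^d$, $\mathbf K_{\phi,h,vms}=\mathrm{diag}(\kappa_{\phi,h,vms,i})_{i=1}^d$, $\mathbf N_h=\mathrm{diag}(\nu_{h,i})_{i=1}^d$, $\mathbf N_{h,vms}=\mathrm{diag}(\nu_{h,vms,i})_{i=1}^d$ with $\kappa_{\phi,h,i}=\sigma_{\phi,h}C_{\max}h|u_{h,i}|$, $\kappa_{\phi,h,vms,i}=(1-\sigma_{\phi,h})C_{\max,vms}h|u_{h,i}|$, $\nu_{h,i}=\sigma_{\mathbf u,h}C_{\max}h|u_{h,i}|$, $\nu_{h,vms,i}=(1-\sigma_{\mathbf u,h})C_{\max,vms}h|u_{h,i}|$, and set $\gamma_h=C_{\max}h|\mathbf u_h|$. Here $u_{h,i}$ is the $i$th component of $\mathbf u_h$.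 Roots of these diagonal matrices are taken entrywise on the diagonal. **Projections.** For a scalar $\phi$, $\Pi_h\nabla\phi\in[\mathcal M_h]^d$ satisfies $(\mathbf K_{\phi,h,vms}\Pi_h\nabla\phi,\mathbf w)=(\mathbf K_{\phi,h,vms}\nabla\phi,\mathbf w)$ for all $\mathbf w\in[\mathcal M_h]^d$ (in each tracer equation the weight is that tracer's matrix, also when the projection is applied to test functions). For a vector field $\mathbf v$, $\Pi_h\nabla\mathbf v\in[\mathbb P_h^{k+1}]^{d\times d}$ satisfies $(\mathbf N_{h,vms}^{1/2}\,\Pi_h\nabla\mathbf v\,\mathbf N_{h,vms}^{1/2},\mathbb V)=(\mathbf N_{h,vms}^{1/2}\,\nabla\mathbf v\,\mathbf N_{h,vms}^{1/2},\mathbb V)$ for all $\mathbb V\in[\mathbb P_h^{k+1}]^{d\times d}$. **Stabilized FEM.** Find (continuously differentiable in time) $T_h,S_h\in\mathcal M_h$, $\mathbf u_h\in\mathcal V_h$, and $P_h\in Q_{0,h}$ such that at all times, for $\phi\in\{T,S\}$, $$\big(\partial_t\phi_h+\mathbf u_h\cdot\nabla\phi_h+\tfrac12(\nabla\cdot\mathbf u_h)(\phi_h-\overline{\phi_h}),w\big)+\big((\kappa_\phi\mathbb I+\mathbf K_{\phi,h})\nabla\phi_h,\nabla w\big)+\big(\mathbf K_{\phi,h,vms}(\nabla\phi_h-\Pi_h\nabla\phi_h),\nabla w-\Pi_h\nabla w\big)=0\quad\forall w\in\mathcal M_h,$$ and, with $D(\mathbf v)=\nabla\mathbf v+(\nabla\mathbf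 v)^\top$ and $D_\Pi(\mathbf v)=\Pi_h\nabla\mathbf v+(\Pi_h\nabla\mathbf v)^\top$, $$\begin{aligned}&\big(\partial_t\mathbf u_h+\mathbf u_h\cdot\nabla\mathbf u_h+(\nabla\mathbf u_h)\mathbf u_h+(\nabla\cdot\mathbf u_h)\mathbf u_h,\mathbf v\big)-(P_h,\nabla\cdot\mathbf v)+(\gamma_h\nabla\cdot\mathbf u_h,\nabla\cdot\mathbf v)\\&+\tfrac12\big(\nu D(\mathbf u_h)+\mathbf N_h^{1/2}D(\mathbf u_h)\mathbf N_h^{1/2},D(\mathbf v)\big)+\tfrac12\big(\mathbf N_{h,vms}^{1/2}(D(\mathbf u_h)-D_\Pi(\mathbf u_h))\mathbf N_{h,vms}^{1/2},D(\mathbf v)-D_\Pi(\mathbf v)\big)\\&=-\Big(\frac{g\,\delta\rho_h}{\rho_0}\hat{\mathbf y},\mathbf v\Big)-\frac12\Big(\frac{\delta\rho_h}{\rho_0}gy,\nabla\cdot\mathbf v\Big)\quad\forall\mathbf v\in\mathcal V_h,\end{aligned}$$ $$(\nabla\cdot\mathbf u_h,q)=0\quad\forall q\in Q_{0,h}.$$ *)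

(* Defs.v *)
From HB Require Import structures.
From mathcomp Require Import all_boot all_order all_algebra.
From mathcomp Require Import all_classical all_reals all_analysis.
From mathcomp Require mpoly.
Import (canonicals, coercions) mpoly.
Import numFieldNormedType.Exports.
Set Implicit Arguments.
Unset Strict Implicit.
Unset Printing Implicit Defensive.
Import Order.TTheory GRing.Theory Num.Theory.
Local Open Scope classical_set_scope.
Local Open Scope ring_scope.

(* The sigma-algebra generated by the coordinates, i.e. the Borel sets of R^n.  *)
Section rV_measurable.
Variables (R : realType) (n : nat).

Definition rV_coord (i : 'I_n) (x : 'rV[R]_n) : measurableTypeR R := x 0 i.

Let rV_set0 : g_sigma_preimage rV_coord set0.
Proof. exact: sigma_algebra0. Qed.

Let rV_setC A : g_sigma_preimage rV_coord A -> g_sigma_preimage rV_coord (~` A).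
Proof. exact: sigma_algebraC. Qed.

Let rV_bigcup (F : _^nat) : (forall i, g_sigma_preimage rV_coord (F i)) ->
  g_sigma_preimage rV_coord (\bigcup_i (F i)).
Proof. exact: sigma_algebra_bigcup. Qed.

HB.instance Definition _ := @isMeasurable.Build default_measure_display
  'rV[R]_n (g_sigma_preimage rV_coord) rV_set0 rV_setC rV_bigcup.

Lemma measurable_rV_coord (i : 'I_n) : measurable_fun [set: 'rV[R]_n] (rV_coord i).
Proof.
move=> _ Y mY; rewrite setTI; apply: sub_sigma_algebra => /=.
rewrite -bigcup_seq/=; exists i => /=; first by rewrite mem_index_enum.
by exists Y => //; rewrite setTI.
Qed.

Lemma measurable_fun_rV d (T : measurableType d) (f : T -> 'rV[R]_n) :
  (forall i, measurable_fun [set: T] (rV_coord i \o f)) ->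
  measurable_fun [set: T] f.
Proof.
move=> mf _ A; rewrite setTI.
have : g_sigma_preimage rV_coord `<=` [set A | measurable (f @^-1` A)].
  apply: smallest_sub.
    split => /=.
    - by rewrite preimage_set0.
    - by move=> B mB; rewrite setTD preimage_setC; exact: measurableC.
    - by move=> F mF; rewrite preimage_bigcup; exact: bigcup_measurable.
  rewrite -bigcup_seq; apply: bigcup_sub => i _ _ [B mB <-] /=.
  by rewrite setTI -comp_preimage -[X in measurable X]setTI; exact: mf.
exact.
Qed.

End rV_measurable.

Section lebesgue_rV.
Variable R : realType.

(* R x R^n ~ R^(n+1), used to build Lebesgue measure on R^n as an n-fold        *)
(* product.                                                                    *)
Definition rV_cons (n : nat) (p : measurableTypeR R * 'rV[R]_n) : 'rV[R]_n.+1 :=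
  \row_(i < n.+1) oapp (fun j => p.2 0 j) p.1 (unlift ord0 i).

Definition rV_uncons (n : nat) (x : 'rV[R]_n.+1) : measurableTypeR R * 'rV[R]_n :=
  (x 0 ord0, \row_j x 0 (lift ord0 j)).

Lemma rV_consK n : cancel (@rV_cons n) (@rV_uncons n).
Proof.
case=> a v; rewrite /rV_uncons /rV_cons mxE unlift_none; congr pair.
by apply/rowP => j; rewrite !mxE liftK.
Qed.

Lemma rV_unconsK n : cancel (@rV_uncons n) (@rV_cons n).
Proof.
by move=> x; apply/rowP => i; rewrite mxE; case: unliftP => [j|] -> //=; rewrite mxE.
Qed.

Lemma measurable_rV_cons n :
  measurable_fun [set: measurableTypeR R * 'rV[R]_n] (@rV_cons n).
Proof.
apply: measurable_fun_rV => i; case: (unliftP ord0 i) => [j|] ->.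
  rewrite (_ : _ \o _ = @rV_coord R n j \o snd).
    by apply: measurableT_comp; [exact: measurable_rV_coord|exact: measurable_snd].
  by apply/funext => p; rewrite /rV_coord /= mxE liftK.
rewrite (_ : _ \o _ = fst); first exact: measurable_fst.
by apply/funext => p; rewrite /rV_coord /= mxE unlift_none.
Qed.

Lemma measurable_rV_uncons n : measurable_fun [set: 'rV[R]_n.+1] (@rV_uncons n).
Proof.
apply/measurable_fun_pairP; split; first exact: (@measurable_rV_coord R n.+1 ord0).
apply: measurable_fun_rV => i.
rewrite (_ : _ \o _ = @rV_coord R n.+1 (lift ord0 i)); first exact: measurable_rV_coord.
by apply/funext => x; rewrite /rV_coord /= mxE.
Qed.

Section cons_measure.
Variables (n : nat) (mu : {sigma_finite_measure set 'rV[R]_n -> \bar R}).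

Definition lebesgue_cons : set 'rV[R]_n.+1 -> \bar R :=
  pushforward (lebesgue_measure \x mu)%E (@rV_cons n).

Let cons0 : lebesgue_cons set0 = 0%E.
Proof. by rewrite /lebesgue_cons /pushforward preimage_set0 measure0. Qed.

Let cons_ge0 A : (0 <= lebesgue_cons A)%E.
Proof. by rewrite /lebesgue_cons /pushforward measure_ge0. Qed.

Let cons_sigma_additive : semi_sigma_additive lebesgue_cons.
Proof.
move=> F mF tF mUF; rewrite /lebesgue_cons /pushforward preimage_bigcup.
have mcons (A : set 'rV[R]_n.+1) : measurable A ->
    measurable (@rV_cons n @^-1` A).
  by move=> mA; rewrite -[X in measurable X]setTI; exact: measurable_rV_cons.
apply: measure_semi_sigma_additive.
- by move=> k; exact: mcons.
- move/trivIsetP : tF => tF; apply/trivIsetP => i j _ _ ij.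
  by rewrite -preimage_setI tF// preimage_set0.
- by rewrite -preimage_bigcup; exact: mcons.
Qed.

HB.instance Definition _ := isMeasure.Build _ _ _ lebesgue_cons
  cons0 cons_ge0 cons_sigma_additive.

Let cons_sigma_finite : sigma_finite setT lebesgue_cons.
Proof.
have /sigma_finiteP[F [TF ndF Foo]] := sigma_finiteT (@lebesgue_measure R).
have /sigma_finiteP[G [TG ndG Goo]] := sigma_finiteT mu.
exists (fun k => @rV_uncons n @^-1` (F k `*` G k)).
  rewrite -preimage_bigcup; apply/esym; rewrite -subTset => x _ /=.
  have [i _ Fi] : (\bigcup_k F k) (rV_uncons x).1 by rewrite -TF.
  have [j _ Gj] : (\bigcup_k G k) (rV_uncons x).2 by rewrite -TG.
  exists (maxn i j) => //; split.
  - by move: Fi; apply/subsetPset/ndF/leq_maxl.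
  - by move: Gj; apply/subsetPset/ndG/leq_maxr.
move=> k; have [mF Fk] := Foo k; have [mG Gk] := Goo k.
have mFG : measurable (F k `*` G k) by exact: measurableX.
split; first by rewrite -[X in measurable X]setTI; exact: measurable_rV_uncons.
rewrite /lebesgue_cons /pushforward -comp_preimage.
rewrite (_ : _ \o _ = id) ?preimage_id; last first.
  by apply/funext => p /=; rewrite rV_consK.
by rewrite product_measure1E// lte_mul_pinfty// ge0_fin_numE.
Qed.

HB.instance Definition _ := @Measure_isSigmaFinite.Build _ _ _ lebesgue_cons
  cons_sigma_finite.

End cons_measure.

Fixpoint lebesgue_rV (n : nat) : {sigma_finite_measure set 'rV[R]_n -> \bar R} :=
  match n with
  | 0 => \d_(0 : 'rV[R]_0)
  | n'.+1 => lebesgue_cons (lebesgue_rV n')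
  end.

End lebesgue_rV.

(* Points of R^d and vectors are rows: a matrix A acts on a vector v by        *)
(* v *m A, which is the column product A^T v.                                  *)
Notation sfield R d := ('rV[R]_d -> R).
Notation vfield R d := ('rV[R]_d -> 'rV[R]_d).
Notation mfield R d := ('rV[R]_d -> 'M[R]_d).

Section calculus.
Variables (R : realType) (d : nat).

Definition dot (v w : 'rV[R]_d) : R := \sum_i v 0 i * w 0 i.

(* Euclidean norm; `|v| is the sup norm on matrices.                           *)
Definition enorm (v : 'rV[R]_d) : R := Num.sqrt (dot v v).

(* Classical partial derivatives. They are only ever integrated over the       *)
(* domain, for fields that are Lipschitz there, hence differentiable almost    *)
(* everywhere; the value elsewhere is irrelevant.                              *)
Definition partial (i : 'I_d) (f : sfield R d) : sfield R d :=
  fun x => 'D_(delta_mx 0 i) f x.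

Definition grad (f : sfield R d) : vfield R d :=
  fun x => \row_i partial i f x.

(* (vgrad v)_ij = d_i v_j                                                      *)
Definition vgrad (v : vfield R d) : mfield R d :=
  fun x => \matrix_(i, j) partial i (fun z => v z 0 j) x.

Definition vdiv (v : vfield R d) : sfield R d :=
  fun x => \sum_i partial i (fun z => v z 0 i) x.

Definition sym2 (G : mfield R d) : mfield R d := fun x => G x + (G x)^T.

Variable Omega : set 'rV[R]_d.

Definition integral_dom (f : sfield R d) : R :=
  \int[lebesgue_rV R d]_(x in Omega) f x.

Definition mean (f : sfield R d) : R :=
  (fine (lebesgue_rV R d Omega))^-1 * integral_dom f.

Definition ip (f g : sfield R d) : R := integral_dom (fun x => f x * g x).

(* Used for matrix fields (q = d) and for vector fields (p = 1, q = d).        *)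
Definition ipmx (p q : nat) (A B : 'rV[R]_d -> 'M[R]_(p, q)) : R :=
  integral_dom (fun x => \sum_i \sum_j A x i j * B x i j).

Definition norm2 (f : sfield R d) : R := Num.sqrt (ip f f).

Definition norm2mx (p q : nat) (A : 'rV[R]_d -> 'M[R]_(p, q)) : R :=
  Num.sqrt (ipmx A A).

Definition boundary : set 'rV[R]_d := closure Omega `\` Omega.

End calculus.

(* Indices start at 0: the second coordinate has index 1.                      *)
Definition yhat (R : realType) (d : nat) : 'rV[R]_d :=
  \row_i (nat_of_ord i == 1%N)%:R.

Definition ycoord (R : realType) (d : nat) : sfield R d :=
  fun x => dot x (yhat R d).

Section domain_mesh.
Variables (R : realType) (n : nat).
Local Notation point := 'rV[R]_n.+1.

(* Near each boundary point, in coordinates z obtained by a rigid motion, the  *)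
(* set is the strict epigraph {z_0 > phi(z_1, ..., z_n)} of a Lipschitz        *)
(* function.                                                                   *)
Definition lipschitz_boundary (Omega : set point) : Prop :=
  forall x0, boundary Omega x0 ->
  exists (Q : 'M[R]_n.+1) (r : R) (phi : 'rV[R]_n -> R),
    [/\ Q *m Q^T = 1%:M, 0 < r, lipschitz phi &
      forall z : point, `|z| < r ->
        (Omega (x0 + z *m Q) <-> phi (col' ord0 z) < z 0 ord0)].

Definition bounded_lipschitz_domain (Omega : set point) : Prop :=
  [/\ Omega !=set0, open Omega, connected Omega, bounded_set Omega &
      lipschitz_boundary Omega].

Definition hull (I : finType) (D : pred I) (p : I -> point) : set point :=
  [set x | exists w : I -> R,
     [/\ forall i, 0 <= w i, forall i, ~~ D i -> w i = 0, \sum_i w i = 1 &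
         x = \sum_i w i *: p i]].

Definition affinely_independent (p : 'I_n.+2 -> point) : Prop :=
  row_free (\matrix_(j < n.+1) (p (lift ord0 j) - p ord0)).

Section mesh.
(* A mesh is a finite family E of simplices given by their vertices.           *)
Variables (Omega : set point) (E : finType) (vtx : E -> 'I_n.+2 -> point).

Definition simplex (K : E) : set point := hull predT (vtx K).

Definition conforming_mesh : Prop :=
  [/\ forall K, affinely_independent (vtx K),
      closure Omega = \bigcup_(K in [set: E]) simplex K &
      forall K L : E, K != L ->
        simplex K <> simplex L /\
        simplex K `&` simplex L =
          hull [pred i | [exists j, vtx L j == vtx K i]] (vtx K)].

(* The face (K, i) of K opposite to its i-th vertex, parametrized by the       *)
(* reference simplex of R^n; its surface measure is                            *)
(* sqrt (det (G G^T)) dt for G the matrix of edge vectors.                     *)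
Definition ref_simplex : set 'rV[R]_n :=
  [set t | (forall j, 0 < t 0 j) /\ \sum_j t 0 j < 1].

Definition face_edges (F : E * 'I_n.+2) : 'M[R]_(n, n.+1) :=
  \matrix_(j < n) (vtx F.1 (lift F.2 (lift ord0 j)) - vtx F.1 (lift F.2 ord0)).

Definition face_map (F : E * 'I_n.+2) (t : 'rV[R]_n) : point :=
  vtx F.1 (lift F.2 ord0) + t *m face_edges F.

Definition open_face (F : E * 'I_n.+2) : set point := face_map F @` ref_simplex.

Definition boundary_face (F : E * 'I_n.+2) : Prop :=
  open_face F `<=` boundary Omega.

Definition ip_boundary (f g : sfield R n.+1) : R :=
  \sum_(F : E * 'I_n.+2 | `[< boundary_face F >])
    Num.sqrt (\det (face_edges F *m (face_edges F)^T)) *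
    \int[lebesgue_rV R n]_(t in ref_simplex) (f (face_map F t) * g (face_map F t)).

(* The normal is only prescribed in the relative interior of boundary faces,   *)
(* that is, almost everywhere on the boundary.                                 *)
Definition outward_unit_normal (nu : vfield R n.+1) : Prop :=
  forall F, boundary_face F -> forall x, open_face F x ->
    [/\ dot (nu x) (nu x) = 1,
        forall j, dot (nu x) (row j (face_edges F)) = 0 &
        \forall s \near 0^'+, ~ closure Omega (x + s *: nu x)].

(* Continuous piecewise polynomials of total degree at most k; msize is the    *)
(* total degree plus one.                                                      *)
Definition Pk (k : nat) (v : sfield R n.+1) : Prop :=
  {within closure Omega, continuous v} /\
  forall K, exists p : mpoly.mpoly n.+1 R, (mpoly.msize p <= k.+1)%N /\
    forall x, simplex K x -> v x = mpoly.meval (fun i => x 0 i) p.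

Definition Pkmx (k p q : nat) (A : point -> 'M[R]_(p, q)) : Prop :=
  forall i j, Pk k (fun x => A x i j).

Definition velocity_space (k : nat) (v : vfield R n.+1) : Prop :=
  Pkmx k.+1 v /\ forall x, boundary Omega x -> v x = 0.

Definition pressure_space (k : nat) (q : sfield R n.+1) : Prop :=
  Pk k q /\ integral_dom Omega q = 0.

Definition tracer_space (k : nat) (w : sfield R n.+1) : Prop := Pk k w.

End mesh.
End domain_mesh.

Section scheme.
Variables (R : realType) (n : nat).
Local Notation sfield := (sfield R n.+1).
Local Notation vfield := (vfield R n.+1).
Local Notation mfield := (mfield R n.+1).

(* The same formula gives the vms matrices, with 1 - sigma and C_max,vms.      *)
Definition stab_diag (sigma : sfield) (C : R) (h : sfield) (u : vfield) : mfield :=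
  fun x => diag_mx (\row_i (sigma x * C * h x * `|u x 0 i|)).

Definition compl_indicator (sigma : sfield) : sfield := fun x => 1 - sigma x.

Definition grad_div_coef (C : R) (h : sfield) (u : vfield) : sfield :=
  fun x => C * h x * enorm (u x).

(* For diagonal matrices with nonnegative entries.                             *)
Definition root2 (N : mfield) : mfield := fun x => map_mx Num.sqrt (N x).

Definition root4 (N : mfield) : mfield := root2 (root2 N).

Definition sandwich (N A : mfield) : mfield := fun x => N x *m A x *m N x.

Definition density_perturbation (rho0 alphaT betaS T0 S0 : R) (T S : sfield) :
    sfield :=
  fun x => rho0 * (- alphaT * (T x - T0) + betaS * (S x - S0)).

Variables (Omega : set 'rV[R]_n.+1) (E : finType).
Variables (vtx : E -> 'I_n.+2 -> 'rV[R]_n.+1) (k : nat).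

(* G is a projected gradient; it need not be unique where the weight           *)
(* degenerates, and any choice is allowed.                                     *)
Definition tracer_projection (Kvms : mfield) (phi : sfield) (G : vfield) : Prop :=
  Pkmx Omega vtx k G /\
  forall w : vfield, Pkmx Omega vtx k w ->
    ipmx Omega (fun x => G x *m Kvms x) w =
    ipmx Omega (fun x => grad phi x *m Kvms x) w.

Definition velocity_projection (Nvms : mfield) (v : vfield) (G : mfield) : Prop :=
  Pkmx Omega vtx k.+1 G /\
  forall V : mfield, Pkmx Omega vtx k.+1 V ->
    ipmx Omega (sandwich (root2 Nvms) G) V =
    ipmx Omega (sandwich (root2 Nvms) (vgrad v)) V.

Definition tracer_equation (kappa : sfield) (K Kvms : mfield)
    (Pi : sfield -> vfield) (u : vfield) (phi dt_phi : sfield) : Prop :=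
  forall w, tracer_space Omega vtx k w ->
    ip Omega (fun x => dt_phi x + dot (u x) (grad phi x)
                + 2^-1 * vdiv u x * (phi x - mean Omega phi)) w
    + ipmx Omega (fun x => grad phi x *m ((kappa x)%:M + K x)) (grad w)
    + ipmx Omega (fun x => (grad phi x - Pi phi x) *m Kvms x)
                 (fun x => grad w x - Pi w x)
    = 0.

(* In row form, u . grad u is u *m vgrad u and (grad u) u is u *m (vgrad u)^T. *)
Definition momentum_equation (g rho0 nu : R) (gamma : sfield) (N Nvms : mfield)
    (Pi : vfield -> mfield) (delta_rho : sfield) (u dt_u : vfield) (P : sfield) :
    Prop :=
  let D v := sym2 (vgrad v) in
  let DPi v := sym2 (Pi v) in
  forall v, velocity_space Omega vtx k v ->
    ipmx Omega (fun x => dt_u x + u x *m vgrad u x + u x *m (vgrad u x)^T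
                  + vdiv u x *: u x) v
    - ip Omega P (vdiv v)
    + ip Omega (fun x => gamma x * vdiv u x) (vdiv v)
    + 2^-1 * ipmx Omega (fun x => nu *: D u x + sandwich (root2 N) (D u) x) (D v)
    + 2^-1 * ipmx Omega (sandwich (root2 Nvms) (fun x => D u x - DPi u x))
                        (fun x => D v x - DPi v x)
    = - ipmx Omega (fun x => (g * delta_rho x / rho0) *: yhat R n.+1) v
      - 2^-1 * ip Omega (fun x => delta_rho x / rho0 * g * ycoord x) (vdiv v).

Definition continuity_equation (u : vfield) : Prop :=
  forall q, pressure_space Omega vtx k q -> ip Omega (vdiv u) q = 0.

End scheme.

Definition C1_on (R : realType) (W : normedModType R) (J : set R) (f : R -> W) :
    Prop :=
  forall t, J t -> derivable f t 1 /\ {for t, continuous (derive1 f)}.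

Definition time_derivative (R : realType) (d : nat) (W : normedModType R)
    (f : R -> 'rV[R]_d -> W) (t : R) : 'rV[R]_d -> W :=
  fun x => derive1 (fun s => f s x) t.

(* Main.v *)
From HB Require Import structures.
Require Import Defs.
From mathcomp Require Import all_boot all_order all_algebra.
From mathcomp Require Import all_classical all_reals all_analysis.
From mathcomp Require Import measurable_realfun lebesgue_integral_definition ring lra.
From mathcomp Require mpoly.
Import (canonicals, coercions) mpoly.
Import numFieldNormedType.Exports.
Set Implicit Arguments.
Unset Strict Implicit.
Unset Printing Implicit Defensive.
Import Order.TTheory GRing.Theory Num.Theory.
Local Open Scope classical_set_scope.
Local Open Scope ring_scope.

(* Test the momentum equation with [u] and the tracer equations with [g (y - mean y)].
   Since the gradient of the latter is constant, its multiscale term vanishes, and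
   after integrations by parts the convective terms cancel, the pressure drops out
   and the buoyancy work equals the rate of change of the potential energy up to the
   vertical diffusive fluxes.

   All the fields are Lipschitz on each simplex, with partial derivatives only almost
   everywhere, so the integrations by parts rest on the one-dimensional fundamental
   theorem for Lipschitz functions on lines parallel to an axis, integrated by
   Fubini over each simplex: the contributions of an interior face cancel because
   conformity and the Lipschitz boundary make it a face of exactly two simplices,
   lying on opposite sides.  The energy can be differentiated in time because a
   finite element function is a fixed finite linear interpolation of its values at
   finitely many points. *)

(** * Lebesgue measure on R^n *)

(** The factors 1/2 in the scheme are what makes the energy close. The discrete velocity is
    divergence-free only against functions of degree at most [k], so the integral of
    [div u * T * y], where [T * y] has degree [k + 1], need not vanish. The tracer equation leaves
    half of it in the potential energy, and the second buoyancy term of the momentum equation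
    supplies the opposite half. Terms with a mean value or with [T0], [S0] involve only integrals
    that do vanish.

    The analytic obstacle is that [partial] is a bare limit, with no meaning where the limit fails
    to exist, while the coefficients contain absolute values of velocity components. Measurability
    of the integrands is therefore never asked for. They are only required to agree with bounded
    Borel functions off a null set ([bae]), a class stable under the algebraic operations of the
    scheme and sufficient for linearity of the integral.

    The height is a test function that does not vanish on the boundary: transport is integrated by
    parts thanks to [u = 0] there, and only diffusion leaves a surface term. *)

Section insertion.
Variable R : realType.

Definition ins (n : nat) (i : 'I_n.+1) (a : R) (v : 'rV[R]_n) : 'rV[R]_n.+1 :=
  \row_k oapp (v 0) a (unlift i k).

Lemma ins_eq n (i : 'I_n.+1) a (v : 'rV[R]_n) : ins i a v 0 i = a.
Proof. by rewrite mxE unlift_none. Qed.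

Lemma ins_lift n (i : 'I_n.+1) a (v : 'rV[R]_n) j : ins i a v 0 (lift i j) = v 0 j.
Proof. by rewrite mxE liftK. Qed.

Lemma ins_col' n (i : 'I_n.+1) (x : 'rV[R]_n.+1) : ins i (x 0 i) (col' i x) = x.
Proof.
apply/rowP => k; case: (unliftP i k) => [j|] ->; first by rewrite ins_lift mxE.
by rewrite ins_eq.
Qed.

Lemma ins_ins n (j : 'I_n.+1) a b (w : 'rV[R]_n) :
  ins ord0 b (ins j a w) = ins (lift ord0 j) a (ins ord0 b w).
Proof.
apply/rowP => k; case: (unliftP (lift ord0 j) k) => [k' ->|->].
  rewrite ins_lift; case: (unliftP ord0 k') => [l ->|->].
    rewrite ins_lift.
    have -> : lift (lift ord0 j) (lift ord0 l) = lift ord0 (lift j l).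
      by apply: val_inj; rewrite /= /bump /= !add1n ltnS addnS.
    by rewrite !ins_lift.
  have -> : lift (lift ord0 j) ord0 = ord0 :> 'I_n.+2 by exact: val_inj.
  by rewrite !ins_eq.
by rewrite ins_lift !ins_eq.
Qed.

Lemma measurable_coord n d (T : measurableType d) (f : T -> 'rV[R]_n) j :
  measurable_fun setT f -> measurable_fun setT (fun x => f x 0 j).
Proof.
move=> mf; apply: (measurableT_comp (f := fun x : 'rV[R]_n => x 0 j)) => //.
exact: (@measurable_rV_coord R n j).
Qed.

Lemma measurable_ins_fun n (i : 'I_n.+1) d (T : measurableType d)
    (f : T -> R) (g : T -> 'rV[R]_n) :
  measurable_fun setT f -> measurable_fun setT g ->
  measurable_fun setT (fun t => ins i (f t) (g t)).
Proof.
move=> mf mg; apply: measurable_fun_rV => k.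
case: (unliftP i k) => [j|] ->.
  rewrite (_ : _ \o _ = fun t => g t 0 j); first exact: measurable_coord.
  by apply/funext => t; rewrite /rV_coord/= ins_lift.
rewrite (_ : _ \o _ = f)//.
by apply/funext => t; rewrite /rV_coord/= ins_eq.
Qed.

Lemma measurable_ins n (i : 'I_n.+1) :
  measurable_fun [set: 'rV[R]_n * measurableTypeR R] (fun p => ins i p.2 p.1).
Proof. by apply: measurable_ins_fun => //; exact: measurable_snd. Qed.

End insertion.

Section tonelli.
Variable R : realType.
Local Open Scope ereal_scope.
Local Notation lam := (lebesgue_rV R).
Local Notation mu := (@lebesgue_measure R).

Lemma integral_cons n (f : 'rV[R]_n.+1 -> \bar R) :
  measurable_fun setT f -> (forall x, 0 <= f x) ->
  \int[lam n.+1]_x f x = \int[lam n]_v \int[mu]_a f (ins ord0 a v).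
Proof.
move=> mf f0.
have mfc : measurable_fun setT (fun p => f (@rV_cons R n p)).
  by apply: (measurableT_comp mf); exact: measurable_rV_cons.
transitivity (\int[mu \x lam n]_p f (rV_cons p)).
  exact: (ge0_integral_pushforward (@measurable_rV_cons R n)).
rewrite (fubini_tonelli2 (fun p => f (@rV_cons R n p)))//.
Qed.

Lemma measurable_integral_ins n (i : 'I_n.+1) (f : 'rV[R]_n.+1 -> \bar R) :
  measurable_fun setT f -> (forall x, 0 <= f x) ->
  measurable_fun setT (fun v => \int[mu]_a f (ins i a v)).
Proof.
move=> mf f0.
apply: (@measurable_fun_fubini_tonelli_F _ _ _ _ R mu
  (fun p : 'rV[R]_n * measurableTypeR R => f (ins i p.2 p.1))) => //.
exact: (measurableT_comp mf (@measurable_ins R n i)).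
Qed.

(** Index 0 is [integral_cons], since the measure is built by splitting off that coordinate. For
    [lift ord0 j], coordinate 0 is split off and moved outside, the induction hypothesis splits off
    [j] among the others, and coordinate 0 is then merged back through [ins_ins]. *)
Lemma tonelli_ins n (i : 'I_n.+1) (f : 'rV[R]_n.+1 -> \bar R) :
  measurable_fun setT f -> (forall x, 0 <= f x) ->
  \int[lam n.+1]_x f x = \int[lam n]_v \int[mu]_a f (ins i a v).
Proof.
elim: n i f => [|n IH] i f mf f0; case: (unliftP ord0 i) => [j|] ->.
- by case: j.
- exact: integral_cons.
- transitivity (\int[lam n.+1]_v \int[mu]_b f (ins ord0 b v)).
    exact: integral_cons.
  pose F1 (p : 'rV[R]_n.+1 * measurableTypeR R) := f (ins ord0 p.2 p.1).
  have mF1 : measurable_fun setT F1.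
    exact: (measurableT_comp mf (@measurable_ins R n.+1 ord0)).
  transitivity (\int[mu]_b \int[lam n.+1]_v F1 (v, b)).
    by apply: (fubini_tonelli (m1 := lam n.+1) (m2 := mu) F1) => // p; exact: f0.
  pose F2 (p : 'rV[R]_n * measurableTypeR R) :=
    \int[mu]_a f (ins ord0 p.2 (ins j a p.1)).
  transitivity (\int[mu]_b \int[lam n]_w F2 (w, b)).
    apply: eq_integral => b _; rewrite /F1 /F2.
    apply: (IH j (fun v => f (ins ord0 b v))) => //.
    by apply: (measurableT_comp mf); exact: measurable_ins_fun.
  have mF2 : measurable_fun setT F2.
    apply: (@measurable_fun_fubini_tonelli_F _ _ _ _ R mu
     (fun p : ('rV[R]_n * measurableTypeR R) * measurableTypeR R =>
        f (ins ord0 p.1.2 (ins j p.2 p.1.1)))) => //.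
    apply: (measurableT_comp mf); apply: measurable_ins_fun.
      exact: (measurableT_comp measurable_snd measurable_fst).
    apply: measurable_ins_fun; first exact: measurable_snd.
    exact: (measurableT_comp measurable_fst measurable_fst).
  transitivity (\int[lam n]_w \int[mu]_b F2 (w, b)).
    apply/esym; apply: (fubini_tonelli (m1 := lam n) (m2 := mu) F2) => // p.
    exact: integral_ge0.
  transitivity (\int[lam n]_w \int[mu]_b \int[mu]_a f (ins (lift ord0 j) a (ins ord0 b w))).
    apply: eq_integral => w _; apply: eq_integral => b _.
    by apply: eq_integral => a _; rewrite ins_ins.
  apply/esym; apply: (integral_cons (f := fun v => \int[mu]_a f (ins (lift ord0 j) a v))).
    exact: measurable_integral_ins.
  by move=> v; exact: integral_ge0.
- exact: integral_cons.
Qed.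

(** The measure [nu], which is [|r|] times the image of Lebesgue measure under the affine map, has
    the right value on half-open intervals, hence is Lebesgue measure by uniqueness. For [r < 0] the
    preimage is half-open on the other side, which does not change its length. *)
Lemma lebesgue_affine1 (r s : R) (f : R -> \bar R) : r != 0%R ->
  measurable_fun setT f -> (forall x, 0 <= f x) ->
  \int[mu]_a (`|r|%:E * f (r * a + s)%R) = \int[mu]_a f a.
Proof.
move=> r0 mf f0.
have mphi : measurable_fun [set: measurableTypeR R]
    (fun a : measurableTypeR R => (r * a + s)%R : measurableTypeR R).
  by apply: measurable_funD => //; exact: measurable_funM.
pose nu := mscale (NngNum (normr_ge0 r))
  (measure_function_pushforward__canonical__measure_function_Measure mu mphi).
have -> : \int[mu]_a f a = \int[nu]_a f a.
  apply: eq_measure_integral => A mA _.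
  apply: lebesgue_measure_unique => // X /ocitvP[->|[[x y] /= xy ->]].
    by rewrite !measure0.
  rewrite lebesgue_measure_itv/= lte_fin xy /nu /mscale /= /pushforward.
  have [r_gt0|r_lt0|r_eq0] := ltgtP 0%R r; last by rewrite r_eq0 eqxx in r0.
  - rewrite (_ : _ @^-1` _ = `](x - s) / r, (y - s) / r]%classic%R); last first.
      apply/seteqP; split => a /=; rewrite !in_itv/=.
        by rewrite ltr_pdivrMr// ler_pdivlMr// (mulrC a) ltrBlDr lerBrDr.
      by rewrite ltr_pdivrMr// ler_pdivlMr// (mulrC a) ltrBlDr lerBrDr.
    rewrite lebesgue_measure_itv/= lte_fin ltr_pM2r ?invr_gt0// ltrD2r xy.
    rewrite -!EFinB -EFinM gtr0_norm//; congr (_%:E).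
    by field; rewrite gt_eqF.
  - rewrite (_ : _ @^-1` _ = `[(y - s) / r, (x - s) / r[%classic%R); last first.
      apply/seteqP; split => a /=; rewrite !in_itv/=.
        rewrite ltr_ndivlMr// ler_ndivrMr// (mulrC a) ltrBlDr lerBrDr.
        by rewrite andbC.
      rewrite ltr_ndivlMr// ler_ndivrMr// (mulrC a) ltrBlDr lerBrDr.
      by rewrite andbC.
    rewrite lebesgue_measure_itv/= lte_fin ltr_nM2r ?invr_lt0// ltrD2r xy.
    rewrite -!EFinB -EFinM ltr0_norm//; congr (_%:E).
    by field; rewrite lt_eqF.
rewrite ge0_integral_mscale//= (ge0_integral_pushforward mphi)//=.
rewrite ge0_integralZl//.
exact: (measurableT_comp mf mphi).
Qed.

End tonelli.

(** * Linear changes of variables *)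

Section linear_change.
Variable R : realType.

Lemma measurable_rV_add n d (T : measurableType d) (f g : T -> 'rV[R]_n) :
  measurable_fun setT f -> measurable_fun setT g ->
  measurable_fun setT (fun x => f x + g x).
Proof.
move=> mf mg; apply: measurable_fun_rV => i.
rewrite (_ : _ \o _ = fun x => f x 0 i + g x 0 i).
  by apply: measurable_funD; exact: measurable_coord.
by apply/funext => x; rewrite /rV_coord/= mxE.
Qed.

Lemma measurable_rV_mul m n d (T : measurableType d) (f : T -> 'rV[R]_m)
    (M : 'M[R]_(m, n)) :
  measurable_fun setT f -> measurable_fun setT (fun x => f x *m M).
Proof.
move=> mf; apply: measurable_fun_rV => i.
rewrite (_ : _ \o _ = fun x => \sum_j (fun y => f y 0 j * M j i) x).
  apply: measurable_sum => j; apply: measurable_funM => //.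
  exact: measurable_coord.
by apply/funext => x; rewrite /rV_coord/= mxE.
Qed.

Lemma measurable_rV_scale n d (T : measurableType d) (f : T -> R) (b : 'rV[R]_n) :
  measurable_fun setT f -> measurable_fun setT (fun x => f x *: b).
Proof.
move=> mf; apply: measurable_fun_rV => i.
rewrite (_ : _ \o _ = fun x => f x * b 0 i); first exact: measurable_funM.
by apply/funext => x; rewrite /rV_coord/= mxE.
Qed.

(* Column reduction along the row 0 with pivot [M 0 j]; [integral_linear] is an
   induction on the Schur complement that appears here. *)
Lemma det_pivot n (M : 'M[R]_n.+1) j : M 0 j != 0 ->
  `|\det M| = `|M 0 j| * `|\det (col' j (row' 0 M)
    - (M 0 j)^-1 *: (col j (row' 0 M) *m col' j (row 0 M)))|.
Proof.
move=> r0.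
(* Right multiplication by [Ej] is the column operation that clears row 0 outside column [j]; its
   determinant is one. *)
pose Ej := \matrix_(p, k) (if k == j then (p == j)%:R
   else (p == k)%:R - (p == j)%:R * (M 0 k / M 0 j)) : 'M[R]_n.+1.
have detE : \det Ej = 1.
  rewrite (expand_det_col _ j) (bigD1 j)//= big1 ?addr0; last first.
    by move=> p /negPf pj; rewrite mxE eqxx pj mul0r.
  rewrite mxE !eqxx mul1r /cofactor -signr_odd addnn odd_double expr0 mul1r.
  rewrite (_ : row' _ _ = 1%:M) ?det1//; apply/matrixP => p k.
  rewrite !mxE eq_sym (negPf (neq_lift _ _)) (eq_sym _ j) (negPf (neq_lift _ _)).
  by rewrite mul0r subr0 (inj_eq (@lift_inj _ j)).
have ME p k : (M *m Ej) p k =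
    if k == j then M p j else M p k - M p j * (M 0 k / M 0 j).
  rewrite mxE; case: (eqVneq k j) => [->|kj].
    rewrite (bigD1 j)//= big1 ?addr0; last first.
      by move=> q /negPf qj; rewrite mxE eqxx qj mulr0.
    by rewrite mxE !eqxx mulr1.
  under eq_bigr => q _ do rewrite mxE (negPf kj) mulrBr.
  rewrite sumrB (bigD1 k)//= big1 ?addr0; last first.
    by move=> q /negPf qk; rewrite qk mulr0.
  rewrite (bigD1 j)//= big1 ?addr0; last first.
    by move=> q /negPf qj; rewrite qj mul0r mulr0.
  by rewrite !eqxx mulr1 mul1r.
have -> : \det M = \det (M *m Ej) by rewrite det_mulmx detE mulr1.
rewrite (expand_det_row _ 0) (bigD1 j)//= big1 ?addr0; last first.
  by move=> k /negPf kj; rewrite ME kj [X in _ - X]mulrC divfK// subrr mul0r.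
rewrite ME eqxx /cofactor !normrM normrX normrN1 expr1n mul1r.
congr (_ * `|\det _|); apply/matrixP => p k.
rewrite !mxE big_ord1 !mxE.
have := ME (lift 0 p) (lift j k); rewrite mxE => ->.
rewrite eq_sym (negPf (neq_lift _ _)); congr (_ - _).
by rewrite mulrA [LHS]mulrC.
Qed.

(** Isolates the coordinate [j] of the image, in which [a] enters with the pivot as its slope, so
    that a one-dimensional substitution can be made there. *)
Lemma ins_mul n (M : 'M[R]_n.+1) j a (v : 'rV[R]_n) :
  ins ord0 a v *m M =
  ins j (M 0 j * a + (v *m col j (row' 0 M)) 0 0)
    (a *: col' j (row 0 M) + v *m col' j (row' 0 M)).
Proof.
have E k : (ins ord0 a v *m M) 0 k = a * M 0 k + \sum_i v 0 i * M (lift 0 i) k.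
  rewrite mxE big_ord_recl ins_eq; congr (_ + _).
  by apply: eq_bigr => i _; rewrite ins_lift.
apply/rowP => k; rewrite E; case: (unliftP j k) => [l|] ->.
  by rewrite ins_lift !mxE; congr (_ + _); apply: eq_bigr => i _; rewrite !mxE.
rewrite ins_eq mulrC !mxE; congr (_ + _); apply: eq_bigr => i _.
by rewrite !mxE.
Qed.

Lemma ins_add n (i : 'I_n.+1) (a b : R) (v w : 'rV[R]_n) :
  ins i a v + ins i b w = ins i (a + b) (v + w).
Proof.
apply/rowP => k; rewrite mxE; case: (unliftP i k) => [j|] ->.
  by rewrite !ins_lift mxE.
by rewrite !ins_eq.
Qed.

Local Open Scope ereal_scope.
Local Notation lam := (lebesgue_rV R).
Local Notation mu := (@lebesgue_measure R).

Lemma integral_translate n (b : 'rV[R]_n) (f : 'rV[R]_n -> \bar R) :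
  measurable_fun setT f -> (forall x, 0 <= f x) ->
  \int[lam n]_x f (x + b)%R = \int[lam n]_x f x.
Proof.
elim: n b f => [|n IH] b f mf f0.
  by apply: eq_integral => x _; rewrite [b]thinmx0 addr0.
have mfb : measurable_fun setT (fun x : 'rV[R]_n.+1 => f (x + b)%R).
  by apply: (measurableT_comp mf); exact: measurable_rV_add.
transitivity (\int[lam n]_v \int[mu]_a f (ins ord0 a v + b)%R).
  by apply: (integral_cons mfb) => x.
rewrite [RHS](integral_cons mf f0).
transitivity (\int[lam n]_v \int[mu]_a f (ins ord0 a (v + col' ord0 b)%R)).
  apply: eq_integral => v _.
  rewrite -[RHS](@lebesgue_affine1 R 1%R (b 0%R ord0)
     (fun a => f (ins ord0 a (v + col' ord0 b)%R)))//.
  - apply: eq_integral => a _; rewrite normr1 mul1e mul1r.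
    by rewrite -{1}(ins_col' ord0 b) ins_add.
  - by apply: (measurableT_comp mf); exact: measurable_ins_fun.
apply: (IH _ (fun v => \int[mu]_a f (ins ord0 a v))).
  exact: measurable_integral_ins.
by move=> v; exact: integral_ge0.
Qed.

Lemma integral_linear n (M : 'M[R]_n) (f : 'rV[R]_n -> \bar R) :
  (\det M)%R != 0%R -> measurable_fun setT f -> (forall x, 0 <= f x) ->
  \int[lam n]_x (`|\det M|%:E * f (x *m M)%R) = \int[lam n]_x f x.
Proof.
elim: n M f => [|n IH] M f detM mf f0.
  by apply: eq_integral => x _; rewrite det_mx00 normr1 mul1e [x]thinmx0 [LHS in f LHS]thinmx0.
have [j r0] : exists j, (M 0 j != 0)%R.
  apply/existsP; rewrite -negb_forall; apply: contra detM => /forallP M0.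
  by rewrite (expand_det_row _ ord0) big1// => j _; rewrite (eqP (M0 j)) mul0r.
set r := (M 0 j)%R in r0; set B := row' ord0 M; set rho := col' j (row ord0 M).
pose C := (col' j B - r^-1 *: (col j B *m rho))%R.
have detE : (`|\det M| = `|r| * `|\det C|)%R by exact: det_pivot.
have detC : (\det C)%R != 0%R.
  by apply: contra_neq detM => C0; apply/eqP; rewrite -normr_eq0 detE C0 normr0 mulr0.
have mfM : measurable_fun setT (fun x : 'rV[R]_n.+1 => `|\det M|%:E * f (x *m M)%R).
  apply: measurable_funeM; apply: (measurableT_comp mf); exact: measurable_rV_mul.
transitivity (\int[lam n]_v \int[mu]_a (`|\det M|%:E * f (ins ord0 a v *m M)%R)).
  by apply: (integral_cons mfM) => x; rewrite mule_ge0.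
(* The substitution [s = r * a + (v *m col j B) 0 0] turns the image of [ins ord0 a v] into
   [ins j s ((s / r) *: rho + v *m C)]: only the Schur complement [C] acts on [v], and the remaining
   shift is constant in [v]. *)
pose F (p : 'rV[R]_n * measurableTypeR R) :=
  `|\det C|%:E * f (ins j p.2 ((p.2 / r) *: rho + p.1 *m C)%R).
have F0 p : 0 <= F p by rewrite mule_ge0.
have mF : measurable_fun setT F.
  apply: measurable_funeM; apply: (measurableT_comp mf).
  apply: measurable_ins_fun; first exact: measurable_snd.
  apply: measurable_rV_add; last first.
    by apply: measurable_rV_mul; exact: measurable_fst.
  by apply: measurable_rV_scale; apply: measurable_funM.
transitivity (\int[lam n]_v \int[mu]_s F (v, s)).
  apply: eq_integral => v _.
  rewrite -(@lebesgue_affine1 R r ((v *m col j B) 0 0)%R (fun s => F (v, s)))//; last first.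
    by apply: (measurableT_comp mF); exact: measurable_fun_pair.
  apply: eq_integral => a _; rewrite /F /= muleA -EFinM -detE; congr (_ * f _).
  rewrite (ins_mul M j) -/r -/B -/rho; congr ins.
  rewrite /C mulmxBr -scalemxAr mulmxA.
  have [c ->] : exists c, (v *m col j B = c%:M)%R.
    by eexists; exact: mx11_scalar.
  rewrite mul_scalar_mx mxE eqxx mulr1n.
  rewrite scalerA addrCA -scalerBl addrC; congr (_ *: _ + _)%R.
  by field.
transitivity (\int[mu]_s \int[lam n]_v F (v, s)).
  exact: (fubini_tonelli (m1 := lam n) (m2 := mu) F).
transitivity (\int[mu]_s \int[lam n]_v f (ins j s v)).
  apply: eq_integral => s _.
  pose h (w : 'rV[R]_n) := f (ins j s ((s / r) *: rho + w)%R).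
  have mh : measurable_fun setT h.
    apply: (measurableT_comp mf); apply: measurable_ins_fun => //.
    exact: measurable_rV_add.
  transitivity (\int[lam n]_v h v); first by apply: (IH C h) => // w; exact: f0.
  rewrite -(@integral_translate _ ((s / r) *: rho)%R (fun v => f (ins j s v))).
  - by apply: eq_integral => w _; rewrite /h addrC.
  - by apply: (measurableT_comp mf); exact: measurable_ins_fun.
  - by move=> w; exact: f0.
transitivity (\int[lam n]_v \int[mu]_s f (ins j s v)).
  apply/esym; apply: (fubini_tonelli (m1 := lam n) (m2 := mu) (fun p => f (ins j p.2 p.1))) => //.
  exact: (measurableT_comp mf (@measurable_ins R n j)).
by apply/esym; exact: tonelli_ins.
Qed.

End linear_change.

(** * Borel sets and Lipschitz functions on R^n *)

Section borel_rV.
Variable R : realType.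
Local Notation lam := (lebesgue_rV R).
Local Notation mu := (@lebesgue_measure R).

Lemma rV_normP n (x : 'rV[R]_n) e : 0 < e ->
  `|x| < e <-> forall i, `|x 0 i| < e.
Proof.
move=> e0; have -> : (`|x| < e) = (`|0 - x| < e) by rewrite sub0r normrN.
have -> : (`|0 - x| < e) = ball_ (fun x => `|x|) 0 e x :> Prop by [].
rewrite -mx_norm_ball; split=> [[_ H] i|H].
  by have := H 0 i; rewrite /ball/= mxE sub0r normrN.
by split=> // i j; rewrite ord1 /ball/= mxE sub0r normrN.
Qed.

Lemma rV_coord_le n (x : 'rV[R]_n) i : `|x 0 i| <= `|x|.
Proof.
rewrite leNgt; apply/negP => H.
have := (@rV_normP n x `|x 0 i| (le_lt_trans (normr_ge0 _) H)).1 H i.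
by rewrite ltxx.
Qed.

Definition box n (q : 'rV[R]_n) (e : R) : set 'rV[R]_n :=
  [set x | forall i, `|x 0 i - q 0 i| < e].

Lemma box_norm n (q x : 'rV[R]_n) e : 0 < e -> box q e x <-> `|x - q| < e.
Proof.
move=> e0; rewrite rV_normP//.
by split=> H i; have := H i; rewrite !mxE.
Qed.

Lemma open_box n (q : 'rV[R]_n) e : open (box q e).
Proof.
rewrite openE => x bx; have [e0|e0] := ltP 0 e; last first.
  (* For [e <= 0] the box is empty, except in dimension 0, where it is the whole space. *)
  case: n q x bx => [|n] q x bx.
    have -> : box q e = setT by apply/seteqP; split=> // y _ [].
    exact: filterT.
  by have := le_lt_trans (normr_ge0 _) (lt_le_trans (bx ord0) e0); rewrite ltxx.
have := (box_norm _ _ e0).1 bx => xq.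
apply/nbhs_ballP; exists (e - `|x - q|) => /=; first by rewrite subr_gt0.
move=> y; rewrite -ball_normE/= => xy; apply/box_norm => //.
by rewrite (le_lt_trans (ler_distD x _ _))// distrC -ltrBrDr.
Qed.

Lemma open_boxP n (A : set 'rV[R]_n) x : open A -> A x ->
  exists2 e, 0 < e & box x e `<=` A.
Proof.
rewrite openE => /(_ x) /[apply] /nbhs_ballP[e /= e0 H].
exists e => // y /box_norm -/(_ e0) xy; apply: H.
by rewrite -ball_normE/= distrC.
Qed.

Lemma measurable_rV_lt n (f : 'rV[R]_n -> R) (g : 'rV[R]_n -> R) :
  measurable_fun setT f -> measurable_fun setT g ->
  measurable [set x | f x < g x].
Proof.
move=> mf mg; rewrite (_ : [set x | _] = (fun x => f x < g x) @^-1` [set true]).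
  by rewrite -[X in measurable X]setTI; exact: measurable_fun_ltr.
by apply/seteqP; split => x /= ->.
Qed.

Lemma measurable_box n (q : 'rV[R]_n) e : measurable (box q e).
Proof.
have -> : box q e = \bigcap_(i in [set: 'I_n]) [set x : 'rV[R]_n | `|x 0 i - q 0 i| < e].
  by apply/seteqP; split => [x bx i _|x bx i]; exact: bx.
apply: fin_bigcap_measurable => // i _; apply: measurable_rV_lt => //.
apply: measurableT_comp => //; apply: measurable_funB => //.
exact: (@measurable_coord R n _ _ id).
Qed.

(** The sigma-algebra is generated by the coordinates, so an open set has to be exhibited as a
    countable union: that of the boxes it contains with rational centre and radius [1 / (m + 1)]. *)
Lemma open_measurable_rV n (A : set 'rV[R]_n) : open A -> measurable A.
Proof.
move=> oA.
have -> : A = \bigcup_(p in [set: 'rV[rat]_n * nat])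
    (if `[< box (map_mx ratr p.1) (p.2.+1%:R^-1) `<=` A >]
     then box (map_mx (ratr : rat -> R) p.1) (p.2.+1%:R^-1) else set0).
  apply/seteqP; split => [x Ax|x [p _]]; last by case: asboolP => // /[apply].
  have [e e0 xA] := open_boxP oA Ax.
  have [m] := near_infty_natSinv_lt (PosNum (divr_gt0 e0 (ltr0n _ 2))).
  move=> _ /(_ m (leqnn m)) /= me.
  have m0 : 0 < m.+1%:R^-1 :> R by rewrite invr_gt0.
  have : forall i, exists q : rat, `|x 0 i - ratr q| < m.+1%:R^-1.
    move=> i; have xm : x 0 i < x 0 i + m.+1%:R^-1 by rewrite ltrDl.
    have [q] := rat_in_itvoo xm; rewrite in_itv/= => /andP[q1 q2]; exists q; rewrite distrC gtr0_norm ?subr_gt0//.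
    by rewrite ltrBlDl.
  move=> /choice[q qP].
  exists (\row_i q i, m) => //=; rewrite ifT; first by move=> i; rewrite !mxE.
  apply/asboolP => y yb; apply: xA => i; rewrite (splitr e).
  have := yb i; rewrite !mxE => yq.
  rewrite (le_lt_trans (ler_distD (ratr (q i)) _ _))//.
  by rewrite ltrD// ?(lt_trans yq)// distrC (lt_trans (qP i)).
apply: countable_bigcupT_measurable => [|p]; first exact: countableP.
case: ifP => _ //.
exact: measurable_box.
Qed.

Lemma closed_measurable_rV n (A : set 'rV[R]_n) : closed A -> measurable A.
Proof. by move/closed_openC/open_measurable_rV/measurableC; rewrite setCK. Qed.

Definition lip_on n (K : set 'rV[R]_n) (L : R) (f : 'rV[R]_n -> R) :=
  forall x y, K x -> K y -> `|f x - f y| <= L * `|x - y|.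

Lemma lip_onW n (K : set 'rV[R]_n) L L' f :
  L <= L' -> lip_on K L f -> lip_on K L' f.
Proof.
by move=> LL' fL x y Kx Ky; rewrite (le_trans (fL _ _ Kx Ky))// ler_wpM2r.
Qed.

(** If [M > 0] is a Lipschitz constant, [f] stays above [c] within distance [(f x - c) / M] of [x];
    hence the set where [f] exceeds [c] is the trace on [K] of a union of open boxes. *)
Lemma lip_on_measurable n (K : set 'rV[R]_n) L f :
  measurable K -> lip_on K L f -> measurable_fun K f.
Proof.
move=> mK fL _.
have [M M0 fM] : exists2 M, 0 < M & lip_on K M f.
  exists (`|L| + 1); first by rewrite ltr_wpDl.
  by apply: lip_onW fL; rewrite (le_trans (ler_norm _))// lerDl.
apply: (measurability _ (RGenOInfty.measurableE R)) => //.
move=> /= _ [_ [c ->] <-].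
have -> : K `&` f @^-1` `]c, +oo[ =
  K `&` \bigcup_(x in [set x | K x /\ c < f x]) box x ((f x - c) / M).
  apply/seteqP; split => [x [Kx /=]|x [Kx [y [Ky cy]]]].
    rewrite in_itv/= andbT => cx; split=> //; exists x => //.
    by apply/box_norm; rewrite ?subrr ?normr0 divr_gt0// subr_gt0.
  have dM : 0 < (f y - c) / M by rewrite divr_gt0// subr_gt0.
  move=> /box_norm -/(_ dM); rewrite ltr_pdivlMr// mulrC => xy.
  split=> //=; rewrite in_itv/= andbT.
  have := le_lt_trans (fM _ _ Kx Ky) xy; rewrite ltr_norml => /andP[].
  by lra.
apply: measurableI => //; apply: open_measurable_rV; apply: bigcup_open => x _.
exact: open_box.
Qed.

Local Open Scope ereal_scope.

Lemma lebesgue_ins n (i : 'I_n.+1) (A : set 'rV[R]_n.+1) : measurable A ->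
  lam n.+1 A = \int[lam n]_v mu [set a | A (ins i a v)].
Proof.
move=> mA.
have mAv v : measurable ([set a | A (ins i a v)] : set (measurableTypeR R)).
  rewrite -[X in measurable X]setTI.
  exact: (@measurable_ins_fun R n i _ _ id (cst v) (@measurable_id _ _ _) (@measurable_cst _ _ _ _ _ _)).
transitivity (\int[lam n.+1]_x (\1_A x)%:E); first by rewrite integral_indic// setIT.
rewrite (_ : \int[lam n.+1]_x _ = \int[lam n]_v \int[mu]_a (\1_A (ins i a v))%:E).
  apply: eq_integral => v _.
  rewrite -[X in _ = mu X]setIT -integral_indic//.
  apply: (tonelli_ins i (f := fun x => (\1_A x)%:E)) => //.
by apply/measurable_EFinP; exact: measurable_indic.
Qed.

Lemma lebesgue_box n (q : 'rV[R]_n) (e : R) : (0 < e)%R ->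
  lam n (box q e) = ((2 * e) ^+ n)%:E.
Proof.
move=> e0; elim: n q => [|n IH] q.
  have -> : box q e = setT by apply/seteqP; split=> // y _ [].
  by rewrite /= diracT.
rewrite (lebesgue_ins ord0); last exact: measurable_box.
transitivity (\int[lam n]_v ((2 * e)%:E * (\1_(box (col' ord0 q) e) v)%:E)).
  apply: eq_integral => v _; rewrite indicE.
  have [vb|vb] := boolP (v \in box (col' ord0 q) e).
    rewrite mule1 (_ : [set a | _] = ball (q 0%R ord0) e).
      by rewrite lebesgue_measure_ball ?ltW// mulr_natl.
    apply/seteqP; split => a /=.
      by move=> /(_ ord0); rewrite ins_eq /ball/= distrC.
    rewrite /ball/= distrC => aq i; case: (unliftP ord0 i) => [j|] ->.
      by have := set_mem vb; rewrite /= ins_lift => /(_ j); rewrite mxE.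
    by rewrite ins_eq.
  rewrite mule0 (_ : [set a | _] = set0) ?measure0//.
  apply/seteqP; split => a //= ab; move/negP: vb; apply; apply/mem_set => j.
  by have := ab (lift ord0 j); rewrite ins_lift mxE.
have e20 : 0 <= (2 * e)%:E by rewrite lee_fin mulr_ge0// ltW.
have mb := measurable_box (col' ord0 q) e.
rewrite ge0_integralZl//; last by apply/measurable_EFinP; exact: measurable_indic.
rewrite integral_indic// setIT exprS [RHS]EFinM.
by congr (_ * _); exact: IH.
Qed.

Lemma lebesgue_bounded_lty n (A : set 'rV[R]_n) (M : R) : measurable A ->
  (forall x, A x -> `|x| <= M)%R -> lam n A < +oo.
Proof.
move=> mA AM; have M0 : (0 < `|M| + 1)%R by rewrite ltr_wpDl.
apply: (@le_lt_trans _ _ (lam n (box 0%R (`|M| + 1)%R))); last first.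
  by rewrite lebesgue_box// ltry.
apply: le_measure; rewrite ?inE//; first exact: measurable_box.
move=> x Ax; apply/box_norm => //; rewrite subr0.
by rewrite (le_lt_trans (AM _ Ax))// (le_lt_trans (ler_norm _))// ltrDl.
Qed.

Lemma lebesgue_open_gt0 n (A : set 'rV[R]_n) x : open A -> A x -> 0 < lam n A.
Proof.
move=> oA Ax; have [e e0 xA] := open_boxP oA Ax.
apply: (@lt_le_trans _ _ (lam n (box x e))).
  by rewrite lebesgue_box// lte_fin exprn_gt0// mulr_gt0.
by apply: le_measure; rewrite ?inE//; [exact: measurable_box|exact: open_measurable_rV].
Qed.

Lemma measurable_affine n d (T : measurableType d) (f : T -> 'rV[R]_n) b c :
  measurable_fun setT f -> measurable_fun setT (fun x => b + dot (f x) c)%R.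
Proof.
move=> mf; apply: measurable_funD => //; rewrite /dot.
by apply: measurable_sum => j; apply: measurable_funM => //; exact: measurable_coord.
Qed.

Lemma measurable_rV_eq0 d (T : measurableType d) (f : T -> R) :
  measurable_fun setT f -> measurable [set x | f x = 0%R].
Proof.
by move=> mf; rewrite -[X in measurable X]setTI; exact: (mf _ [set 0%R]).
Qed.

(** Some [c 0 i] is nonzero, and each line parallel to the axis [i] meets the hyperplane in a single
    point. *)
Lemma lebesgue_hyperplane n b (c : 'rV[R]_n) : c != 0%R ->
  lam n [set x | b + dot x c = 0]%R = 0.
Proof.
move=> c0; have /existsP[i ci] : [exists i, c 0%R i != 0%R].
  rewrite -negb_forall; apply: contra c0 => /forallP c0.
  by apply/eqP/rowP => i; rewrite mxE (eqP (c0 i)).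
case: n b c c0 i ci => [|n] b c c0 i ci; first by case: i ci.
rewrite (lebesgue_ins i); last first.
  by apply: measurable_rV_eq0; apply: measurable_affine.
rewrite integral0_eq// => v _.
apply: (@countable_lebesgue_measure0 R) => //.
rewrite (_ : [set a | _] = [set - (b + dot (ins i 0%R v) c) / c 0%R i]%R); first exact: countable1.
have E a : dot (ins i a v) c = (a * c 0 i + dot (ins i 0 v) c)%R.
  rewrite /dot (bigD1 i)//= [in RHS](bigD1 i)//= !ins_eq mul0r add0r; congr (_ + _)%R.
  apply: eq_bigr => j; rewrite eq_sym => /unlift_some[k -> _].
  by rewrite !ins_lift.
apply/seteqP; split => a /=.
  rewrite [dot (ins i a v) c]E => H; rewrite (_ : (b + _ = - a * c 0 i)%R); first by rewrite -mulNr opprK mulfK.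
  by lra.
by move=> ->; rewrite [dot (ins i (_ / _) v) c]E divfK//; lra.
Qed.

End borel_rV.

(** * Lipschitz functions on an interval *)

Section lipschitz_line.
Variable R : realType.
Local Notation mu := (@lebesgue_measure R).

Lemma stieltjes_itvoc (F : cumulative R R) (a b : R) : a <= b ->
  lebesgue_stieltjes_measure F `]a, b]%classic = (F b - F a)%:E.
Proof.
move=> ab; rewrite /lebesgue_stieltjes_measure /measure_extension/=.
by rewrite measurable_mu_extE/= ?wlength_itv_bnd//; exact: is_ocitv.
Qed.

Lemma lip_right_continuous (F : R -> R) (M : R) :
  (forall x y, `|F x - F y| <= M * `|x - y|) -> right_continuous F.
Proof.
move=> FM; have M0 : 0 <= M.
  have := FM 1 0; rewrite subr0 normr1 mulr1; exact: le_trans.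
apply: right_continuousW => x; apply/cvgrPdist_lt => e e0; near=> y.
rewrite (le_lt_trans (FM _ _))// (@le_lt_trans _ _ ((M + 1) * `|x - y|))//.
  by rewrite ler_wpM2r// lerDl.
rewrite -ltr_pdivlMl ?ltr_wpDl//; near: y.
by apply: cvgr_dist_lt => //; rewrite mulr_gt0// invr_gt0 ltr_wpDl.
Unshelve. all: by end_near. Qed.

(* Both [F] and [M x - F x] are nondecreasing and their Stieltjes measures add up
   to [M] times Lebesgue measure, so that of [F] is absolutely continuous. *)
Lemma lip_density (F : R -> R) (M a b : R) : a < b -> 0 < M ->
  {homo F : x y / x <= y} -> (forall x y, x <= y -> F y - F x <= M * (y - x)) ->
  exists g : R -> R, mu.-integrable setT (EFin \o g) /\
    forall x, a <= x <= b -> (\int[mu]_(t in `]a, x]) (g t)%:E = (F x - F a)%:E)%E.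
Proof.
move=> ab M0 Fnd FM.
have FL x y : `|F x - F y| <= M * `|x - y|.
  wlog xy : x y / x <= y.
    by move=> H; have [/H//|/ltW/H] := leP x y; rewrite distrC [`|y - x|]distrC.
  by rewrite distrC [`|x - y|]distrC !ger0_norm ?subr_ge0 ?FM// Fnd.
have Frc := lip_right_continuous FL.
pose H x := M * x - F x.
have Hnd : {homo H : x y / x <= y} by move=> x y /FM; rewrite /H; lra.
have Hrc : right_continuous H.
  apply: (@lip_right_continuous _ (M + M)) => x y.
  rewrite (_ : H x - H y = M * (x - y) - (F x - F y)); last by rewrite /H; lra.
  by rewrite (le_trans (ler_normB _ _))// mulrDl lerD// normrM gtr0_norm.
pose cF : cumulative R R := HB.pack F (isCumulative.Build R _ R F Fnd Frc).
pose cH : cumulative R R := HB.pack H (isCumulative.Build R _ R H Hnd Hrc).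
pose nu := lebesgue_stieltjes_measure cF.
have Mi0 : 0 <= M^-1 by rewrite invr_ge0 ltW.
pose sm := mscale (NngNum Mi0) (measure_add nu (lebesgue_stieltjes_measure cH)).
have smD A : sm A = (M^-1%:E * (nu A + lebesgue_stieltjes_measure cH A))%E.
  by rewrite -measure_addE.
have smE A : measurable A -> mu A = sm A.
  apply: lebesgue_measure_unique => // X /ocitvP[->|[[x y] /= xy ->]].
    by rewrite !measure0.
  apply: etrans (esym (smD _)); rewrite lebesgue_measure_itv/= lte_fin xy.
  rewrite /nu !stieltjes_itvoc ?ltW//= -EFinD -EFinM ?EFinB /H; congr (_%:E).
  by field; rewrite gt_eqF.
have moo : (nu `]a, b]%classic < +oo)%E by rewrite /nu stieltjes_itvoc ?ltW// ltry.
have mab : measurable (`]a, b]%classic : set (measurableTypeR R)) by [].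
(* The Radon-Nikodym theorem wants a finite measure, hence the restriction to []a, b]]. *)
pose nab := mfrestr mab moo.
have dom : nab `<< mu.
  apply/null_content_dominatesP => A mA A0; have {}A0 := etrans (esym (smE _ mA)) A0.
  have nuA : nu A = 0%E.
    move: (etrans (esym (smD A)) A0) => /eqP.
    rewrite mule_eq0 eqe invr_eq0 gt_eqF//= => /eqP.
    move/eqP; rewrite padde_eq0 ?measure_ge0// => /andP[/eqP + _]; exact.
  apply/eqP; rewrite eq_le; apply/andP; split; last exact: measure_ge0.
  rewrite -nuA; apply: le_measure; rewrite ?inE//; first exact: measurableI.
have [g [g0 gfin gint gE]] := radon_nikodym_sigma_finite dom.
exists (fine \o g); have fg : EFin \o (fine \o g) = g.
  by apply/funext => x /=; rewrite fineK.
split; first by rewrite fg.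
move=> x /andP[ax xb].
transitivity (\int[mu]_(t in `]a, x]) g t)%E.
  by apply: eq_integral => t _; rewrite -[in RHS]fg.
transitivity (nu (`]a, x]%classic `&` `]a, b]%classic)); first exact: esym (gE _ _).
rewrite (_ : _ `&` _ = `]a, x]%classic).
  by rewrite /nu stieltjes_itvoc.
apply/seteqP; split => t /=; rewrite !in_itv/=; first by case.
by move=> /andP[-> tx]; rewrite tx (le_trans tx).
Qed.

(* [lip_density] applies to [f x + M x], clamped outside [[a, b]], as soon as [M]
   exceeds the Lipschitz constant of [f]. *)
Lemma lip_ftc (f g : R -> R) (a b L : R) : a < b ->
  (forall x y, a <= x <= b -> a <= y <= b -> `|f x - f y| <= L * `|x - y|) ->
  measurable_fun (`]a, b[%classic : set (measurableTypeR R)) g ->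
  (forall x, a < x < b -> derivable f x 1 -> g x = derive1 f x) ->
  mu.-negligible [set x | a < x < b /\ ~ derivable f x 1] /\
  (\int[mu]_(x in `]a, b[) (g x)%:E = (f b - f a)%:E)%E.
Proof.
move=> ab fL mg gf.
pose M := `|L| + 1.
have M0 : 0 < M by rewrite ltr_wpDl.
have fM x y : a <= x <= b -> a <= y <= b -> `|f x - f y| <= M * `|x - y|.
  move=> xab yab; rewrite (le_trans (fL _ _ xab yab))// ler_wpM2r//.
  by rewrite (le_trans (ler_norm _))// lerDl.
pose c x := Num.max a (Num.min x b).
have cab x : a <= c x <= b.
  by rewrite /c le_max lexx/= ge_max ltW//= ge_min lexx orbT.
have cnd : {homo c : x y / x <= y}.
  move=> x y xy; rewrite /c ge_max le_max lexx/= le_max; apply/orP; right.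
  by rewrite le_min !ge_min xy lexx !orbT.
have c_id x : a <= x <= b -> c x = x.
  by move=> /andP[ax xb]; rewrite /c min_l// max_r.
have c1 x y : x <= y -> c y - c x <= y - x.
  move=> xy; rewrite /c /Num.max.
  by case: (leP b x) => ?; case: (leP b y) => ?; case: ltP => ?; case: ltP => ?; lra.
pose F x := f (c x) + M * c x.
have Fnd : {homo F : x y / x <= y}.
  move=> x y xy; have := fM (c x) (c y) (cab _) (cab _).
  rewrite (distrC (c x)) (ger0_norm (_ : 0 <= c y - c x)) ?subr_ge0 ?cnd//.
  by rewrite ler_norml /F => /andP[]; lra.
have FM x y : x <= y -> F y - F x <= (M + M) * (y - x).
  move=> xy; have := fM (c x) (c y) (cab _) (cab _).
  rewrite (distrC (c x)) (ger0_norm (_ : 0 <= c y - c x)) ?subr_ge0 ?cnd//.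
  rewrite ler_norml /F => /andP[] H1 H2.
  have := ler_wpM2l (ltW M0) (c1 _ _ xy); lra.
have [g0 [ig0 g0E]] := lip_density ab (addr_gt0 M0 M0) Fnd FM.
have igy y : mu.-integrable `]a, y] (EFin \o g0).
  exact: (integrableS measurableT _ _ ig0).
(* Lebesgue differentiation: off the null set [N] the indefinite integral [G] of [g0] has derivative
   [g0]. Near an interior point [f] is [G] plus the constant [F a] minus [M] times the identity, so
   [f] is differentiable wherever [G] is. *)
have := FTC1 (f := g0) (a := BRight a) igy (open_integrable_locally openT ig0).
move=> /= [N [mN N0 NP]].
pose G y := (\int[mu]_(t in `]a, y]) g0 t)%R.
have der x : a < x < b -> ~ N x -> derivable f x 1 /\ derive1 f x = g0 x - M.
  move=> /andP[ax xb] Nx.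
  have [dG GE] : derivable G x 1 /\ derive1 G x = g0 x.
    by apply: contrapT => H; apply: Nx; apply: NP => /=; move=> /(_ ax).
  have isG : is_derive x 1 G (g0 x) by rewrite -GE derive1E; exact: derivableP.
  have isE : is_derive x 1 (G + (cst (F a) - M *: id)) (g0 x + (0 - M *: 1)).
    exact: is_deriveD.
  have isf : is_derive x 1 f (g0 x + (0 - M *: 1)).
    apply: near_eq_is_derive isE; near=> y.
    have yab : a <= y <= b.
      by apply/andP; split; apply: ltW; near: y; [exact: lt_nbhsr|exact: lt_nbhsl].
    rewrite !fctE /G /Rintegral g0E//= /F !c_id ?lexx ?(ltW ab)//.
    by rewrite /GRing.scale/=; lra.
  split; first by case: isf.
  by rewrite derive1E (@derive_val _ _ _ _ _ _ _ isf) /GRing.scale/= mulr1 sub0r.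
split.
  exists N; split => // x [xab nd]; apply: contrapT => Nx.
  by apply: nd; have [] := der _ xab Nx.
have iab : mu.-integrable `]a, b[ (EFin \o g0).
  by apply: (integrableS measurableT) ig0.
transitivity (\int[mu]_(x in `]a, b[) ((g0 x)%:E - M%:E)%E)%E.
  apply: ae_eq_integral => //.
  - exact/measurable_EFinP.
  - by apply: emeasurable_funB => //; exact: measurable_int iab.
  - exists N; split => // x H; apply: contrapT => Nx; apply: H => xab /=.
    have {}xab : a < x < b by move: xab; rewrite /= in_itv.
    by have [df dE] := der _ xab Nx; rewrite (gf x xab df) dE EFinB.
have icst : mu.-integrable `]a, b[ (EFin \o cst M).
  have muab : (mu `]a, b[%classic < +oo)%E.
    by rewrite lebesgue_measure_itv/= lte_fin ab -EFinB ltry.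
  apply: (measurable_bounded_integrable _ muab) => //.
  exists M; split; first exact: num_real.
  by move=> K MK x _ /=; rewrite gtr0_norm// ltW.
transitivity (\int[mu]_(x in `]a, b[) (g0 x)%:E - \int[mu]_(x in `]a, b[) (cst M x)%:E)%E.
  exact: integralB_EFin.
have -> : (\int[mu]_(x in `]a, b[) (cst M x)%:E = (M * (b - a))%:E)%E.
  transitivity (M%:E * mu `]a, b[%classic)%E; first by rewrite -(integral_cst mu).
  by rewrite lebesgue_measure_itv/= lte_fin ab -EFinB -EFinM.
rewrite integral_itv_bndo_bndc; last exact: measurable_int iab.
rewrite g0E ?lexx ?(ltW ab)// -!EFinB; congr (_%:E).
by rewrite /F !c_id ?lexx ?(ltW ab)//; lra.
Unshelve. all: by end_near. Qed.

End lipschitz_line.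

(** * Simplices *)

Section dot_product.
Variables (R : realType) (d : nat).
Implicit Types u v w : 'rV[R]_d.

Lemma dotC u v : dot u v = dot v u.
Proof. by apply: eq_bigr => i _; rewrite mulrC. Qed.

Lemma dotDl u v w : dot (u + v) w = dot u w + dot v w.
Proof. by rewrite -big_split; apply: eq_bigr => i _; rewrite mxE mulrDl. Qed.

Lemma dotZl a u w : dot (a *: u) w = a * dot u w.
Proof. by rewrite mulr_sumr; apply: eq_bigr => i _; rewrite mxE mulrA. Qed.

Lemma dotNl u w : dot (- u) w = - dot u w.
Proof. by rewrite -scaleN1r dotZl mulN1r. Qed.

Lemma dotBl u v w : dot (u - v) w = dot u w - dot v w.
Proof. by rewrite dotDl dotNl. Qed.

Lemma dot0l w : dot 0 w = 0.
Proof. by rewrite -(scale0r 0) dotZl mul0r. Qed.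

Lemma dotDr u v w : dot w (u + v) = dot w u + dot w v.
Proof. by rewrite dotC dotDl !(dotC w). Qed.

Lemma dotZr a u w : dot w (a *: u) = a * dot w u.
Proof. by rewrite dotC dotZl (dotC w). Qed.

Lemma dotNr u w : dot w (- u) = - dot w u.
Proof. by rewrite dotC dotNl (dotC w). Qed.

Lemma dot_suml (I : finType) (F : I -> 'rV[R]_d) w :
  dot (\sum_i F i) w = \sum_i dot (F i) w.
Proof.
rewrite /dot exchange_big; apply: eq_bigr => j _.
by rewrite summxE mulr_suml.
Qed.

Lemma dot_mul m (t : 'rV[R]_m) (G : 'M[R]_(m, d)) w :
  dot (t *m G) w = \sum_j t 0 j * dot (row j G) w.
Proof.
rewrite mulmx_sum_row dot_suml; apply: eq_bigr => j _; exact: dotZl.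
Qed.

Lemma dot_gt0 u : u != 0 -> 0 < dot u u.
Proof.
move=> u0; have /existsP[i ui] : [exists i, u 0 i != 0].
  rewrite -negb_forall; apply: contra u0 => /forallP u0.
  by apply/eqP/rowP => i; rewrite mxE (eqP (u0 i)).
rewrite /dot (bigD1 i)//= ltr_wpDr//; last by rewrite -expr2 exprn_even_gt0.
by apply: sumr_ge0 => j _; rewrite -expr2 sqr_ge0.
Qed.

End dot_product.

Section barycentric.
Variables (R : realType) (n : nat) (p : 'I_n.+2 -> 'rV[R]_n.+1).

Definition edge_mx : 'M[R]_n.+1 := \matrix_(j < n.+1) (p (lift ord0 j) - p ord0).

(* Gradient of the barycentric coordinate of index [i]; normal to the opposite
   face, pointing inwards. *)
Definition bgrad (i : 'I_n.+2) : 'rV[R]_n.+1 :=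
  oapp (fun j => (col j (invmx edge_mx))^T)
       (- \sum_j (col j (invmx edge_mx))^T) (unlift ord0 i).

Definition bary (i : 'I_n.+2) (x : 'rV[R]_n.+1) : R :=
  (i == ord0)%:R + dot (x - p ord0) (bgrad i).

Lemma bary_add i x v : bary i (x + v) = bary i x + dot v (bgrad i).
Proof. by rewrite /bary -[RHS]addrA -dotDl [x - _ + v]addrAC. Qed.

Lemma sum_bgrad : \sum_i bgrad i = 0.
Proof.
rewrite big_ord_recl /bgrad unlift_none/= addrC; apply/eqP; rewrite subr_eq0; apply/eqP.
by apply: eq_bigr => j _; rewrite liftK.
Qed.

Lemma sum_bary x : \sum_i bary i x = 1.
Proof.
rewrite big_split/= [X in _ + X](_ : _ = 0); last first.
  by under eq_bigr => i _ do rewrite dotC; rewrite -dot_suml sum_bgrad dot0l.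
rewrite (bigD1 ord0)//= big1 ?addr0// => i /negPf i0.
by rewrite i0.
Qed.

Hypothesis pfree : affinely_independent p.

Lemma edge_unit : edge_mx \in unitmx.
Proof. by rewrite -row_free_unit. Qed.

Lemma bary_comb x : \sum_i bary i x *: p i = x.
Proof.
have -> : \sum_i bary i x *: p i = p ord0 + \sum_i bary i x *: (p i - p ord0).
  under [in RHS]eq_bigr do rewrite scalerBr.
  by rewrite sumrB -scaler_suml sum_bary scale1r addrC subrK.
rewrite big_ord_recl subrr scaler0 add0r.
have -> : \sum_(i < n.+1) bary (lift ord0 i) x *: (p (lift ord0 i) - p ord0) =
    ((x - p ord0) *m invmx edge_mx) *m edge_mx.
  rewrite [RHS]mulmx_sum_row; apply: eq_bigr => j _; rewrite rowK; congr (_ *: _).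
  rewrite /bary /bgrad liftK/= add0r mxE.
  by apply: eq_bigr => k _; rewrite !mxE.
by rewrite mulmxKV ?edge_unit// addrC subrK.
Qed.

Lemma bary_affine (w : 'I_n.+2 -> R) i : \sum_k w k = 1 ->
  bary i (\sum_k w k *: p k) = \sum_k w k * bary i (p k).
Proof.
move=> w1; rewrite /bary; under [RHS]eq_bigr do rewrite mulrDr.
rewrite big_split/= -mulr_suml w1 mul1r; congr (_ + _).
under [RHS]eq_bigr do rewrite -dotZl scalerBr.
by rewrite -dot_suml sumrB -scaler_suml w1 scale1r.
Qed.

Lemma bary_vertex i k : bary i (p k) = (i == k)%:R.
Proof.
have E j : bary (lift ord0 j) (p k) = (lift ord0 j == k)%:R.
  rewrite /bary /bgrad liftK/= add0r; case: (unliftP ord0 k) => [l|] ->.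
    rewrite (inj_eq (@lift_inj _ _)).
    transitivity ((edge_mx *m invmx edge_mx) l j).
      by rewrite mxE; apply: eq_bigr => q _; rewrite !mxE.
    by rewrite mulmxV ?edge_unit// mxE eq_sym.
  by rewrite subrr dot0l.
case: (unliftP ord0 i) => [j|] ->; first exact: E.
have := sum_bary (p k); rewrite big_ord_recl.
case: (unliftP ord0 k) E => [l ->|->] E.
  rewrite (bigD1 l)//= big1 ?addr0; last first.
    by move=> j jl; rewrite E (inj_eq (@lift_inj _ _)) (negPf jl).
  by rewrite E eqxx => /(canRL (addrK _)); rewrite subrr => ->.
by rewrite big1 ?addr0// => j _; rewrite E.
Qed.

Lemma bary_uniq (w : 'I_n.+2 -> R) i : \sum_k w k = 1 ->
  bary i (\sum_k w k *: p k) = w i.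
Proof.
move=> w1; rewrite bary_affine// (bigD1 i)//= big1 ?addr0.
  by rewrite bary_vertex eqxx mulr1.
by move=> k /negPf ki; rewrite bary_vertex eq_sym ki mulr0.
Qed.

Lemma hullP (D : pred 'I_n.+2) x :
  hull D p x <-> (forall i, 0 <= bary i x) /\ (forall i, ~~ D i -> bary i x = 0).
Proof.
split=> [[w [w0 wD w1 ->]]|[x0 xD]].
  by split=> i; rewrite bary_uniq//; exact: wD.
by exists (fun i => bary i x); split=> //; rewrite ?sum_bary ?bary_comb.
Qed.

Lemma simplexP x : hull predT p x <-> forall i, 0 <= bary i x.
Proof. by rewrite hullP; split=> [[]//|H]; split. Qed.

Lemma bgrad_vertex i j k : dot (p j - p k) (bgrad i) = (i == j)%:R - (i == k)%:R.
Proof.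
rewrite -!bary_vertex; have := bary_add i (p k) (p j - p k).
by rewrite addrC subrK => ->; rewrite addrAC subrr add0r.
Qed.

Lemma bgrad_neq0 i : bgrad i != 0.
Proof.
apply/eqP => b0; have [k ki] : exists k : 'I_n.+2, k != i.
  by exists (lift i ord0); rewrite eq_sym neq_lift.
have := bgrad_vertex i i k; rewrite b0 dotC dot0l eqxx eq_sym (negPf ki) subr0.
by move/eqP; rewrite eq_sym oner_eq0.
Qed.

Lemma bary_ins i d a v :
  bary i (ins d a v) = bary i (ins d 0 v) + bgrad i 0 d * a.
Proof.
have -> : ins d a v = ins d 0 v + a *: delta_mx 0 d.
  apply/rowP => k; rewrite !mxE eqxx/=; case: (unliftP d k) => [j|] ->.
    by rewrite /= eq_sym (negPf (neq_lift _ _)) mulr0 addr0.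
  by rewrite /= eqxx mulr1 add0r.
rewrite bary_add dotZl mulrC; congr (_ + _ * _).
rewrite /dot (bigD1 d)//= big1 ?addr0; last first.
  by move=> k /negPf kd; rewrite mxE kd andbF mul0r.
by rewrite mxE !eqxx mul1r.
Qed.

Lemma bgrad_coord_neq0 d : exists i, bgrad i 0 d != 0.
Proof.
apply/existsP; rewrite -negb_forall; apply/negP => /forallP b0.
have: bary^~ (ins d 0 0) =1 bary^~ (ins d 1 0).
  by move=> i; rewrite [RHS]bary_ins (eqP (b0 i)) mul0r addr0.
move=> E; have := bary_comb (ins d 0 0); under eq_bigr do rewrite E.
rewrite bary_comb => /rowP/(_ d); rewrite !ins_eq => /eqP.
by rewrite oner_eq0.
Qed.

(** As [n > 0] there is a third vertex [k], and pairing the combination with the edges from [p k] to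
    [p i] and [p j] isolates its two coefficients. Its [d]-th entry is zero by construction, so
    deleting it loses nothing. In dimension one the claim fails, since nothing is left after the
    deletion. *)
Lemma bgrad_independent (d : 'I_n.+1) i j : (0 < n)%N -> i != j ->
  (bgrad i 0 d != 0) || (bgrad j 0 d != 0) ->
  col' d (bgrad i 0 d *: bgrad j - bgrad j 0 d *: bgrad i) != 0.
Proof.
move=> n0 ij; apply: contraTneq => H.
set v := (X in col' d X) in H.
have v0 : v = 0.
  apply/rowP => k; rewrite [RHS]mxE; case: (unliftP d k) => [l|] ->.
    by move/rowP: H => /(_ l); rewrite !mxE.
  by rewrite !mxE mulrC subrr.
have [k [ki kj]] : exists k, k != i /\ k != j.
  have : (0 < #|~: [set i; j]|)%N by rewrite cardsCs finset.setCK cards2 ij card_ord subn_gt0 !ltnS.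
  by case/card_gt0P => k; rewrite !inE negb_or => /andP[]; exists k.
have := congr1 (dot (p j - p k)) v0; have := congr1 (dot (p i - p k)) v0.
rewrite ![dot _ 0]dotC !dot0l /v !dotDr !dotNr !dotZr !bgrad_vertex !eqxx.
rewrite !(eq_sym _ k) (negPf ki) (negPf kj) (negPf ij) eq_sym (negPf ij).
by rewrite !subr0 !mulr1 !mulr0 sub0r subr0 => /eqP; rewrite oppr_eq0 => /eqP -> ->; rewrite eqxx.
Qed.

Definition sint : set 'rV[R]_n.+1 := [set x | forall i, 0 < bary i x].

Definition sface (i : 'I_n.+2) : set 'rV[R]_n.+1 :=
  [set x | bary i x = 0 /\ forall j, j != i -> 0 < bary j x].

Lemma sint_sub x : sint x -> hull predT p x.
Proof. by move=> x0; apply/simplexP => i; exact: ltW. Qed.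

Lemma sface_sub i x : sface i x -> hull predT p x.
Proof.
move=> [xi xj]; apply/simplexP => j; have [->|/xj/ltW//] := eqVneq j i.
by rewrite xi.
Qed.

End barycentric.

(** * Slices of a simplex by a line *)

Section line_slice.
Variable R : realType.

Lemma near_affine_gt0 (q b : R) : 0 < q -> \forall s \near 0^'+, 0 < q + b * s.
Proof.
move=> q0; have b1 : 0 < `|b| + 1 by rewrite ltr_wpDl.
near=> s.
have s0 : 0 < s by near: s; exact: nbhs_right_gt.
have : s < q / (`|b| + 1).
  by near: s; apply: nbhs_right_lt; rewrite divr_gt0.
rewrite ltr_pdivlMr// => sq.
have : - (`|b| * s) <= b * s by rewrite -mulNr ler_pM2r// lerNl ler_normr lexx orbT.
by move: sq; rewrite mulrDr mulr1 mulrC; lra.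
Unshelve. all: by end_near. Qed.

Lemma sum0_pos (I : finType) (c : I -> R) i :
  \sum_i c i = 0 -> c i != 0 -> exists j, 0 < c j.
Proof.
move=> c0 ci; apply: contrapT => H.
have cle j : 0 <= - c j by rewrite oppr_ge0 leNgt; apply/negP => cj; apply: H; exists j.
have : \sum_i (- c i) = 0 by rewrite sumrN c0 oppr0.
move=> /(psumr_eq0P (fun j _ => cle j)) /(_ i isT) /eqP.
by rewrite oppr_eq0 (negPf ci).
Qed.

Variables (I : finType) (alpha c : I -> R).

(* The slice of an open simplex along a line is
   [[set a | forall i, 0 < alpha i + c i * a]]; [lhit i] says that the line crosses
   the relative interior of the face of index [i], at the parameter [lroot i]. *)
Definition lroot i := - alpha i / c i.

Definition lhit i : bool :=
  (c i != 0) && [forall j, (j != i) ==> (0 < alpha j + c j * lroot i)].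

Lemma lrootE i : c i != 0 -> alpha i + c i * lroot i = 0.
Proof. by move=> ci; rewrite /lroot mulrCA divff// mulr1 subrr. Qed.

Lemma lroot_pos i a : 0 < c i -> (0 < alpha i + c i * a) = (lroot i < a).
Proof.
move=> ci; rewrite /lroot ltr_pdivrMr// mulrC.
by apply/idP/idP; lra.
Qed.

Lemma lroot_neg i a : c i < 0 -> (0 < alpha i + c i * a) = (a < lroot i).
Proof.
move=> ci; rewrite /lroot ltr_ndivlMr// mulrC.
by apply/idP/idP; lra.
Qed.

(** A line crossing the relative interior of the face [i] transversally enters the open simplex on
    one side: moving the parameter by [c i * s] raises the coordinate [i] from 0 to [c i ^+ 2 * s],
    and the others stay positive for small [s]. *)
Lemma slice_empty : ~ (exists a, forall i, 0 < alpha i + c i * a) ->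
  forall i, ~~ lhit i.
Proof.
move=> H i; apply/negP => /andP[ci /forallP hi]; apply: H.
have : \forall s \near 0^'+, forall j, 0 < alpha j + c j * (lroot i + c i * s).
  apply: filter_forall => j; have [->|ji] := eqVneq j i.
    near=> s; rewrite mulrDr addrA lrootE// add0r mulrA -expr2.
    by rewrite mulr_gt0 ?exprn_even_gt0//; near: s; exact: nbhs_right_gt.
  have := near_affine_gt0 (c j * c i) (implyP (hi j) ji).
  by apply: filterS => s; rewrite mulrDr mulrA addrA.
by move=> /filter_ex[s Hs]; exists (lroot i + c i * s).
Unshelve. all: by end_near. Qed.

(** The line avoids the intersections of two face hyperplanes: if [c i] and [c j] are both nonzero,
    the parameters [lroot i] and [lroot j] differ; if only one is nonzero, the line does not lie in
    the hyperplane to which it is parallel. *)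
Hypothesis generic : forall i j, i != j -> (c i != 0) || (c j != 0) ->
  c i * alpha j - c j * alpha i != 0.
Hypothesis c_sum : \sum_i c i = 0.
Hypothesis c_neq0 : exists i, c i != 0.

Lemma lroot_inj i j : c i != 0 -> c j != 0 -> lroot i = lroot j -> i = j.
Proof.
move=> ci cj; apply: contra_eq => ij; have := generic ij; rewrite ci => /(_ isT).
apply: contra_neq; rewrite /lroot => E.
have : (- alpha i / c i) * (c i * c j) = (- alpha j / c j) * (c i * c j) by rewrite E.
rewrite mulrA divfK// [c i * _]mulrC mulrA divfK//; lra.
Qed.

(** Coordinates with positive slope bound the parameter from below and those with negative slope
    from above; since the slopes sum to zero and do not all vanish, both kinds occur. The entry [ip]
    is the largest root of the first kind and the exit [im] the smallest of the second. Genericity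
    makes both strict, so these are the only two faces hit. *)
Lemma slice_itv a0 : (forall i, 0 < alpha i + c i * a0) ->
  exists ip im, [/\ 0 < c ip, c im < 0, lroot ip < lroot im,
    forall i, lhit i = (i == ip) || (i == im) &
    forall a, (forall i, 0 < alpha i + c i * a) <-> lroot ip < a < lroot im].
Proof.
move=> a0P; have [i0 ci0] := c_neq0.
have [p0 cp0] := sum0_pos c_sum ci0.
have [m0 cm0] : exists j, c j < 0.
  have : \sum_i (- c i) = 0 by rewrite sumrN c_sum oppr0.
  move=> /(@sum0_pos _ (fun i => - c i) i0) []; first by rewrite oppr_eq0.
  by move=> j; rewrite oppr_gt0; exists j.
case: (@arg_maxP _ _ _ p0 (fun i => 0 < c i) lroot cp0) => ip cip ipP'.
case: (@arg_minP _ _ _ m0 (fun i => c i < 0) lroot cm0) => im cim imP'.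
have ipP j : 0 < c j -> lroot j <= lroot ip := ipP' j.
have imP j : c j < 0 -> lroot im <= lroot j := imP' j.
have ipa : lroot ip < a0 by rewrite -lroot_pos.
have aim : a0 < lroot im by rewrite -lroot_neg.
have ipim := lt_trans ipa aim.
have sliceP a : (forall i, 0 < alpha i + c i * a) <-> lroot ip < a < lroot im.
  split=> [H|/andP[pa am] i]; first by rewrite -lroot_pos// -lroot_neg// !H.
  have [ci|ci|ci] := ltgtP (c i) 0.
  - by rewrite lroot_neg// (lt_le_trans am)// imP.
  - by rewrite lroot_pos// (le_lt_trans _ pa)// ipP.
  - by have := a0P i; rewrite ci !mul0r.
exists ip, im; split=> // i.
apply/idP/idP => [/andP[ci /forallP hi]|/orP[/eqP->|/eqP->]].
- have [cn|cp|/eqP] := ltgtP (c i) 0; last by rewrite (negPf ci).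
    apply/orP; right; apply/eqP; apply: contrapT => /eqP iim.
    have := implyP (hi im); rewrite eq_sym => /(_ iim); rewrite lroot_neg//.
    by rewrite ltNge imP.
  apply/orP; left; apply/eqP; apply: contrapT => /eqP iip.
  have := implyP (hi ip); rewrite eq_sym => /(_ iip); rewrite lroot_pos//.
  by rewrite ltNge ipP.
- rewrite /lhit gt_eqF//=; apply/forallP => j; apply/implyP => jip.
  have [cj|cj|cj] := ltgtP (c j) 0.
  + by rewrite lroot_neg// (lt_le_trans ipim)// imP.
  + rewrite lroot_pos// lt_neqAle ipP// andbT; apply: contra jip => /eqP E.
    by apply/eqP; apply: lroot_inj => //; rewrite gt_eqF.
  + by have := a0P j; rewrite cj !mul0r.
- rewrite /lhit lt_eqF//=; apply/forallP => j; apply/implyP => jim.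
  have [cj|cj|cj] := ltgtP (c j) 0.
  + rewrite lroot_neg// lt_neqAle imP// andbT; apply: contra jim => /eqP E.
    by apply/eqP; apply: lroot_inj => //; rewrite lt_eqF.
  + by rewrite lroot_pos// (le_lt_trans _ ipim)// ipP.
  + by have := a0P j; rewrite cj !mul0r.
Qed.

End line_slice.

(** * Partial derivatives of Lipschitz functions *)

Section mcshane.
Variables (R : realType) (n : nat).
Implicit Types (K : set 'rV[R]_n) (f : 'rV[R]_n -> R).

(** The extension is the infimum over [y] in [K] of [f y + M * |x - y|]. It lets the difference
    quotients below be formed at every point and for every increment, although a field is Lipschitz
    only on a closed simplex. *)
Lemma mcshane_extension K f L x0 : K x0 -> lip_on K L f ->
  exists M F, lip_on setT M F /\ forall x, K x -> F x = f x.
Proof.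
move=> Kx0 fL0; pose M := `|L|; have M0 : 0 <= M by exact: normr_ge0.
exists M.
have fL : lip_on K M f by exact: lip_onW (ler_norm _) fL0.
pose S x := [set f y + M * `|x - y| | y in K].
have S0 x : S x !=set0 by exists (f x0 + M * `|x - x0|), x0.
have Slb x : has_lbound (S x).
  exists (f x0 - M * `|x - x0|) => _ [y Ky <-].
  have := fL _ _ Kx0 Ky; rewrite ler_norml => /andP[_ H].
  have : M * `|x0 - y| <= M * (`|x - x0| + `|x - y|).
    by apply: ler_wpM2l => //; rewrite [`|x - x0|]distrC; exact: ler_distD.
  by rewrite mulrDr; lra.
exists (fun x => inf (S x)); split.
  have half x y : inf (S x) - inf (S y) <= M * `|x - y|.
    suff : inf (S x) - M * `|x - y| <= inf (S y) by lra.
    apply: lb_le_inf => // _ [z Kz <-].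
    have : inf (S x) <= f z + M * `|x - z| by apply: ge_inf => //; exists z.
    have : M * `|x - z| <= M * (`|x - y| + `|y - z|).
      by apply: ler_wpM2l => //; exact: ler_distD.
    by rewrite mulrDr; lra.
  move=> x y _ _; rewrite ler_norml half andbT.
  by have := half y x; rewrite distrC; lra.
move=> x Kx; apply/eqP; rewrite eq_le; apply/andP; split.
  by apply: ge_inf => //; exists x => //; rewrite subrr normr0 mulr0 addr0.
apply: lb_le_inf => // _ [y Ky <-].
have := fL _ _ Kx Ky; rewrite ler_norml => /andP[_]; lra.
Qed.

End mcshane.

Section rademacher_coordinate.
Variables (R : realType) (n : nat) (d : 'I_n.+1).
Local Notation lam := (lebesgue_rV R n.+1).
Local Notation mu := (@lebesgue_measure R).
Let e : 'rV[R]_n.+1 := delta_mx 0 d.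

Lemma ins_shift (h a : R) (v : 'rV[R]_n) : h *: e + ins d a v = ins d (h + a) v.
Proof.
apply/rowP => k; rewrite !mxE eqxx/=; case: (unliftP d k) => [j|] ->.
  by rewrite /= eq_sym (negPf (neq_lift _ _)) mulr0 add0r.
by rewrite /= eqxx mulr1.
Qed.

Lemma growth_ins (f : 'rV[R]_n.+1 -> R) (a : R) (v : 'rV[R]_n) :
  (fun h : R => h^-1 *: ((f \o shift (ins d a v)) (h *: e) - f (ins d a v))) =
  (fun h : R => h^-1 *: (((fun s => f (ins d s v)) \o shift a) (h *: (1 : R))
     - (fun s => f (ins d s v)) a)).
Proof. by apply/funext => h /=; rewrite ins_shift /GRing.scale/= mulr1. Qed.

Lemma derivable_ins (f : 'rV[R]_n.+1 -> R) a v :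
  derivable f (ins d a v) e <-> derivable (fun s => f (ins d s v)) a 1.
Proof. by rewrite /derivable growth_ins. Qed.

Lemma partial_ins (f : 'rV[R]_n.+1 -> R) a v :
  partial d f (ins d a v) = derive1 (fun s => f (ins d s v)) a.
Proof. by rewrite derive1E /partial /derive growth_ins. Qed.

Lemma norm_e : `|e| <= 1.
Proof.
rewrite leNgt; apply/negP => H.
have [i] := mx_norm_neq0 (lt0r_neq0 (lt_trans ltr01 H) : mx_norm e != 0).
move=> E; move: H; rewrite {1}/Num.norm/= E /e mxE.
by case: (_ && _); rewrite ?normr1 ?normr0 ?ltxx// ltNge ler01.
Qed.

Lemma lip_closed_le (L c : R) (w : 'rV[R]_n.+1 -> R) :
  lip_on setT L w -> closed [set x | w x <= c].
Proof.
move=> wL0; pose M := `|L| + 1.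
have M0 : 0 < M by rewrite ltr_wpDl.
have wL : lip_on setT M w.
  by apply: lip_onW wL0; rewrite (le_trans (ler_norm _))// lerDl.
rewrite (_ : [set x | _] = ~` [set x | c < w x]); last first.
  by apply/seteqP; split => x /=; rewrite leNgt => /negP.
apply: open_closedC; rewrite openE => x /= cx.
have dM : 0 < (w x - c) / M by rewrite divr_gt0// subr_gt0.
apply/nbhs_ballP; exists ((w x - c) / M) => //= y.
rewrite -ball_normE/= ltr_pdivlMr// mulrC => xy.
have := le_lt_trans (wL x y I I) xy; rewrite ltr_norml => /andP[_]; lra.
Qed.

Variables (L : R) (F : 'rV[R]_n.+1 -> R).
Hypothesis FL : lip_on setT L F.

Let q h x : R := h^-1 *: ((F \o shift x) (h *: e) - F x).

Let L_ge0 : 0 <= L.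
Proof.
have [//|L0] := leP 0 L; have := FL (x := 0) (y := e) I I.
move=> /(le_trans (normr_ge0 _)); rewrite sub0r normrN.
have : 0 < `|e|.
  rewrite normr_gt0; apply/eqP => /rowP/(_ d); rewrite !mxE !eqxx => /eqP.
  by rewrite oner_eq0.
by move=> e0; rewrite pmulr_lge0// => /(lt_le_trans L0); rewrite ltxx.
Qed.

Let q_le h x : `|q h x| <= L.
Proof.
rewrite /q /GRing.scale/= normrM normfV.
have [->|h0] := eqVneq h 0; first by rewrite normr0 invr0 mul0r.
rewrite ler_pdivrMl ?normr_gt0// mulrC.
have := FL (x := h *: e + x) (y := x) I I; rewrite addrK normrZ => /le_trans; apply.
by rewrite ler_wpM2l// ler_piMr// norm_e.
Qed.

Let q_lip h : lip_on setT (`|h|^-1 * (L + L)) (q h).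
Proof.
move=> x y _ _; rewrite /q /GRing.scale/= -mulrBr normrM normfV -mulrA.
rewrite ler_wpM2l ?invr_ge0// mulrDl.
have := FL (x := h *: e + x) (y := h *: e + y) I I.
rewrite opprD addrACA subrr add0r.
have := FL (x := x) (y := y) I I.
set a := F x; set b := F y; set a' := F (_ + x); set b' := F (_ + y) => H1 H2.
rewrite (_ : a' - a - (b' - b) = (a' - b') - (a - b)); last by lra.
by rewrite (le_trans (ler_normB _ _))// lerD.
Qed.

Definition diff_set : set 'rV[R]_n.+1 := [set x | derivable F x e].

(** The Cauchy criterion for difference quotients, with countable parameters. For fixed [h] and [h']
    the condition is closed in [x], so differentiability holds on a countable intersection of
    countable unions of closed sets, a Borel set. *)
Let Apm (p m : nat) : set 'rV[R]_n.+1 :=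
  [set x | forall h h', 0 < `|h| < m.+1%:R^-1 -> 0 < `|h'| < m.+1%:R^-1 ->
     `|q h x - q h' x| <= p.+1%:R^-1].

Let diff_setE : diff_set = \bigcap_p \bigcup_m Apm p m.
Proof.
apply/seteqP; split => x.
  move=> /cauchy_cvgP /cauchyP cx p _.
  have p0 : 0 < p.+1%:R^-1 / 2 :> R by rewrite divr_gt0// invr_gt0.
  have [l] := cx _ p0; rewrite /= => -[r /= r0 Hr].
  have [m] := near_infty_natSinv_lt (PosNum r0); move=> _ /(_ m (leqnn m)) /= mr.
  exists m => // h h' /andP[h0 hm] /andP[h'0 h'm].
  have near_l k : 0 < `|k| -> `|k| < m.+1%:R^-1 -> `|l - q k x| < p.+1%:R^-1 / 2.
    move=> k0 km; have := Hr k; rewrite /ball/= sub0r normrN; apply.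
      exact: lt_trans mr.
    by rewrite -normr_gt0.
  have := near_l _ h0 hm; have := near_l _ h'0 h'm; rewrite (distrC l (q h x)) => H1 H2.
  by rewrite (le_trans (ler_distD l _ _))// (splitr p.+1%:R^-1) lerD// ltW.
move=> H; apply/cauchy_cvgP/cauchyP => eps eps0.
have [p] := near_infty_natSinv_lt (PosNum eps0); move=> _ /(_ p (leqnn p)) /= peps.
have [m _ mP] := H p I.
have m0 : 0 < m.+1%:R^-1 :> R by rewrite invr_gt0.
(* Any quotient with an admissible increment serves as an approximate limit; half of the bound keeps
   the increment strictly below it. *)
exists (q (m.+1%:R^-1 / 2) x); near=> h.
rewrite /ball/=; apply: le_lt_trans peps; apply: mP.
  by rewrite gtr0_norm ?divr_gt0//= ltr_pdivrMr// ltr_pMr// ltr1n.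
apply/andP; split; first by rewrite normr_gt0; near: h; exact: nbhs_dnbhs_neq.
by near: h; exact: dnbhs0_lt.
Unshelve. all: by end_near. Qed.

Lemma measurable_diff_set : measurable diff_set.
Proof.
rewrite diff_setE; apply: bigcapT_measurable => p; apply: bigcupT_measurable => m.
apply: closed_measurable_rV.
rewrite (_ : Apm p m = \bigcap_(h in [set h : R * R | 0 < `|h.1| < m.+1%:R^-1 /\
    0 < `|h.2| < m.+1%:R^-1]) [set x | `|q h.1 x - q h.2 x| <= p.+1%:R^-1]).
  apply: closed_bigI => -[h h'] _ /=.
  apply: (@lip_closed_le (`|h|^-1 * (L + L) + `|h'|^-1 * (L + L))) => x y _ _.
  rewrite (le_trans (ler_dist_dist _ _))// mulrDl.
  have := @q_lip h x y I I; have := @q_lip h' x y I I.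
  move=> H1 H2; rewrite (_ : _ - _ - _ = (q h x - q h y) - (q h' x - q h' y)); last by lra.
  by rewrite (le_trans (ler_normB _ _))// lerD.
by apply/seteqP; split => x H; [move=> [h h'] []; exact: H|move=> h h' hm h'm; exact: (H (h, h'))].
Qed.

(** Put to zero where the limit does not exist, which makes it Borel and bounded on the whole
    space. *)
Definition pder : 'rV[R]_n.+1 -> R := partial d F \_ diff_set.

Lemma pderE x : diff_set x -> pder x = partial d F x.
Proof. by move=> Dx; rewrite /pder patchE mem_set. Qed.

Lemma pder_le x : `|pder x| <= L.
Proof.
rewrite /pder patchE; case: ifPn => [/set_mem Dx|_]; last by rewrite normr0.
rewrite leNgt; apply/negP => H.
have := @cvgr_dist_lt _ _ _ _ _ _ _ Dx (`|partial d F x| - L).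
rewrite subr_gt0 => /(_ _ H) /filter_ex[h /=] ; rewrite -/(q h x) => hx.
have := q_le h x; have := lerB_dist (partial d F x) (q h x).
by move: hx; rewrite /partial /derive; set l := lim _; lra.
Qed.

Lemma measurable_pder : measurable_fun setT pder.
Proof.
apply/(measurable_restrictT _ measurable_diff_set).
apply: (@measurable_fun_cvg _ _ _ _ (fun m => q m.+1%:R^-1)).
  move=> m; apply: measurable_funS (lip_on_measurable measurableT (@q_lip _)) => //.
move=> x Dx; apply/cvgrPdist_lt => eps eps0.
have [r /= r0 Hr] := @cvgr_dist_lt _ _ _ _ _ _ _ Dx eps eps0.
have := near_infty_natSinv_lt (PosNum r0); apply: filterS => m /= mr.
have m0 : 0 < m.+1%:R^-1 :> R by rewrite invr_gt0.
apply: Hr; last by rewrite gt_eqF.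
by rewrite /ball/= sub0r normrN gtr0_norm.
Qed.

(** Fubini along the axis [d], available because [diff_set] is Borel: on each line parallel to the
    axis, [lip_ftc] gives differentiability almost everywhere. *)
Lemma diff_set_negligible : lam (~` diff_set) = 0%E.
Proof.
have mD := measurable_diff_set.
rewrite (lebesgue_ins d); last exact: measurableC.
rewrite integral0_eq// => v _.
set S := [set a | _].
have mS : measurable (S : set (measurableTypeR R)).
  rewrite -[X in measurable X]setTI.
  by apply: (@measurable_ins_fun R n d _ _ id (cst v)) => //; exact: measurableC.
apply/(negligibleP _ mS).
pose f a := F (ins d a v).
have fL x y : `|f x - f y| <= L * `|x - y|.
  rewrite (le_trans (FL I I))//; apply: ler_wpM2l => //.
  rewrite (_ : _ - _ = (x - y) *: e); last first.
    by rewrite -{1}(subrK y x) -ins_shift addrK.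
  by rewrite normrZ ler_piMr// norm_e.
(* [lip_ftc] speaks of bounded intervals, so the line is exhausted by countably many of them. *)
apply: (@negligibleS _ _ _ mu
    (\bigcup_k [set a | - k.+1%:R < a < k.+1%:R /\ ~ derivable f a 1])).
  move=> a Sa; exists (Num.truncn `|a|); first exact: I.
  split.
    by rewrite -ltr_norml truncnS_gt.
  by move=> Da; apply: Sa; apply/derivable_ins.
apply: negligible_bigcup => k.
have k0 : - k.+1%:R < k.+1%:R :> R.
  by rewrite (@lt_trans _ _ 0) ?ltr0n// oppr_lt0 ltr0n.
have [] // := @lip_ftc R f (fun a => pder (ins d a v)) (- k.+1%:R) k.+1%:R L k0.
- apply: measurable_funTS; apply: (measurableT_comp measurable_pder).
  exact: measurable_ins_fun.
- by move=> x _ dx; rewrite pderE; [exact: partial_ins|exact/derivable_ins].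
Qed.

End rademacher_coordinate.

Section fubini_insertion.
Variable R : realType.
Local Notation lam := (lebesgue_rV R).
Local Notation mu := (@lebesgue_measure R).
Local Open Scope ereal_scope.

Lemma bounded_integrable n (g : 'rV[R]_n -> R) (C B : R) :
  measurable_fun setT g -> (forall x, `|g x| <= C)%R ->
  (forall x, g x != 0 -> `|x| <= B)%R -> (lam n).-integrable setT (EFin \o g).
Proof.
move=> mg gC gB; have B0 : (0 < `|B| + 1)%R by rewrite ltr_wpDl.
have mb := measurable_box (0 : 'rV[R]_n)%R (`|B| + 1)%R.
apply: (@le_integrable _ _ _ _ _ measurableT _ (EFin \o (fun x => C * \1_(box 0%R (`|B| + 1)%R) x)%R)).
- exact/measurable_EFinP.
- move=> x _; rewrite lee_fin; have [->|gx] := eqVneq (g x) 0%R.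
    by rewrite normr0.
  rewrite indicE mem_set; last first.
    apply/box_norm => //; rewrite subr0 (le_lt_trans (gB _ gx))//.
    by rewrite (le_lt_trans (ler_norm _))// ltrDl.
  by rewrite mulr1 (le_trans (gC x))// ler_norm.
- rewrite (_ : _ \o _ = (fun x => C%:E * (\1_(box 0%R (`|B| + 1)%R) x)%:E)); last first.
    by apply/funext => x /=; rewrite EFinM.
  apply: integrableZl => //; apply/integrableP; split.
    by apply/measurable_EFinP; exact: measurable_indic.
  under eq_integral => x _ do rewrite gee0_abs ?lee_fin//.
  rewrite integral_indic// setIT.
  apply: le_lt_trans (_ : lam n (box 0%R (`|B| + 1)%R) < +oo); first by [].
  by rewrite lebesgue_box// ltry.
Qed.

Lemma fubini_ins n (d : 'I_n.+1) (F : 'rV[R]_n.+1 -> \bar R) :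
  (lam n.+1).-integrable setT F ->
  measurable_fun setT (fun v => \int[mu]_a F (ins d a v)) /\
  \int[lam n.+1]_x F x = \int[lam n]_v \int[mu]_a F (ins d a v).
Proof.
move=> iF; have mF : measurable_fun setT F := measurable_int _ iF.
pose phi (q : 'rV[R]_n * measurableTypeR R) := ins d q.2 q.1.
have mphi : measurable_fun setT phi := @measurable_ins R n d.
have mFphi : measurable_fun setT (F \o phi) by exact: (measurableT_comp mF mphi).
have iFphi : (lam n \x mu).-integrable setT (F \o phi).
  apply/integrableP; split => //; move/integrableP : iF => [_]; apply: le_lt_trans.
  rewrite (tonelli_ins d (f := fun x => `|F x|))//; last exact: measurableT_comp.
  rewrite (fubini_tonelli1 (fun q => `|F (phi q)|))//.
  by apply: measurableT_comp.
split; first exact: (measurable_fubini_F iFphi).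
transitivity (\int[lam n \x mu]_q F (phi q)); last first.
  exact: (esym (integral12_prod_meas1 iFphi)).
pose nu := measure_function_pushforward__canonical__measure_function_Measure
  (lam n \x mu) mphi.
transitivity (\int[nu]_x F x); last first.
  exact: (integral_pushforward mphi mF (D := setT) iFphi measurableT).
apply: eq_measure_integral.
move=> A mA _; apply: etrans (lebesgue_ins d mA) _.
rewrite /pushforward /= /product_measure1; apply: eq_integral => v _ /=.
congr (lebesgue_measure _); by apply/seteqP; split => a /=; rewrite /xsection/= inE.
Qed.

End fubini_insertion.

(** * Integral of a partial derivative over a simplex *)

Section simplex_ftc.
Variables (R : realType) (n : nat) (n_gt0 : (0 < n)%N) (d : 'I_n.+1).
Variables (p : 'I_n.+2 -> 'rV[R]_n.+1) (pfree : affinely_independent p).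
Local Notation lam := (lebesgue_rV R).
Local Notation mu := (@lebesgue_measure R).

Lemma hull_bounded x : hull predT p x -> `|x| <= \sum_i `|p i|.
Proof.
move=> /(simplexP pfree) x0; rewrite -{1}(bary_comb pfree x).
rewrite (le_trans (ler_norm_sum _ _ _))//; apply: ler_sum => i _.
rewrite normrZ ler_piMl// ger0_norm// -(sum_bary p x) (bigD1 i)//= lerDl.
by apply: sumr_ge0.
Qed.

Lemma measurable_bary i e (T : measurableType e) (f : T -> 'rV[R]_n.+1) :
  measurable_fun setT f -> measurable_fun setT (fun x => bary p i (f x)).
Proof.
move=> mf; rewrite (_ : (fun x => _) =
    fun x => ((i == ord0)%:R - dot (p ord0) (bgrad p i)) + dot (f x) (bgrad p i)).
  exact: measurable_affine.
by apply/funext => x; rewrite /bary dotBl; lra.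
Qed.

Lemma measurable_hull : measurable (hull predT p).
Proof.
rewrite (_ : hull predT p = \bigcap_(i in [set: 'I_n.+2]) ~` [set x | bary p i x < 0]).
  apply: fin_bigcap_measurable => // i _; apply: measurableC.
  by apply: measurable_rV_lt => //; exact: (measurable_bary i (f := id)).
apply/seteqP; split => x.
  by move=> /(simplexP pfree) x0 i _ /=; rewrite ltNge x0.
by move=> H; apply/(simplexP pfree) => i; rewrite leNgt; apply/negP; exact: H.
Qed.

Lemma measurable_sint : measurable (sint p).
Proof.
rewrite (_ : sint p = \bigcap_(i in [set: 'I_n.+2]) [set x | 0 < bary p i x]).
  apply: fin_bigcap_measurable => // i _; apply: measurable_rV_lt => //.
  exact: (measurable_bary i (f := id)).
by apply/seteqP; split => x H i; [move=> _; exact: H|exact: H].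
Qed.

Lemma measurable_sface i : measurable (sface p i).
Proof.
rewrite (_ : sface p i = [set x | bary p i x = 0] `&`
    \bigcap_(j in [set j : 'I_n.+2 | j != i]) [set x | 0 < bary p j x]).
  apply: measurableI.
    by apply: measurable_rV_eq0; exact: (measurable_bary i (f := id)).
  apply: fin_bigcap_measurable => [|j _].
    exact: finite_finset.
  apply: measurable_rV_lt => //; exact: (measurable_bary j (f := id)).
by apply/seteqP; split => x [x0 H]; split.
Qed.

Let c i := bgrad p i 0 d.
Let alpha v i := bary p i (ins d 0 v).
(* The point above [v], in direction [d], of the hyperplane of the face [i]. *)
Definition flift i (v : 'rV[R]_n) := ins d (lroot (alpha v) c i) v.

Lemma bary_line j a v : bary p j (ins d a v) = alpha v j + c j * a.
Proof. exact: bary_ins. Qed.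

Lemma bary_flift i v : c i != 0 -> bary p i (flift i v) = 0.
Proof. by move=> ci; rewrite bary_line lrootE. Qed.

Lemma lhitP v i : reflect (c i != 0 /\ sface p i (flift i v)) (lhit (alpha v) c i).
Proof.
apply: (iffP andP) => -[ci].
  move=> /forallP H; split=> //; split=> [|j ji]; first exact: bary_flift.
  by rewrite bary_line; exact: (implyP (H j)).
move=> [_ H]; split=> //; apply/forallP => j; apply/implyP => ji.
by rewrite -bary_line; exact: H.
Qed.

Lemma flift_uniq i v a : c i != 0 -> bary p i (ins d a v) = 0 -> flift i v = ins d a v.
Proof.
move=> ci; rewrite bary_line => H; congr ins; rewrite /lroot.
apply: (mulIf ci); rewrite divfK// mulrC; lra.
Qed.

Variable f : 'rV[R]_n.+1 -> R.

(** The values of [f] on the face [i], read on the projection of the face along the axis [d]. It is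
    zero where the line above [v] misses the relative interior of the face, and identically zero for
    a face parallel to the axis. *)
Definition ftrace i (v : 'rV[R]_n) : R :=
  if lhit (alpha v) c i then f (flift i v) else 0.

Variable L : R.
Hypothesis fL : lip_on (hull predT p) L f.

Lemma lip_bounded : exists C, forall x, hull predT p x -> `|f x| <= C.
Proof.
pose B := \sum_i `|p i|; exists (`|f (p ord0)| + `|L| * (B + B)) => x Kx.
have Kp : hull predT p (p ord0).
  by apply/(simplexP pfree) => i; rewrite bary_vertex// ler0n.
have -> : f x = f (p ord0) + (f x - f (p ord0)) by lra.
rewrite (le_trans (ler_normD _ _))// lerD2l (le_trans (fL Kx Kp))//.
rewrite (@le_trans _ _ (`|L| * `|x - p ord0|))//; first by rewrite ler_wpM2r// ler_norm.
apply: ler_wpM2l => //; rewrite (le_trans (ler_normB _ _))// lerD//; exact: hull_bounded.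
Qed.

Lemma measurable_flift i : measurable_fun setT (flift i).
Proof.
apply: measurable_ins_fun => //; rewrite /lroot; apply: measurable_funM => //.
by apply: measurableT_comp => //; apply: measurable_bary; exact: measurable_ins_fun.
Qed.

Lemma measurable_ftrace i : measurable_fun setT (ftrace i).
Proof.
rewrite (_ : ftrace i = fun v => (c i != 0)%:R * \1_(sface p i) (flift i v)
   * (f \_ (hull predT p)) (flift i v)).
  apply: measurable_funM.
    apply: measurable_funM => //; apply: (measurableT_comp _ (measurable_flift i)).
    by apply: measurable_indic; exact: measurable_sface.
  apply: (measurableT_comp _ (measurable_flift i)).
  apply/(measurable_restrictT _ measurable_hull).
  exact: lip_on_measurable measurable_hull fL.
apply/funext => v; rewrite /ftrace indicE.
case: (lhitP v i) => [[-> Hv]|H].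
  by rewrite mem_set// !mul1r patchE mem_set//; exact: sface_sub Hv.
have [ci|] := boolP (c i != 0); last by rewrite !mul0r.
by rewrite memNset ?mulr0 ?mul0r// => Hv; apply: H.
Qed.

Lemma integrable_ftrace i : (lam n).-integrable setT (EFin \o ftrace i).
Proof.
have [C HC] := lip_bounded.
apply: (@bounded_integrable _ _ _ (`|C|) (\sum_i `|p i|) (measurable_ftrace i)).
  move=> v; rewrite /ftrace; case: lhitP => [[_ H]|_]; last by rewrite normr0.
  by rewrite (le_trans _ (ler_norm _))// HC//; exact: sface_sub H.
move=> v; rewrite /ftrace; case: lhitP => [[_ H] _|]; last by rewrite eqxx.
apply: le_trans (hull_bounded (sface_sub pfree H)); rewrite /flift.
set a := lroot _ _ _; rewrite leNgt; apply/negP => av.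
have : `|v| < `|v|.
  apply/rV_normP; first exact: le_lt_trans av.
  by move=> j; rewrite -(ins_lift d a v); apply: le_lt_trans av; exact: rV_coord_le.
by rewrite ltxx.
Qed.

Definition line_generic (v : 'rV[R]_n) := forall i j, i != j ->
  (c i != 0) || (c j != 0) -> c i * alpha v j - c j * alpha v i != 0.

(** For each pair of faces the exceptional [v] fill a hyperplane of R^n, whose normal vector is
    nonzero by [bgrad_independent]. *)
Lemma line_generic_ae : (lam n).-negligible (~` [set v | line_generic v]).
Proof.
pose S (ij : 'I_n.+2 * 'I_n.+2) : set 'rV[R]_n :=
  if (ij.1 != ij.2) && ((c ij.1 != 0) || (c ij.2 != 0)) then
    [set v | c ij.1 * alpha v ij.2 - c ij.2 * alpha v ij.1 = 0] else set0.
apply: (@negligibleS _ _ _ (lam n)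
    (\bigcup_k (if @unpickle ('I_n.+2 * 'I_n.+2)%type k is Some ij then S ij else set0))).
  move=> v /= /existsNP[i /existsNP[j]] /not_implyP[ij] /not_implyP[cij].
  move=> /negP/negPn/eqP E; exists (pickle (i, j)) => //.
  by rewrite pickleK /S/= ij cij.
apply: negligible_bigcup => k; case: unpickle => [[i j]|]; last exact: negligible_set0.
rewrite /S/=; case: ifPn => [/andP[ij cij]|_]; last exact: negligible_set0.
have H := bgrad_independent pfree n_gt0 ij cij.
set w := c i *: bgrad p j - c j *: bgrad p i in H.
pose wc : 'rV[R]_n := col' d w.
apply/negligibleP.
  apply: measurable_rV_eq0; apply: measurable_funB; apply: measurable_funM => //;
  by apply: measurable_bary; exact: measurable_ins_fun.
pose b := c i * ((j == ord0)%:R - dot (p ord0) (bgrad p j)) -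
  c j * ((i == ord0)%:R - dot (p ord0) (bgrad p i)).
rewrite -[RHS](@lebesgue_hyperplane R n b wc H); congr (lam n _).
apply/funext => v; apply/propext.
have E : dot v wc = c i * dot (ins d 0 v) (bgrad p j) - c j * dot (ins d 0 v) (bgrad p i).
  rewrite -dotZr -dotZr -dotNr -dotDr -/w /dot (bigD1_ord d)//= ins_eq mul0r add0r.
  by apply: eq_bigr => k' _; rewrite ins_lift mxE.
by rewrite /= E /alpha /bary !dotBl /b; split; lra.
Qed.

Variables (M : R) (F : 'rV[R]_n.+1 -> R).
Hypothesis FM : lip_on setT M F.
Hypothesis Ff : forall x, hull predT p x -> F x = f x.

(** The slice is one interval, so the integral is the value at the exit minus the value at the
    entry. As [bgrad] points inwards, [- Num.sg (c i)] is the sign of the [d]-th component of the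
    outward normal: -1 at the entry, +1 at the exit. *)
Lemma line_integral v : line_generic v ->
  (\int[mu]_a (pder d F (ins d a v) * \1_(sint p) (ins d a v))%:E =
   (\sum_i - Num.sg (c i) * ftrace i v)%:E)%E.
Proof.
move=> vgen.
have sc : \sum_i c i = 0.
  by have := congr1 (fun w : 'rV_n.+1 => w 0 d) (sum_bgrad p); rewrite summxE mxE.
have cn0 : exists i, c i != 0 by exact: bgrad_coord_neq0.
have [[a0 a0P]|H] := pselect (exists a, forall i, 0 < alpha v i + c i * a); last first.
  rewrite integral0_eq; last first.
    move=> a _; rewrite indicE memNset ?mulr0// => Ha; apply: H; exists a => i.
    by rewrite -bary_line; exact: Ha.
  rewrite big1// => i _; rewrite /ftrace.
  by rewrite (negPf (slice_empty H i)) mulr0.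
have [ip [im [cip cim r12 hitE sliceE]]] := slice_itv vgen sc cn0 a0P.
set r1 := lroot _ _ ip in r12 sliceE; set r2 := lroot _ _ im in r12 sliceE.
have Hip : lhit (alpha v) c ip by rewrite hitE eqxx.
have Him : lhit (alpha v) c im by rewrite hitE eqxx orbT.
have mp1 : ip != im by apply: contraTneq cip => ->; rewrite -leNgt ltW.
transitivity (\int[mu]_(a in `]r1, r2[) (pder d F (ins d a v))%:E)%E.
  rewrite [RHS]integral_mkcond; apply: eq_integral => a _.
  rewrite patchE indicE; case: ifPn => [/set_mem|/negP Ha].
    rewrite /= in_itv/= => /sliceE Ha; rewrite mem_set ?mulr1// => i.
    by rewrite bary_line.
  rewrite memNset ?mulr0// => Hs; apply: Ha; apply/mem_set; rewrite /= in_itv/=.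
  by apply/sliceE => i; rewrite -bary_line.
have [] := @lip_ftc R (fun s => F (ins d s v)) (fun a => pder d F (ins d a v)) r1 r2 `|M| r12.
- move=> x y _ _; rewrite (le_trans (FM I I))//.
  rewrite (_ : _ - _ = (x - y) *: delta_mx 0 d); last first.
    by rewrite -{1}(subrK y x) -ins_shift addrK.
  rewrite normrZ mulrCA mulrC ler_wpM2r// ?mulr_ge0//.
  rewrite (@le_trans _ _ (`|M| * `|delta_mx 0 d : 'rV[R]_n.+1|))//.
    by rewrite ler_wpM2r// ler_norm.
  by rewrite ler_piMr// norm_e.
- apply: measurable_funTS; apply: (measurableT_comp (measurable_pder d FM)).
  exact: measurable_ins_fun.
- by move=> x _ dx; rewrite pderE; [exact: partial_ins|exact/derivable_ins].
move=> _ ->; congr (_%:E).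
rewrite (bigD1 ip)//= (bigD1 im) 1?eq_sym//= big1 ?addr0; last first.
  move=> i /andP[ip' im']; rewrite /ftrace hitE (negPf ip') (negPf im').
  by rewrite mulr0.
rewrite gtr0_sg// ltr0_sg// opprK mulN1r mul1r /ftrace Hip Him addrC.
have face i : lhit (alpha v) c i -> hull predT p (flift i v).
  by move=> /lhitP[_ Hi]; exact: sface_sub Hi.
by rewrite -!Ff; [|exact: face..].
Qed.

Lemma simplex_ftc :
  \int[lam n.+1]_(x in sint p) pder d F x =
  \sum_i - Num.sg (bgrad p i 0 d) * \int[lam n]_v ftrace i v.
Proof.
pose G x := pder d F x * \1_(sint p) x.
have mG : measurable_fun setT G.
  by apply: measurable_funM; [exact: (measurable_pder d FM)|apply: measurable_indic; exact: measurable_sint].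
have iG : (lam n.+1).-integrable setT (EFin \o G).
  apply: (@bounded_integrable _ _ _ `|M| (\sum_i `|p i|) mG) => x.
    rewrite /G normrM (le_trans _ (ler_norm _))// (le_trans _ (pder_le d FM x))//.
    by rewrite ler_piMr// indicE; case: (_ \in _); rewrite ?normr1 ?normr0.
  rewrite /G indicE; have [/set_mem xs _|_] := boolP (x \in sint p).
    exact/hull_bounded/sint_sub.
  by rewrite mulr0 eqxx.
have -> : \int[lam n.+1]_(x in sint p) pder d F x = fine (\int[lam n.+1]_x (G x)%:E)%E.
  rewrite /Rintegral integral_mkcond; congr fine; apply: eq_integral => x _.
  by rewrite patchE /G indicE; case: ifP => _; rewrite ?mulr1 ?mulr0.
have [mI ->] := fubini_ins d iG.
have iT i : (lam n).-integrable setT (fun v => (- Num.sg (c i) * ftrace i v)%:E).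
  by apply: (@integrableZl _ _ _ _ _ measurableT (- Num.sg (c i)) (EFin \o ftrace i));
    exact: integrable_ftrace.
transitivity (fine (\int[lam n]_v (\sum_i (- Num.sg (c i) * ftrace i v)%:E))%E).
  congr fine; apply: ae_eq_integral => //.
  - by apply: measurable_int; apply: integrable_sum => // i _.
  - have [N [mN N0 Nsub]] := line_generic_ae.
    exists N; split => // v Hv; apply: Nsub => vgen; apply: Hv => _ /=.
    by rewrite (line_integral vgen) sumEFin.
rewrite (integral_sum measurableT iT).
have E i : (\int[lam n]_v (- Num.sg (c i) * ftrace i v)%:E)%E =
   (- Num.sg (c i) * \int[lam n]_v ftrace i v)%:E.
  under eq_integral => v _ do rewrite EFinM.
  rewrite integralZl//; last exact: integrable_ftrace.
  by rewrite EFinM fineK//; apply: integrable_fin_num => //; exact: integrable_ftrace.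
by under eq_bigr => i _ do rewrite E; rewrite sumEFin.
Qed.

End simplex_ftc.

(** * The mesh *)

Section simplex_topology.
Variables (R : realType) (n : nat) (p : 'I_n.+2 -> 'rV[R]_n.+1).

Lemma dot_le m (u v : 'rV[R]_m) : `|dot u v| <= (\sum_i `|v 0 i|) * `|u|.
Proof.
rewrite (le_trans (ler_norm_sum _ _ _))// mulr_suml; apply: ler_sum => i _.
by rewrite normrM mulrC ler_wpM2l// rV_coord_le.
Qed.

Lemma bary_lip i : lip_on setT (\sum_j `|bgrad p i 0 j|) (bary p i).
Proof.
move=> x y _ _; rewrite (_ : _ - _ = dot (x - y) (bgrad p i)); first exact: dot_le.
by rewrite -{1}(subrK y x) [x - y + y]addrC bary_add; lra.
Qed.

Lemma bary_lt_open i c : open [set x | c < bary p i x].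
Proof.
rewrite (_ : [set x | _] = ~` [set x | bary p i x <= c]).
  exact/closed_openC/(lip_closed_le (bary_lip i)).
by apply/seteqP; split => x /=; rewrite ltNge => /negP.
Qed.

Lemma open_sint : open (sint p).
Proof.
rewrite openE => x sx.
apply: (@filter_forall _ 'I_n.+2 (fun i => [set y | 0 < bary p i y]) (nbhs x)) => i.
by have := @bary_lt_open i 0; rewrite openE => /(_ x (sx i)).
Qed.

Hypothesis pfree : affinely_independent p.

Lemma closed_hull : closed (hull predT p).
Proof.
rewrite (_ : hull predT p = \bigcap_(i in setT) ~` [set x | 0 < - bary p i x]).
  apply: closed_bigI => i _; apply: open_closedC.
  rewrite (_ : [set x | _] = ~` [set x | - bary p i x <= 0]).
    apply/closed_openC/(@lip_closed_le _ _ (\sum_j `|bgrad p i 0 j|)) => x y _ _.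
    by rewrite -opprD normrN; exact: bary_lip.
  by apply/seteqP; split => x /=; rewrite ltNge => /negP.
apply/seteqP; split => x.
  by move=> /(simplexP pfree) x0 i _ /=; rewrite oppr_gt0 ltNge x0.
move=> H; apply/(simplexP pfree) => i; rewrite leNgt; apply/negP.
by have := H i I; rewrite /= oppr_gt0.
Qed.

Definition face_center (i : 'I_n.+2) : 'rV[R]_n.+1 :=
  \sum_k ((k != i)%:R / n.+1%:R) *: p k.

Lemma sface_center i : sface p i (face_center i).
Proof.
have w1 : \sum_k (k != i)%:R / n.+1%:R = 1 :> R.
  rewrite -mulr_suml (bigD1 i)//= eqxx add0r (eq_bigr (fun=> 1)); last first.
    by move=> k ->.
  rewrite sumr_const cardC1 card_ord /= divff// pnatr_eq0//.
split=> [|j ji]; rewrite bary_uniq//; first by rewrite eqxx mul0r.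
by rewrite ji mul1r invr_gt0 ltr0n.
Qed.

Lemma sface_near i x v : sface p i x -> 0 < dot v (bgrad p i) ->
  \forall s \near 0^'+, sint p (x + s *: v).
Proof.
move=> [xi xj] vi; apply: (@filter_forall _ 'I_n.+2) => j.
have [->|ji] := eqVneq j i.
  apply: filterS (nbhs_right_gt 0) => s s0.
  by rewrite bary_add xi add0r dotZl mulr_gt0.
apply: filterS (near_affine_gt0 (dot v (bgrad p j)) (xj _ ji)) => s.
by rewrite bary_add dotZl mulrC.
Qed.

Lemma sface_near_tangent i x v : sface p i x -> dot v (bgrad p i) = 0 ->
  \forall s \near 0^'+, sface p i (x + s *: v).
Proof.
move=> [xi xj] vi.
have : \forall s \near 0^'+, forall j, j != i -> 0 < bary p j (x + s *: v).
  apply: filter_forall => j; have [->|ji] := eqVneq j i; first exact: nearW.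
  apply: filterS (near_affine_gt0 (dot v (bgrad p j)) (xj _ ji)) => s H _.
  by rewrite bary_add dotZl mulrC.
apply: filterS => s H; split=> //.
by rewrite bary_add xi dotZl vi mulr0 addr0.
Qed.

Lemma vertex_inj : injective p.
Proof.
move=> i j E; have := bary_vertex pfree i j; rewrite -E bary_vertex// eqxx.
by case: eqP => // _ /eqP; rewrite oner_eq0.
Qed.

Lemma tangent_comb i i0 v : dot v (bgrad p i) = 0 ->
  v = \sum_(m | m != i) dot v (bgrad p m) *: (p m - p i0).
Proof.
move=> vi; have : \sum_m (dot v (bgrad p m)) *: p m = v.
  apply: (addrI (\sum_m bary p m 0 *: p m)).
  rewrite -big_split bary_comb//= add0r -[RHS](bary_comb pfree v).
  by apply: eq_bigr => m _; rewrite -scalerDl -bary_add add0r.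
move=> {1}<-; have s0 : \sum_m dot v (bgrad p m) = 0.
  by under eq_bigr => m _ do rewrite dotC; rewrite -dot_suml sum_bgrad dot0l.
transitivity (\sum_m dot v (bgrad p m) *: (p m - p i0)).
  under [RHS]eq_bigr => m _ do rewrite scalerBr.
  by rewrite sumrB -scaler_suml s0 scale0r subr0.
by rewrite (bigD1 i)//= vi scale0r add0r.
Qed.

End simplex_topology.

Lemma normal_component (R : realType) d (u g : 'rV[R]_d) : g != 0 ->
  (forall v, dot v g = 0 -> dot v u = 0) -> exists a, u = a *: g.
Proof.
move=> g0 H; pose a := dot u g / dot g g; exists a.
have gg : dot g g != 0 by rewrite gt_eqF// dot_gt0.
have vg : dot (u - a *: g) g = 0 by rewrite dotBl dotZl /a divfK// subrr.
apply/eqP; rewrite -subr_eq0; apply/negPn/negP => /dot_gt0.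
have -> : dot (u - a *: g) (u - a *: g) = dot (u - a *: g) u - a * dot (u - a *: g) g.
  by rewrite dotDr dotNr dotZr.
by rewrite (H _ vg) vg mulr0 subrr ltxx.
Qed.

Lemma near_open_ray (R : realType) n (U : set 'rV[R]_n) x v : open U -> U x ->
  \forall s \near 0^'+, U (x + s *: v).
Proof.
move=> oU Ux; have [e e0 xU] := open_boxP oU Ux.
have v0 : 0 < `|v| + 1 by rewrite ltr_wpDl.
near=> s; apply: xU; apply/box_norm => //; rewrite addrAC subrr add0r normrZ.
have s0 : 0 < s by near: s; exact: nbhs_right_gt.
have : s < e / (`|v| + 1) by near: s; apply: nbhs_right_lt; rewrite divr_gt0.
rewrite ltr_pdivlMr// gtr0_norm//; apply: le_lt_trans.
by apply: ler_wpM2l; [exact: ltW|rewrite lerDl].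
Unshelve. all: by end_near. Qed.

Section mesh_faces.
Variables (R : realType) (n : nat) (Omega : set 'rV[R]_n.+1).
Variables (E : finType) (vtx : E -> 'I_n.+2 -> 'rV[R]_n.+1).
Hypothesis Omega_lip : bounded_lipschitz_domain Omega.
Hypothesis mesh : conforming_mesh Omega vtx.

Lemma mesh_free K : affinely_independent (vtx K).
Proof. by case: mesh. Qed.

Lemma simplex_closure K : simplex vtx K `<=` closure Omega.
Proof. by case: mesh => _ -> _ x Kx; exists K. Qed.

Lemma closure_simplex x : closure Omega x -> exists K, simplex vtx K x.
Proof. by case: mesh => _ -> _ [K _]; exists K. Qed.

Lemma Omega_open : open Omega.
Proof. by case: Omega_lip. Qed.

(* A point of [closure Omega] outside [Omega] lies on the Lipschitz graph, and the
   points just below it avoid [closure Omega]. *)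
Lemma open_sub_closure (U : set 'rV[R]_n.+1) :
  open U -> U `<=` closure Omega -> U `<=` Omega.
Proof.
move=> oU UO x Ux; apply: contrapT => Ox.
have [_ _ _ _ lipO] := Omega_lip.
have [Q [r [phi [Q1 r0 lphi HQ]]]] := lipO x (conj (UO x Ux) Ox).
have Q2 : Q^T *m Q = 1%:M by exact: mulmx1C.
(* [x] is not in [Omega], so the origin of the local coordinates is not above the graph. *)
have phi0 : 0 <= phi 0.
  rewrite leNgt; apply/negP => H; apply: Ox.
  have := HQ 0; rewrite normr0 mul0mx addr0 mxE => /(_ r0) [_]; apply.
  by rewrite (_ : col' _ _ = 0)//; apply/rowP => j; rewrite !mxE.
have [M [M0 phiM]] : exists M, 0 < M /\ forall v w, `|phi v - phi w| <= M * `|v - w|.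
  move: lphi => [M0 [_ H]]; exists (`|M0| + 1); split; first by rewrite ltr_wpDl.
  move=> v w; have := H (`|M0| + 1); rewrite (le_lt_trans (ler_norm _)) ?ltrDl//.
  by move=> /(_ isT) /(_ (v, w)); apply.
pose w0 : 'rV[R]_n.+1 := - row ord0 Q.
have : \forall t \near 0^'+, 0 < t /\ (t < r / 2) /\ U (x + t *: w0).
  near=> t; split; first by near: t; exact: nbhs_right_gt.
  split; first by near: t; apply: nbhs_right_lt; rewrite divr_gt0.
  by near: t; exact: near_open_ray.
move=> /filter_ex[t [t0 [tr Ut]]].
pose y := x + t *: w0; pose z : 'rV[R]_n.+1 := - t *: delta_mx 0 ord0.
have zE j : z 0 j = - t * (j == ord0)%:R by rewrite !mxE eqxx.
have yz : y = x + z *m Q.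
  by rewrite /y /z /w0 -scalemxAl -rowE scalerN scaleNr.
(* [C] bounds how much passing to the rotated coordinates enlarges the sup norm. [eta] keeps the
   perturbed point in the chart and below the graph: there [phi] is at least [- M * eta], while the
   height is below [- t + eta], and [(M + 1) * eta < t]. *)
pose C := \sum_j \sum_i `|Q j i| + 1.
have C0 : 0 < C by rewrite ltr_wpDl// sumr_ge0// => j _; rewrite sumr_ge0.
pose eta := Num.min (t / (M + 2)) (r / 2).
have eta0 : 0 < eta by rewrite lt_min !divr_gt0// addr_gt0.
have d0 : 0 < eta / C by rewrite divr_gt0.
have : nbhs y (box y (eta / C)).
  by apply: open_nbhs_nbhs; split; [exact: open_box|apply/box_norm => //; rewrite subrr normr0].
move=> /(UO y Ut) [y' [Oy' /box_norm -/(_ d0) yy']].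
pose z' := (y' - x) *m Q^T.
have y'E : y' = x + z' *m Q by rewrite /z' -mulmxA Q2 mulmx1 addrC subrK.
have zz' j : `|z' 0 j - z 0 j| < eta.
  have -> : z' 0 j - z 0 j = dot (y' - y) (row j Q).
    have -> : z = (y - x) *m Q^T by rewrite yz addrC addKr -mulmxA Q1 mulmx1.
    rewrite /z'; transitivity (((y' - x) *m Q^T - (y - x) *m Q^T) 0 j).
      by rewrite !mxE.
    rewrite -mulmxBl opprB addrA subrK mxE; apply: eq_bigr => i _.
    by rewrite !mxE.
  rewrite (le_lt_trans (dot_le _ _))// (@le_lt_trans _ _ (C * `|y' - y|))//.
    rewrite ler_wpM2r// (eq_bigr (fun i => `|Q j i|)); last first.
      by move=> i _; rewrite mxE.
    rewrite /C [X in _ <= X + 1](bigD1 j)//= -addrA lerDl addr_ge0// sumr_ge0// => k _.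
    by rewrite sumr_ge0.
  by rewrite mulrC -ltr_pdivlMr.
have etat : (M + 1) * eta < t.
  have : eta <= t / (M + 2) by rewrite ge_min lexx.
  rewrite ler_pdivlMr ?addr_gt0// => H; apply: lt_le_trans H.
  by rewrite mulrC ltr_pM2l// ltrD2l ltr1n.
have z'r : `|z'| < r.
  apply/rV_normP => // j; have := ler_normD (z' 0 j - z 0 j) (z 0 j).
  rewrite subrK => /le_lt_trans; apply; rewrite (splitr r) ltrD//.
    by rewrite (lt_le_trans (zz' j))// ge_min lexx orbT.
  rewrite zE normrM normrN (gtr0_norm t0).
  by case: (_ == _); rewrite ?normr1 ?normr0 ?mulr1 ?mulr0 ?divr_gt0.
have := HQ _ z'r; rewrite -y'E => -[/(_ Oy') + _].
have z'0 : z' 0 ord0 < - t + eta.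
  have := zz' ord0; rewrite ltr_norml => /andP[_].
  by rewrite zE eqxx mulr1; lra.
have : `|col' ord0 z' - 0| <= eta.
  rewrite subr0 leNgt; apply/negP => H; have : `|col' ord0 z'| < `|col' ord0 z'|.
    apply/rV_normP; first exact: lt_trans H.
    move=> j; rewrite mxE; apply: lt_trans H; have := zz' (lift ord0 j).
    by rewrite zE eq_sym (negPf (neq_lift _ _)) mulr0 subr0.
  by rewrite ltxx.
move=> H; have := phiM (col' ord0 z') 0; have := ler_wpM2l (ltW M0) H.
by move: etat; rewrite ler_norml mulrDl mul1r => ? ? /andP[]; lra.
Unshelve. all: by end_near. Qed.

Lemma sint_Omega K : sint (vtx K) `<=` Omega.
Proof.
apply: open_sub_closure; first exact: open_sint.
by move=> x /(sint_sub (mesh_free K)); exact: simplex_closure.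
Qed.

Lemma simplexI K L x : K != L -> simplex vtx K x -> simplex vtx L x ->
  forall i, 0 < bary (vtx K) i x -> exists j, vtx L j = vtx K i.
Proof.
case: mesh => free _ conf KL Kx Lx i xi.
have [_ /seteqP[H _]] := conf K L KL.
have /(hullP (free K))[_ H2] := H x (conj Kx Lx).
apply: contrapT => nD; have xi0 : bary (vtx K) i x = 0.
  by apply: H2; apply/negP => /existsP[j /eqP E0]; apply: nD; exists j.
by move: xi; rewrite xi0 ltxx.
Qed.

(** By counting, the injection of the vertices of [K] into those of [L] is onto, so both simplices
    equal their intersection; a conforming mesh does not contain the same simplex twice. *)
Lemma not_all_common K L : K != L -> ~ (forall i, exists j, vtx L j = vtx K i).
Proof.
case: mesh => free _ conf KL /choice[f fE].
have finj : injective f.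
  by move=> i j ij; apply: (vertex_inj (free K)); rewrite -!fE ij.
have hull_all (D : pred 'I_n.+2) M : (forall i, D i) -> hull D (vtx M) = simplex vtx M.
  by move=> HD; apply/seteqP; split => x [w [w0 _ w1 wx]]; exists w; split=> // i;
    rewrite ?HD.
have [KneL KL1] := conf K L KL.
have LK : L != K by rewrite eq_sym.
have [_ LK1] := conf L K LK.
apply: KneL; rewrite -[LHS](hull_all [pred i | [exists j, vtx L j == vtx K i]]).
  rewrite -KL1 setIC LK1; apply: hull_all => j /=; apply/existsP.
  have [g fg gf] := injF_bij finj.
  by exists (g j); rewrite -{2}(gf j) fE.
by move=> i /=; apply/existsP; exists (f i); rewrite fE.
Qed.

Lemma sint_disjoint K L x : sint (vtx K) x -> sint (vtx L) x -> K = L.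
Proof.
move=> Kx Lx; apply/eqP/negPn/negP => KL; apply: (not_all_common KL) => i.
apply: (simplexI KL _ _ (Kx i)); apply: sint_sub => //; exact: mesh_free.
Qed.

End mesh_faces.

(** * Integration of almost everywhere bounded Borel functions *)

Section integral_null_set.
Context d (T : measurableType d) (R : realType).
Variable mu : {measure set T -> \bar R}.
Import HBNNSimple.
Local Open Scope ereal_scope.

Let nnsup_le (N : set T) (F G : T -> \bar R) : measurable N -> mu N = 0 ->
  (forall x, 0 <= G x) -> (forall x, ~ N x -> F x = G x) ->
  ereal_sup [set sintegral mu h | h in [set h : {nnsfun T >-> R} | forall x, (h x)%:E <= F x]] <=
  ereal_sup [set sintegral mu h | h in [set h : {nnsfun T >-> R} | forall x, (h x)%:E <= G x]].
Proof.
move=> mN N0 G0 FG; apply: ge_ereal_sup => _ [h hF <-].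
pose h' := mul_nnsfun h (indic_nnsfun R (measurableC mN)).
apply: ereal_sup_ubound; exists h'.
  move=> x /=; rewrite /= mindicE; case: (boolP (x \in ~` N)) => [|_].
    by move=> /set_mem Nx; rewrite mulr1 -FG//; exact: hF.
  by rewrite mulr0.
rewrite -!integralT_nnsfun; apply: ae_eq_integral => //.
- exact/measurable_EFinP.
- exact/measurable_EFinP.
exists N; split => // x /= H; apply: contrapT => Nx; apply: H => _.
by rewrite /= mindicE mem_set// mulr1.
Qed.

(* No measurability of [f], [g] is required: [integral] is defined from suprema over
   simple functions, which can be cut off on a measurable null set. *)
Lemma eq_integral_null_set (D N : set T) (f g : T -> \bar R) :
  measurable N -> mu N = 0 -> (forall x, D x -> ~ N x -> f x = g x) ->
  \int[mu]_(x in D) f x = \int[mu]_(x in D) g x.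
Proof.
move=> mN N0 fg; rewrite /integral.
have E x : ~ N x -> (f \_ D) x = (g \_ D) x.
  by move=> Nx; rewrite !patchE; case: ifPn => // /set_mem Dx; exact: fg.
congr (_ - _); apply/eqP; rewrite eq_le !(nnsup_le mN N0)// => x Nx;
  by rewrite ?funeposE ?funenegE E.
Qed.

End integral_null_set.

Section bounded_ae_measurable.
Variables (R : realType) (n : nat) (Omega : set 'rV[R]_n).
Hypothesis mOmega : measurable Omega.
Variable B : R.
Hypothesis OmegaB : forall x, Omega x -> `|x| <= B.
Local Notation lam := (lebesgue_rV R n).
Implicit Types f g : 'rV[R]_n -> R.

(* Equal on [Omega] to a bounded Borel function, off a Borel null set. *)
Definition bae f := exists g (N : set 'rV[R]_n) (C : R),
  [/\ measurable_fun setT g, forall x, `|g x| <= C, measurable N, lam N = 0%E &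
      forall x, Omega x -> ~ N x -> f x = g x].

Lemma integral_dom_null f g N : measurable N -> lam N = 0%E ->
  (forall x, Omega x -> ~ N x -> f x = g x) ->
  integral_dom Omega f = integral_dom Omega g.
Proof.
move=> mN N0 fg; rewrite /integral_dom /Rintegral; congr fine.
by apply: (eq_integral_null_set mN N0) => x Ox Nx; rewrite fg.
Qed.

Lemma bae_eq f g : (forall x, Omega x -> f x = g x) -> bae f -> bae g.
Proof.
move=> fg [g' [N [C [? ? ? ? H]]]]; exists g', N, C; split=> // x Ox Nx.
by rewrite -fg// H.
Qed.

Lemma lebesgue_setU0 (N N' : set 'rV[R]_n) : measurable N -> measurable N' ->
  lam N = 0%E -> lam N' = 0%E -> lam (N `|` N') = 0%E.
Proof.
move=> mN mN' N0 N'0; apply/eqP; rewrite eq_le measure_ge0 andbT.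
apply: (le_trans (measureU2 _ mN mN')).
by rewrite [X in (X + _)%E]N0 add0e [X in (X <= _)%E]N'0.
Qed.

Lemma bae_null f g N : measurable N -> lam N = 0%E ->
  (forall x, Omega x -> ~ N x -> f x = g x) -> bae f -> bae g.
Proof.
move=> mN N0 fg [g' [N' [C [? ? mN' N'0 H]]]]; exists g', (N `|` N'), C; split=> //.
- exact: measurableU.
- exact: lebesgue_setU0.
- by move=> x Ox /not_orP[Nx N'x]; rewrite -fg// H.
Qed.

Lemma bae_cst c : bae (fun=> c).
Proof. by exists (fun=> c), set0, `|c|; split. Qed.

Lemma bae2 (op : R -> R -> R) (b : R -> R -> R) f g :
  (forall u v : 'rV[R]_n -> R, measurable_fun setT u -> measurable_fun setT v ->
     measurable_fun setT (fun x => op (u x) (v x))) ->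
  (forall x y C D, `|x| <= C -> `|y| <= D -> `|op x y| <= b C D) ->
  bae f -> bae g -> bae (fun x => op (f x) (g x)).
Proof.
move=> mop bop [f' [N [C [mf f'C mN N0 fE]]]] [g' [N' [C' [mg g'C mN' N'0 gE]]]].
exists (fun x => op (f' x) (g' x)), (N `|` N'), (b C C'); split.
- exact: mop.
- by move=> x; exact: bop.
- exact: measurableU.
- exact: lebesgue_setU0.
- by move=> x Ox /not_orP[Nx N'x]; rewrite fE// gE.
Qed.

Lemma baeD f g : bae f -> bae g -> bae (fun x => f x + g x).
Proof.
apply: (bae2 (b := fun C D => C + D)).
  by move=> u v; exact: measurable_funD.
by move=> x y C D xC yD; rewrite (le_trans (ler_normD _ _))// lerD.
Qed.

Lemma baeM f g : bae f -> bae g -> bae (fun x => f x * g x).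
Proof.
apply: (bae2 (b := fun C D => C * D)).
  by move=> u v; exact: measurable_funM.
by move=> x y C D xC yD; rewrite normrM ler_pM.
Qed.

Lemma bae1 (op : R -> R) (b : R -> R) f :
  (forall u : 'rV[R]_n -> R, measurable_fun setT u ->
     measurable_fun setT (fun x => op (u x))) ->
  (forall x C, `|x| <= C -> `|op x| <= b C) ->
  bae f -> bae (fun x => op (f x)).
Proof.
move=> mop bop [g [N [C [mg gC mN N0 fE]]]]; exists (fun x => op (g x)), N, (b C).
by split=> // [|x|x Ox Nx]; [exact: mop|exact: bop|rewrite fE].
Qed.

Lemma baeN f : bae f -> bae (fun x => - f x).
Proof. by apply: (bae1 (b := id)) => [u|x C]; [exact: measurableT_comp|rewrite normrN]. Qed.

Lemma baeB f g : bae f -> bae g -> bae (fun x => f x - g x).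
Proof. by move=> bf bg; apply: baeD => //; exact: baeN. Qed.

Lemma bae_norm f : bae f -> bae (fun x => `|f x|).
Proof. by apply: (bae1 (b := id)) => [u|x C]; [exact: measurableT_comp|rewrite normr_id]. Qed.

Lemma bae_sqrt f : bae f -> bae (fun x => Num.sqrt (f x)).
Proof.
apply: (bae1 (op := fun x => Num.sqrt x) (b := fun C => Num.sqrt C)) => [u mu|x C xC].
  by apply: (measurableT_comp (f := @Num.sqrt R)) => //; apply: continuous_measurable_fun; exact: sqrt_continuous.
rewrite ger0_norm ?sqrtr_ge0// ler_wsqrtr// (le_trans (ler_norm _))//.
Qed.

Lemma bae_sum (I : Type) (s : seq I) (P : pred I) (f : I -> 'rV[R]_n -> R) :
  (forall i, P i -> bae (f i)) -> bae (fun x => \sum_(i <- s | P i) f i x).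
Proof.
move=> bf; elim: s => [|i s IH].
  by apply: bae_eq (bae_cst 0) => x _; rewrite big_nil.
apply: (@bae_eq (fun x => (if P i then f i x else 0) + \sum_(i <- s | P i) f i x)).
  by move=> x _; rewrite big_cons; case: ifP => // _; rewrite add0r.
apply: baeD => //; have := bf i; case: (P i) => [/(_ isT)//|_]; exact: bae_cst.
Qed.

Let integrable_rep g C : measurable_fun setT g -> (forall x, `|g x| <= C) ->
  lam.-integrable Omega (EFin \o g).
Proof.
move=> mg gC; apply: measurable_bounded_integrable => //.
- exact: lebesgue_bounded_lty OmegaB.
- exact: measurable_funTS.
- exists `|C|; split; first exact: num_real.
  by move=> K CK x _ /=; rewrite (le_trans (gC x))// (le_trans (ler_norm _))// ltW.
Qed.

Lemma integral_domD f g : bae f -> bae g ->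
  integral_dom Omega (fun x => f x + g x) = integral_dom Omega f + integral_dom Omega g.
Proof.
move=> [f' [N [C [mf f'C mN N0 fE]]]] [g' [N' [C' [mg g'C mN' N'0 gE]]]].
rewrite (integral_dom_null mN N0 fE) (integral_dom_null mN' N'0 gE).
have mNN := measurableU _ _ mN mN'.
rewrite (@integral_dom_null _ (fun x => f' x + g' x) _ mNN); last 2 first.
- exact: lebesgue_setU0.
- by move=> x Ox /not_orP[Nx N'x]; rewrite fE// gE.
by apply: RintegralD => //; apply: integrable_rep.
Qed.

Lemma integral_domZ c f : bae f ->
  integral_dom Omega (fun x => c * f x) = c * integral_dom Omega f.
Proof.
move=> [f' [N [C [mf f'C mN N0 fE]]]]; rewrite (integral_dom_null mN N0 fE).
rewrite (@integral_dom_null _ (fun x => c * f' x) _ mN N0).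
  by apply: RintegralZl => //; exact: integrable_rep f'C.
by move=> x Ox Nx; rewrite fE.
Qed.

Lemma integral_domN f : bae f ->
  integral_dom Omega (fun x => - f x) = - integral_dom Omega f.
Proof.
move=> bf; rewrite -mulN1r -integral_domZ//; congr integral_dom.
by apply/funext => x; rewrite mulN1r.
Qed.

Lemma integral_domB f g : bae f -> bae g ->
  integral_dom Omega (fun x => f x - g x) = integral_dom Omega f - integral_dom Omega g.
Proof. by move=> bf bg; rewrite integral_domD ?integral_domN//; exact: baeN. Qed.

Lemma eq_integral_dom f g : (forall x, Omega x -> f x = g x) ->
  integral_dom Omega f = integral_dom Omega g.
Proof. by move=> fg; apply: eq_Rintegral => x /set_mem; exact: fg. Qed.

Lemma integral_dom0 : integral_dom Omega (fun=> 0) = 0.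
Proof. by rewrite /integral_dom /Rintegral integral0. Qed.

Lemma integral_dom_sum (I : Type) (s : seq I) (P : pred I) (f : I -> 'rV[R]_n -> R) :
  (forall i, P i -> bae (f i)) ->
  integral_dom Omega (fun x => \sum_(i <- s | P i) f i x) =
  \sum_(i <- s | P i) integral_dom Omega (f i).
Proof.
move=> bf; elim: s => [|i s IH].
  rewrite big_nil -[RHS]integral_dom0; congr integral_dom.
  by apply/funext => x; rewrite big_nil.
rewrite big_cons -IH; case: ifPn => Pi.
  rewrite -integral_domD//; [|exact: bf|exact: bae_sum].
  by congr integral_dom; apply/funext => x; rewrite big_cons Pi.
by congr integral_dom; apply/funext => x; rewrite big_cons (negPf Pi).
Qed.

Lemma integral_dom_ge0 f : (forall x, Omega x -> 0 <= f x) -> 0 <= integral_dom Omega f.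
Proof. by move=> f0; apply: Rintegral_ge0. Qed.

Lemma measurable_bae f C : measurable_fun Omega f ->
  (forall x, Omega x -> `|f x| <= C) -> bae f.
Proof.
move=> mf fC; exists (f \_ Omega), set0, `|C|; split => //.
- exact/(measurable_restrictT _ mOmega).
- move=> x; rewrite patchE; case: ifPn => [/set_mem Ox|_]; last by rewrite normr0.
  by rewrite (le_trans (fC _ Ox))// ler_norm.
- by move=> x Ox _; rewrite patchE mem_set.
Qed.

End bounded_ae_measurable.

(** * Faces shared by two simplices *)

Section mesh_twins.
Variables (R : realType) (n : nat) (Omega : set 'rV[R]_n.+1).
Variables (E : finType) (vtx : E -> 'I_n.+2 -> 'rV[R]_n.+1).
Hypothesis Omega_lip : bounded_lipschitz_domain Omega.
Hypothesis mesh : conforming_mesh Omega vtx.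
Local Notation face := (E * 'I_n.+2)%type.
Let free := mesh_free mesh.

Definition fgrad (F : face) := bgrad (vtx F.1) F.2.
Definition oface (F : face) := sface (vtx F.1) F.2.

Lemma bary_face_map (F : face) t k :
  bary (vtx F.1) k (face_map vtx F t) =
  (k == lift F.2 ord0)%:R + \sum_j t 0 j *
    ((k == lift F.2 (lift ord0 j))%:R - (k == lift F.2 ord0)%:R).
Proof.
rewrite /face_map bary_add bary_vertex// dot_mul; congr (_ + _).
by apply: eq_bigr => j _; rewrite rowK bgrad_vertex.
Qed.

Lemma bary_face_map0 (F : face) t : bary (vtx F.1) F.2 (face_map vtx F t) = 0.
Proof.
rewrite bary_face_map (negPf (neq_lift _ _)) add0r big1// => j _.
by rewrite (negPf (neq_lift _ _)) subr0 mulr0.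
Qed.

Lemma bary_face_map1 (F : face) t :
  bary (vtx F.1) (lift F.2 ord0) (face_map vtx F t) = 1 - \sum_j t 0 j.
Proof.
rewrite bary_face_map eqxx -sumrN; congr (_ + _); apply: eq_bigr => j _.
by rewrite (inj_eq (@lift_inj _ _)) (negPf (neq_lift _ _)) sub0r mulrN1.
Qed.

Lemma bary_face_map2 (F : face) t j :
  bary (vtx F.1) (lift F.2 (lift ord0 j)) (face_map vtx F t) = t 0 j.
Proof.
rewrite bary_face_map (inj_eq (@lift_inj _ _)) eq_sym (negPf (neq_lift _ _)) add0r.
rewrite (bigD1 j)//= eqxx subr0 mulr1 big1 ?addr0// => l lj.
by rewrite !(inj_eq (@lift_inj _ _)) eq_sym (negPf lj) subr0 mulr0.
Qed.

Lemma face_map_sface (F : face) t : oface F (face_map vtx F t) <-> ref_simplex t.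
Proof.
split=> [[_ H]|[t0 t1]].
  split=> [j|]; first by rewrite -(bary_face_map2 F) H// eq_sym neq_lift.
  by rewrite -subr_gt0 -(bary_face_map1 F) H// eq_sym neq_lift.
split=> [|k]; first exact: bary_face_map0.
case: (unliftP F.2 k) => [k'|] ->; last by rewrite eqxx.
move=> _; case: (unliftP ord0 k') => [j|] ->; first by rewrite bary_face_map2.
by rewrite bary_face_map1 subr_gt0.
Qed.

Lemma face_map_onto (F : face) x : bary (vtx F.1) F.2 x = 0 ->
  face_map vtx F (\row_j bary (vtx F.1) (lift F.2 (lift ord0 j)) x) = x.
Proof.
move=> x0; set t := \row_j _; rewrite -[RHS](bary_comb (free F.1)).
rewrite -[LHS](bary_comb (free F.1)); apply: eq_bigr => k _; congr (_ *: _).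
case: (unliftP F.2 k) => [k'|] ->; last by rewrite bary_face_map0 x0.
case: (unliftP ord0 k') => [j|] ->; first by rewrite bary_face_map2 mxE.
rewrite bary_face_map1 -(sum_bary (vtx F.1) x) (bigD1_ord F.2)//= x0 add0r.
rewrite (bigD1_ord ord0)//= -addrA -sumrB big1 ?addr0// => j _.
by rewrite mxE subrr.
Qed.

Lemma open_faceE (F : face) : open_face vtx F = oface F.
Proof.
apply/seteqP; split=> [_ [t tr <-]|x [x0 xj]]; first exact/face_map_sface.
have := face_map_onto x0; set t := \row_j _ => tx; exists t => //.
by apply/(face_map_sface F); rewrite tx.
Qed.

Lemma fset_simplex F : oface F `<=` simplex vtx F.1.
Proof. by move=> x; exact: sface_sub (free F.1) _ _. Qed.

Lemma fgrad_neq0 F : fgrad F != 0.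
Proof. exact: bgrad_neq0. Qed.

Lemma fset_center F : oface F (face_center (vtx F.1) F.2).
Proof. exact: sface_center. Qed.

(** The two faces have the same tangent vectors, so the gradients are parallel. With a positive
    factor, both open simplices would contain points slightly inside the common face; then the
    simplices would coincide, and two distinct faces of one simplex have disjoint relative
    interiors. *)
Lemma twin_fgrad F G : oface G = oface F -> G != F ->
  exists2 a, a < 0 & fgrad G = a *: fgrad F.
Proof.
move=> GF neq; have x0F := fset_center F; set x0 := face_center _ _ in x0F.
have x0G : oface G x0 by rewrite GF.
have [a aE] : exists a, fgrad G = a *: fgrad F.
  apply: normal_component; first exact: fgrad_neq0.
  move=> v vF; have : \forall s \near 0^'+, 0 < s /\ oface F (x0 + s *: v).
    by apply: filterI; [exact: nbhs_right_gt|exact: sface_near_tangent].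
  move=> /filter_ex[s [s0 sF]].
  have [sG _] : oface G (x0 + s *: v) by rewrite GF.
  move: sG; rewrite bary_add; case: x0G => -> _; rewrite add0r dotZl => /eqP.
  by rewrite mulf_eq0 gt_eqF//= => /eqP.
exists a => //; rewrite ltNge le_eqVlt; apply/negP => /orP[/eqP a0|a0].
  by have := fgrad_neq0 G; rewrite aE -a0 scale0r eqxx.
have FF : 0 < dot (fgrad F) (bgrad (vtx F.1) F.2) by exact/dot_gt0/fgrad_neq0.
have FG : 0 < dot (fgrad F) (bgrad (vtx G.1) G.2).
  by rewrite -/(fgrad G) aE dotZr mulr_gt0.
have : \forall s \near 0^'+, sint (vtx F.1) (x0 + s *: fgrad F) /\
    sint (vtx G.1) (x0 + s *: fgrad F).
  by apply: filterI; [exact: sface_near FF|exact: sface_near FG].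
move=> /filter_ex[s [sF sG]].
have KL := sint_disjoint mesh sF sG.
have ij : F.2 != G.2.
  apply: contra neq => /eqP ij.
  by rewrite (surjective_pairing F) (surjective_pairing G) KL ij.
by have := x0G.2 _ ij; rewrite -KL x0F.1 ltxx.
Qed.

(** At [x0] every vertex of [K] other than the [i]-th has positive weight, so conformity makes it a
    vertex of [L]. One vertex of [L] is left over, and [j] is its index. A point of either face is a
    combination of the common vertices, whence its two families of barycentric coordinates agree up
    to renumbering. *)
Lemma same_face K L i x0 : K != L -> oface (K, i) x0 -> simplex vtx L x0 ->
  exists j, oface (L, j) = oface (K, i).
Proof.
move=> KL x0F Lx0.
have Kx0 : simplex vtx K x0 by exact: fset_simplex x0F.
have common m : exists l, m != i -> vtx L l = vtx K m.
  have [->|mi] := eqVneq m i; first by exists ord0.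
  have [l lE] := simplexI mesh KL Kx0 Lx0 (x0F.2 _ mi); by exists l.
move: common => /choice[s0 s0E].
have s0inj m m' : m != i -> m' != i -> s0 m = s0 m' -> m = m'.
  move=> mi m'i ss; apply: (vertex_inj (free K)).
  by rewrite -s0E// -(s0E m')// ss.
have [j jP] : exists j, forall m, m != i -> s0 m != j.
  have : (#|s0 @: finset.setC (finset.set1 i)| < #|'I_n.+2|)%N.
    by rewrite (leq_ltn_trans (leq_imset_card _ _))// cardsC1 card_ord.
  move=> H; have [j jn] : exists j, j \notin s0 @: finset.setC (finset.set1 i).
    apply/existsP; rewrite -negb_forall; apply: contraL H => /forallP Hall.
    by rewrite -leqNgt; apply: subset_leq_card; apply/fintype.subsetP => j _.
  exists j => m mi; apply: contra jn => /eqP <-; apply/imsetP; exists m => //.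
  by rewrite !inE.
pose s m := if m == i then j else s0 m.
have sinj : injective s.
  move=> m m'; rewrite /s; case: eqVneq => [->|mi]; case: eqVneq => [->|m'i] //.
  - by move=> E'; have := jP _ m'i; rewrite E' eqxx.
  - by move=> E'; have := jP _ mi; rewrite E' eqxx.
  - exact: s0inj.
have sE m : m != i -> vtx L (s m) = vtx K m by move=> mi; rewrite /s (negPf mi) s0E.
have si : s i = j by rewrite /s eqxx.
exists j; have [s' ss' s's] := injF_bij sinj.
have toL x : bary (vtx K) i x = 0 -> forall m, bary (vtx L) (s m) x = bary (vtx K) m x.
  move=> xi m; have xE : x = \sum_l bary (vtx K) (s' l) x *: vtx L l.
    rewrite -{1}(bary_comb (free K) x) [RHS](reindex s)/=; last first.
      by exists s' => ? _.
    apply: eq_bigr => l _; rewrite ss'; have [->|li] := eqVneq l i.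
      by rewrite xi !scale0r.
    by rewrite sE.
  rewrite {1}xE bary_uniq ?ss'//.
  by rewrite (reindex s)/=; [under eq_bigr do rewrite ss'; exact: sum_bary|exists s' => ? _].
have toK x : bary (vtx L) j x = 0 -> forall m, bary (vtx K) m x = bary (vtx L) (s m) x.
  move=> xj m; have xE : x = \sum_l bary (vtx L) (s l) x *: vtx K l.
    rewrite -{1}(bary_comb (free L) x) [LHS](reindex s)/=; last first.
      by exists s' => ? _.
    apply: eq_bigr => l _; have [->|li] := eqVneq l i.
      by rewrite si xj !scale0r.
    by rewrite sE.
  rewrite {1}xE bary_uniq//.
  by rewrite -[RHS](sum_bary (vtx L) x) [RHS](reindex s)//=; exists s' => ? _.
apply/seteqP; split=> x [xz xP]; rewrite /= in xz xP.
  have xi : bary (vtx K) i x = 0 by rewrite toK// si.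
  split=> //= m mi; rewrite toK// xP// -si; exact: contra_neq (sinj _ _) mi.
have xj : bary (vtx L) j x = 0 by rewrite -si toL.
split=> //= l lj; rewrite -(s's l) toL// xP//.
by apply: contra_neq lj => E'; rewrite -(s's l) E' si.
Qed.

Lemma boundary_faceE (F : face) : boundary_face Omega vtx F = (oface F `<=` boundary Omega) :> Prop.
Proof. by rewrite /boundary_face open_faceE. Qed.

(** Some point [x] of the open face lies in the open set [Omega]. Leaving the simplex through [x]
    one stays in [Omega], hence in some simplex [L]. There are finitely many closed simplices, so
    for a short enough step [L] also contains [x], and [same_face] applies. *)
Lemma twin_exists (F : face) : ~ boundary_face Omega vtx F ->
  exists2 G, G != F & oface G = oface F.
Proof.
rewrite boundary_faceE => /existsNP[x /not_implyP[xF xb]].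
have xO : Omega x.
  apply: contrapT => Ox; apply: xb; split=> //.
  exact/(simplex_closure mesh)/(fset_simplex xF).
have near_out L : \forall s \near 0^'+, ~ simplex vtx L x ->
    ~ simplex vtx L (x + s *: - fgrad F).
  have [xL|xL] := pselect (simplex vtx L x); first exact: nearW.
  apply: filterS (near_open_ray (- fgrad F) (closed_openC (closed_hull (free L))) xL).
  by move=> s H _; exact: H.
have near_all : \forall s \near 0^'+, forall L, ~ simplex vtx L x ->
    ~ simplex vtx L (x + s *: - fgrad F) by exact: filter_forall.
have : \forall s \near 0^'+, (forall L, ~ simplex vtx L x ->
    ~ simplex vtx L (x + s *: - fgrad F)) /\
    (0 < s /\ Omega (x + s *: - fgrad F)).
  apply: filterI => //; apply: filterI; first exact: nbhs_right_gt.
  exact: near_open_ray (Omega_open Omega_lip) xO.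
move=> /filter_ex[s [Hs [s0 Os]]].
have [L Ls] := closure_simplex mesh (subset_closure Os).
have Lx : simplex vtx L x by apply: contrapT => Lx; exact: Hs Lx Ls.
have KL : F.1 != L.
  apply: contraPneq Ls => <- /(simplexP (free F.1)) /(_ F.2).
  rewrite bary_add; case: xF => -> _; rewrite add0r dotZl dotNl mulrN oppr_ge0.
  by rewrite leNgt mulr_gt0//; exact/dot_gt0/fgrad_neq0.
have xF' : oface (F.1, F.2) x by [].
have [j jE] := same_face KL xF' Lx.
exists (L, j); last by rewrite jE; case: (F).
by apply: contra KL => /eqP <-.
Qed.

(** Three coincident faces would have pairwise opposite normals, but the product of two negative
    factors is positive. *)
Lemma twin_uniq F G H : G != F -> H != F -> oface G = oface F -> oface H = oface F -> G = H.
Proof.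
move=> GF HF GE HE; apply/eqP/negPn/negP => GH.
have [a a0 aE] := twin_fgrad GE GF.
have [b b0 bE] := twin_fgrad HE HF.
have GHo : oface G = oface H by rewrite GE HE.
have [c c0 cE] := twin_fgrad GHo GH.
have /eqP := cE; rewrite aE bE scalerA -subr_eq0 -scalerBl scaler_eq0.
rewrite (negPf (fgrad_neq0 F)) orbF subr_eq0 => E'.
have cb : 0 < c * b by rewrite nmulr_rgt0.
by move: cb; rewrite -(eqP E') ltNge (ltW a0).
Qed.

Lemma sum_interior_faces (t : face -> R) :
  (forall F G, oface G = oface F -> G != F -> t G = - t F) ->
  \sum_(F | ~~ `[< boundary_face Omega vtx F >]) t F = 0.
Proof.
move=> tE; have : forall F, exists G, ~~ `[< boundary_face Omega vtx F >] ->
    G != F /\ oface G = oface F.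
  move=> F; case: asboolP => [|/twin_exists[G ? ?]]; last by exists G.
  by exists F.
move=> /choice[pi0 pi0P].
(* Fixing the boundary faces extends the twin map to an involution of all the faces, by which the
   sum can be reindexed. *)
pose pi F := if `[< boundary_face Omega vtx F >] then F else pi0 F.
have bE F G : oface G = oface F ->
    `[< boundary_face Omega vtx F >] = `[< boundary_face Omega vtx G >].
  by move=> FG; congr asbool; rewrite !boundary_faceE FG.
have piP F : ~~ `[< boundary_face Omega vtx F >] -> pi F != F /\ oface (pi F) = oface F.
  by move=> bF; rewrite /pi (negPf bF); exact: pi0P.
have piK : involutive pi.
  move=> F; case: (boolP `[< boundary_face Omega vtx F >]) => bF.
    by rewrite /pi bF bF.
  have [nF eF] := piP F bF; have bpF : ~~ `[< boundary_face Omega vtx (pi F) >].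
    by rewrite -(bE _ _ eF).
  have [nF' eF'] := piP _ bpF.
  by apply: (twin_uniq nF' _ eF' (esym eF)); rewrite eq_sym.
have H : \sum_(F | ~~ `[< boundary_face Omega vtx F >]) t F =
  - \sum_(F | ~~ `[< boundary_face Omega vtx F >]) t F.
  rewrite [LHS](reindex_inj (inv_inj piK))/= -sumrN; apply: eq_big => F.
    case: (boolP `[< boundary_face Omega vtx F >]) => bF; first by rewrite /pi bF bF.
    by rewrite (bE (pi F) F)//; have [_ ->] := piP F bF.
  move=> bpF; have bF : ~~ `[< boundary_face Omega vtx F >].
    by apply: contra bpF => bF; rewrite /pi bF bF.
  by have [nF eF] := piP F bF; rewrite (tE F).
by apply/eqP; rewrite -[_ == 0](mulrn_eq0 _ 2) mulr2n {1}H addNr.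
Qed.

End mesh_twins.

(** * Divergence theorem for piecewise Lipschitz functions *)

Section mesh_divergence.
Variables (R : realType) (n : nat) (n_gt0 : (0 < n)%N) (Omega : set 'rV[R]_n.+1).
Variables (E : finType) (vtx : E -> 'I_n.+2 -> 'rV[R]_n.+1).
Hypothesis Omega_lip : bounded_lipschitz_domain Omega.
Hypothesis mesh : conforming_mesh Omega vtx.
Local Notation face := (E * 'I_n.+2)%type.
Local Notation lam := (lebesgue_rV R).
Let free := mesh_free mesh.

(** The simplices are closed and [f] is a single function, so its values from the two sides of a
    shared face agree: no jump terms arise. *)
Definition pwlip (f : 'rV[R]_n.+1 -> R) :=
  forall K, exists L, lip_on (simplex vtx K) L f.

Lemma measurable_Omega : measurable Omega.
Proof. by apply: open_measurable_rV; exact: Omega_open Omega_lip. Qed.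

Definition mesh_bound := \sum_K \sum_i `|vtx K i|.

Lemma Omega_bounded x : Omega x -> `|x| <= mesh_bound.
Proof.
move=> /subset_closure/(closure_simplex mesh)[K Kx].
rewrite (le_trans (hull_bounded (free K) Kx))// /mesh_bound (bigD1 K)//= lerDl.
by apply: sumr_ge0 => L _; apply: sumr_ge0 => i _; exact: normr_ge0.
Qed.

Let bae_Omega := bae (n := n.+1) Omega.

(** The whole hyperplanes carrying the faces: larger than the union of the faces, still null, and
    each given by one equation. *)
Definition skeleton : set 'rV[R]_n.+1 := \bigcup_(F in [set: face])
  [set x | bary (vtx F.1) F.2 x = 0].

Lemma measurable_skeleton : measurable skeleton.
Proof.
apply: fin_bigcup_measurable => // F _; apply: measurable_rV_eq0.
exact: (measurable_bary _ _ (f := id)).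
Qed.

Lemma skeleton0 : lam n.+1 skeleton = 0%E.
Proof.
apply/(negligibleP _ measurable_skeleton).
apply: (@negligibleS _ _ _ (lam n.+1) (\bigcup_k (if @unpickle face k is Some F
    then [set x | bary (vtx F.1) F.2 x = 0] else set0))).
  by move=> x [F _ xF]; exists (pickle F) => //; rewrite pickleK.
apply: negligible_bigcup => k; case: unpickle => [F|]; last exact: negligible_set0.
apply/negligibleP.
  by apply: measurable_rV_eq0; exact: (measurable_bary _ _ (f := id)).
pose b := (F.2 == ord0)%:R - dot (vtx F.1 ord0) (fgrad vtx F).
rewrite -[RHS](@lebesgue_hyperplane R n.+1 b _ (fgrad_neq0 mesh F)); congr (lam n.+1 _).
apply/funext => x; apply/propext; rewrite /= /bary dotBl /b /fgrad.
by split; lra.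
Qed.

Lemma off_skeleton x : Omega x -> ~ skeleton x -> exists K, sint (vtx K) x.
Proof.
move=> Ox nx; have [K Kx] := closure_simplex mesh (subset_closure Ox).
exists K => i; rewrite lt_neqAle; have := (simplexP (free K) x).1 Kx i.
move=> ->; rewrite andbT eq_sym; apply/eqP => x0; apply: nx.
by exists (K, i).
Qed.

Lemma sum_sint (h : E -> 'rV[R]_n.+1 -> R) K x : sint (vtx K) x ->
  \sum_L h L x * \1_(sint (vtx L)) x = h K x.
Proof.
move=> Kx; rewrite (bigD1 K)//= indicE mem_set// mulr1 big1 ?addr0// => L LK.
rewrite indicE memNset ?mulr0// => Lx; move: LK.
by rewrite (sint_disjoint mesh Lx Kx) eqxx.
Qed.

Lemma pwlip_bae f : pwlip f -> bae_Omega f.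
Proof.
move=> /choice[L fL].
have /choice[C fC] : forall K, exists C, forall x, simplex vtx K x -> `|f x| <= C.
  by move=> K; exact: lip_bounded (free K) _ _ (fL K).
exists (fun x => \sum_K (f \_ (simplex vtx K)) x * \1_(sint (vtx K)) x), skeleton,
  (\sum_K `|C K|); split.
- apply: measurable_sum => K; apply: measurable_funM.
    have mK := measurable_hull (free K).
    by apply/(measurable_restrictT _ mK); exact: lip_on_measurable mK (fL K).
  by apply: measurable_indic; exact: measurable_sint.
- move=> x; rewrite (le_trans (ler_norm_sum _ _ _))//; apply: ler_sum => K _.
  rewrite normrM (@le_trans _ _ `|(f \_ (simplex vtx K)) x|)//.
    by rewrite ler_piMr// indicE; case: (_ \in _); rewrite ?normr1 ?normr0.
  rewrite patchE; case: ifPn => [/set_mem Kx|_]; last by rewrite normr0.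
  by rewrite (le_trans (fC _ _ Kx))// ler_norm.
- exact: measurable_skeleton.
- exact: skeleton0.
- move=> x Ox /(off_skeleton Ox)[K Kx]; rewrite (sum_sint (fun L => f \_ (simplex vtx L)) Kx).
  by rewrite patchE mem_set//; exact: sint_sub (free K) _ Kx.
Qed.

Section direction.
Variable d : 'I_n.+1.

(* Integral over the face [F] of [f] times the [d]-th component of the outward
   normal, the face being parametrized by its projection along the axis [d]. *)
Definition boundary_trace (f : 'rV[R]_n.+1 -> R) (F : face) : R :=
  - Num.sg (fgrad vtx F 0 d) * \int[lam n]_v ftrace d (vtx F.1) f F.2 v.

Lemma pwlip_partial f : pwlip f ->
  exists (g : 'rV[R]_n.+1 -> R) (N : set 'rV[R]_n.+1) (C : R),
  [/\ measurable_fun setT g, forall x, `|g x| <= C, measurable N, lam n.+1 N = 0%E &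
   (forall x, Omega x -> ~ N x -> derivable f x (delta_mx 0 d) /\ partial d f x = g x) /\
   integral_dom Omega g = \sum_F boundary_trace f F].
Proof.
move=> /choice[L fL].
have : forall K, exists MF : R * ('rV[R]_n.+1 -> R), lip_on setT MF.1 MF.2 /\
    forall x, simplex vtx K x -> MF.2 x = f x.
  move=> K.
  have [M [F [HM HF]]] := mcshane_extension (sface_sub (free K) (sface_center (free K) ord0)) (fL K).
  by exists (M, F).
move=> /choice[MF MFP].
have MFL K := (MFP K).1; have MFf K := (MFP K).2.
pose h K x := pder d (MF K).2 x.
have hM K x : `|h K x * \1_(sint (vtx K)) x| <= `|(MF K).1|.
  rewrite normrM (@le_trans _ _ `|h K x|)//.
    by rewrite ler_piMr// indicE; case: (_ \in _); rewrite ?normr1 ?normr0.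
  by rewrite (le_trans (pder_le d (MFL K) x))// ler_norm.
have mh K : measurable_fun setT (fun x => h K x * \1_(sint (vtx K)) x).
  apply: measurable_funM; first exact: measurable_pder (MFL K).
  by apply: measurable_indic; exact: measurable_sint.
pose N := skeleton `|` \bigcup_(K in [set: E]) ~` diff_set d (MF K).2.
have mD : measurable (\bigcup_(K in [set: E]) ~` diff_set d (MF K).2).
  apply: fin_bigcup_measurable => // K _; apply: measurableC.
  exact: measurable_diff_set (MFL K).
have D0 : lam n.+1 (\bigcup_(K in [set: E]) ~` diff_set d (MF K).2) = 0%E.
  apply/(negligibleP _ mD).
  apply: (@negligibleS _ _ _ (lam n.+1) (\bigcup_k (if @unpickle E k is Some K
    then ~` diff_set d (MF K).2 else set0))).
    by move=> x [K _ xK]; exists (pickle K) => //; rewrite pickleK.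
  apply: negligible_bigcup => k; case: unpickle => [K|]; last exact: negligible_set0.
  apply/negligibleP; last exact: diff_set_negligible (MFL K).
  by apply: measurableC; exact: measurable_diff_set (MFL K).
exists (fun x => \sum_K h K x * \1_(sint (vtx K)) x), N, (\sum_K `|(MF K).1|); split.
- exact: measurable_sum.
- by move=> x; rewrite (le_trans (ler_norm_sum _ _ _))//; apply: ler_sum => K _.
- by apply: measurableU => //; exact: measurable_skeleton.
- exact: lebesgue_setU0 measurable_skeleton mD skeleton0 D0.
split.
  move=> x Ox /not_orP[/(off_skeleton Ox)[K Kx] nx].
  have Dx : diff_set d (MF K).2 x by apply: contrapT => H; apply: nx; exists K.
  have nearE : \forall y \near x, (MF K).2 y = f y.
    have := @open_sint _ _ (vtx K); rewrite openE => /(_ x Kx).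
    by apply: filterS => y Ky; apply: MFf; exact: sint_sub (free K) _ Ky.
  split; first exact: near_eq_derivable nearE Dx.
  rewrite (sum_sint h Kx) /h pderE// /partial.
  by apply/esym; exact: near_eq_derive.
rewrite (integral_dom_sum measurable_Omega Omega_bounded); last first.
  move=> K _; apply: (@measurable_bae _ _ _ measurable_Omega _ `|(MF K).1|).
    exact: measurable_funTS.
  by move=> x _; exact: hM.
transitivity (\sum_K \sum_i boundary_trace f (K, i)); last by rewrite pair_bigA; apply: eq_bigr => -[].
apply: eq_bigr => K _.
rewrite -[RHS](simplex_ftc n_gt0 d (free K) (fL K) (MFL K) (MFf K)).
rewrite /integral_dom /Rintegral; congr fine; rewrite integral_mkcond [RHS]integral_mkcond.
apply: eq_integral => x _; rewrite !patchE indicE.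
case: (boolP (x \in sint (vtx K))) => [/set_mem Kx|_].
  by rewrite mem_set ?mulr1//; exact: (sint_Omega Omega_lip mesh Kx).
by rewrite mulr0 if_same.
Qed.

Lemma partial_bae f : pwlip f -> bae_Omega (partial d f).
Proof.
move=> /pwlip_partial[g [N [C [mg gC mN N0 [H _]]]]]; exists g, N, C; split=> //.
by move=> x Ox Nx; have [] := H x Ox Nx.
Qed.

(** Both faces are the same set, so the line above [v] meets them at the same point and the traces
    coincide; only the sign of the normal component changes. *)
Lemma boundary_trace_twin f F G : oface vtx G = oface vtx F -> G != F ->
  boundary_trace f G = - boundary_trace f F.
Proof.
move=> GF neq; have [a a0 aE] := twin_fgrad mesh GF neq.
have cE : fgrad vtx G 0 d = a * fgrad vtx F 0 d by rewrite aE mxE.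
have trace0 H : fgrad vtx H 0 d = 0 -> boundary_trace f H = 0.
  by move=> H0; rewrite /boundary_trace H0 sgr0 oppr0 mul0r.
have [cF|cF] := eqVneq (fgrad vtx F 0 d) 0.
  by rewrite !trace0 ?oppr0// cE cF mulr0.
have cG : fgrad vtx G 0 d != 0 by rewrite cE mulf_neq0// lt_eqF.
suff trE : ftrace d (vtx G.1) f G.2 = ftrace d (vtx F.1) f F.2.
  by rewrite /boundary_trace trE cE sgrM (ltr0_sg a0) mulN1r mulNr.
apply/funext => v; rewrite /ftrace.
have half F1 F2 : oface vtx F1 = oface vtx F2 -> fgrad vtx F1 0 d != 0 ->
    fgrad vtx F2 0 d != 0 -> oface vtx F1 (flift d (vtx F1.1) F1.2 v) ->
    flift d (vtx F2.1) F2.2 v = flift d (vtx F1.1) F1.2 v.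
  by move=> E12 c1 c2; rewrite E12 => -[H _]; exact: flift_uniq c2 H.
case: lhitP => [[c1 H1]|H1]; case: lhitP => [[c2 H2]|H2] //.
- by rewrite (half F G).
- exfalso; apply: H2; split=> //; rewrite (half G F)//.
  by rewrite -/(oface vtx F) -GF.
- exfalso; apply: H1; split=> //; rewrite (half F G)//.
  by rewrite -/(oface vtx G) GF.
Qed.

Lemma mesh_divergence f : pwlip f ->
  integral_dom Omega (partial d f) =
  \sum_(F | `[< boundary_face Omega vtx F >]) boundary_trace f F.
Proof.
move=> /pwlip_partial[g [N [C [mg gC mN N0 [H gE]]]]].
rewrite (@integral_dom_null _ _ _ _ g _ mN N0); last first.
  by move=> x Ox Nx; have [] := H x Ox Nx.
rewrite gE (bigID (fun F => `[< boundary_face Omega vtx F >]))/=.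
rewrite [X in _ + X](sum_interior_faces Omega_lip mesh) ?addr0//.
exact: boundary_trace_twin.
Qed.

Lemma mesh_divergence0 f : pwlip f -> (forall x, boundary Omega x -> f x = 0) ->
  integral_dom Omega (partial d f) = 0.
Proof.
move=> fl f0; rewrite mesh_divergence// big1// => F /asboolP bF.
rewrite /boundary_trace (_ : \int[lam n]_v _ = 0) ?mulr0//.
rewrite /Rintegral integral0_eq// => v _; rewrite /ftrace.
case: lhitP => // -[_ H]; rewrite f0//; apply: bF.
by rewrite (open_faceE mesh).
Qed.

End direction.

Lemma pwlip_cst c : pwlip (fun=> c).
Proof. by move=> K; exists 0 => x y _ _; rewrite subrr normr0 mul0r. Qed.

Lemma pwlip_coord i : pwlip (fun x => x 0 i).
Proof.
move=> K; exists 1 => x y _ _; rewrite mul1r.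
by have := rV_coord_le (x - y) i; rewrite !mxE.
Qed.

Lemma pwlipD f g : pwlip f -> pwlip g -> pwlip (fun x => f x + g x).
Proof.
move=> fl gl K; have [L HL] := fl K; have [M HM] := gl K; exists (L + M) => x y Kx Ky.
rewrite opprD addrACA (le_trans (ler_normD _ _))// mulrDl lerD//; [exact: HL|exact: HM].
Qed.

Lemma pwlipM f g : pwlip f -> pwlip g -> pwlip (fun x => f x * g x).
Proof.
move=> fl gl K; have [L HL] := fl K; have [M HM] := gl K.
have [C HC] := lip_bounded (free K) HL; have [D HD] := lip_bounded (free K) HM.
exists (L * `|D| + `|C| * M) => x y Kx Ky.
rewrite (_ : _ - _ = (f x - f y) * g x + f y * (g x - g y)); last by lra.
rewrite (le_trans (ler_normD _ _))// !normrM mulrDl lerD//.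
  rewrite mulrAC ler_pM//; first exact: HL.
  by rewrite (le_trans (HD _ Kx))// ler_norm.
rewrite -mulrA ler_pM//; last exact: HM.
by rewrite (le_trans (HC _ Ky))// ler_norm.
Qed.

Lemma pwlip_norm f : pwlip f -> pwlip (fun x => `|f x|).
Proof.
move=> fl K; have [L HL] := fl K; exists L => x y Kx Ky.
by rewrite (le_trans (ler_dist_dist _ _))//; exact: HL.
Qed.

Lemma pwlip_eq f g : (forall K x, simplex vtx K x -> f x = g x) -> pwlip f -> pwlip g.
Proof.
move=> fg fl K; have [L HL] := fl K; exists L => x y Kx Ky.
by rewrite -!(fg K)//; exact: HL.
Qed.

Lemma pwlip_sum (I : Type) (s : seq I) (P : pred I) (f : I -> 'rV[R]_n.+1 -> R) :
  (forall i, P i -> pwlip (f i)) -> pwlip (fun x => \sum_(i <- s | P i) f i x).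
Proof.
move=> bf; elim: s => [|i s IH].
  by apply: pwlip_eq (pwlip_cst 0) => K x _; rewrite big_nil.
apply: (@pwlip_eq (fun x => (if P i then f i x else 0) + \sum_(i <- s | P i) f i x)).
  by move=> K x _; rewrite big_cons; case: ifP => // _; rewrite add0r.
apply: pwlipD => //; have := bf i; case: (P i) => [/(_ isT)//|_]; exact: pwlip_cst.
Qed.

Lemma pwlip_prod (I : Type) (s : seq I) (f : I -> 'rV[R]_n.+1 -> R) :
  (forall i, pwlip (f i)) -> pwlip (fun x => \prod_(i <- s) f i x).
Proof.
move=> bf; elim: s => [|i s IH].
  by apply: pwlip_eq (pwlip_cst 1) => K x _; rewrite big_nil.
apply: (@pwlip_eq (fun x => f i x * \prod_(i <- s) f i x)).
  by move=> K x _; rewrite big_cons.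
exact: pwlipM.
Qed.

Lemma pwlipX f m : pwlip f -> pwlip (fun x => f x ^+ m).
Proof.
move=> fl; elim: m => [|m IH]; first by apply: pwlip_eq (pwlip_cst 1).
by apply: (@pwlip_eq (fun x => f x * f x ^+ m)) => [K x _|]; [rewrite exprS|exact: pwlipM].
Qed.

End mesh_divergence.

(** * Surface integrals over boundary faces *)

Section affine_integral.
Variable R : realType.
Local Notation lam := (lebesgue_rV R).

(** The changes of variables above concern nonnegative functions and are applied to the positive and
    negative parts; the transformed integrals are finite because the determinant is nonzero. *)
Lemma Rintegral_affine n (M : 'M[R]_n) (b : 'rV[R]_n) (h : 'rV[R]_n -> R) :
  \det M != 0 -> (lam n).-integrable setT (EFin \o h) ->
  \int[lam n]_v h v = `|\det M| * \int[lam n]_t h (b + t *m M).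
Proof.
move=> detM ih; have mh : measurable_fun setT h by apply/measurable_EFinP; exact: measurable_int ih.
pose phi (t : 'rV[R]_n) := b + t *m M.
have mphi : measurable_fun setT phi.
  by apply: measurable_rV_add => //; exact: measurable_rV_mul.
have key (u : 'rV[R]_n -> \bar R) : measurable_fun setT u -> (forall x, 0 <= u x)%E ->
    (\int[lam n]_v u v = `|\det M|%:E * \int[lam n]_t u (phi t))%E.
  move=> mu u0; rewrite -ge0_integralZl//; last exact: (measurableT_comp mu mphi).
  rewrite (integral_linear (f := fun v => u (b + v)) detM)//; last first.
    by apply: (measurableT_comp mu); exact: measurable_rV_add.
  rewrite -(integral_translate b mu u0).
  by apply: eq_integral => x _; rewrite addrC.
have hp := integrable_funepos measurableT ih; have hn := integrable_funeneg measurableT ih.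
have fp := integrable_fin_num measurableT hp; have fn := integrable_fin_num measurableT hn.
have Ep := key _ (measurable_int _ hp) (@funepos_ge0 _ _ _).
have En := key _ (measurable_int _ hn) (@funeneg_ge0 _ _ _).
set P := (\int[lam n]_t (EFin \o h)^\+%E (phi t))%E in Ep.
set Q := (\int[lam n]_t (EFin \o h)^\-%E (phi t))%E in En.
have D0 : 0 < `|\det M| by rewrite normr_gt0.
have fin (I J : \bar R) : (0 <= I)%E -> J \is a fin_num -> J = (`|\det M|%:E * I)%E ->
    I \is a fin_num.
  move=> I0 fJ JE; rewrite ge0_fin_numE// ltNge leye_eq; apply/negP => /eqP IE.
  by move: fJ; rewrite JE IE gt0_muley// lte_fin.
have fP : P \is a fin_num by apply: (fin P _ _ fp Ep); apply: integral_ge0 => t _; exact: funepos_ge0.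
have fQ : Q \is a fin_num by apply: (fin Q _ _ fn En); apply: integral_ge0 => t _; exact: funeneg_ge0.
have EL : (\int[lam n]_v (h v)%:E = `|\det M|%:E * P - `|\det M|%:E * Q)%E.
  by rewrite -Ep -En; exact: integralE.
have ER : (\int[lam n]_t (h (phi t))%:E = P - Q)%E.
  by rewrite integralE; congr (_ - _)%E; apply: eq_integral => t _;
    rewrite ?funeposE ?funenegE.
rewrite /Rintegral EL ER -(fineK fP) -(fineK fQ) -!EFinM -!EFinB /=.
by rewrite mulrBr.
Qed.

End affine_integral.

Section surface.
Variables (R : realType) (n : nat) (n_gt0 : (0 < n)%N) (Omega : set 'rV[R]_n.+1).
Variables (E : finType) (vtx : E -> 'I_n.+2 -> 'rV[R]_n.+1).
Hypothesis Omega_lip : bounded_lipschitz_domain Omega.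
Hypothesis mesh : conforming_mesh Omega vtx.
Local Notation face := (E * 'I_n.+2)%type.
Local Notation lam := (lebesgue_rV R).
Let free := mesh_free mesh.
Variable normal : 'rV[R]_n.+1 -> 'rV[R]_n.+1.
Hypothesis normalP : outward_unit_normal Omega vtx normal.

Lemma edge_fgrad (F : face) j : dot (row j (face_edges vtx F)) (fgrad vtx F) = 0.
Proof.
rewrite rowK bgrad_vertex//.
by rewrite (negPf (neq_lift _ _)) (negPf (neq_lift _ _)) subr0.
Qed.

Lemma face_edges_inj (F : face) (t : 'rV[R]_n) : t *m face_edges vtx F = 0 -> t = 0.
Proof.
move=> tG; have tE : face_map vtx F t = face_map vtx F 0 by rewrite /face_map tG mul0mx.
by apply/rowP => j; rewrite -[LHS](bary_face_map2 mesh F) tE (bary_face_map2 mesh).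
Qed.

(** Orthogonality to the edges makes the normal a multiple of [fgrad], which points inwards. A
    positive factor would lead into the simplex, against the outward condition, and the unit length
    fixes the factor. *)
Lemma boundary_normal (F : face) x : boundary_face Omega vtx F -> open_face vtx F x ->
  normal x = - (enorm (fgrad vtx F))^-1 *: fgrad vtx F.
Proof.
move=> bF xF; have [n1 nG near_out] := normalP bF xF.
have g0 := fgrad_neq0 mesh F; have gg := dot_gt0 g0.
rewrite (open_faceE mesh) in xF.
have [a aE] : exists a, normal x = a *: fgrad vtx F.
  apply: normal_component => // v vg.
  rewrite (tangent_comb (free F.1) (lift F.2 ord0) vg).
  rewrite (big_morph (fun w => dot w (normal x)) (fun w1 w2 => dotDl w1 w2 _) (dot0l _)).
  rewrite big1// => m mi; rewrite dotZl; case: (unliftP F.2 m) mi => [m'|] ->; last by rewrite eqxx.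
  move=> _; case: (unliftP ord0 m') => [j|] ->; last by rewrite subrr dot0l mulr0.
  by have := nG j; rewrite dotC rowK => ->; rewrite mulr0.
have a_lt0 : a < 0.
  rewrite ltNge le_eqVlt; apply/negP => /orP[/eqP a0|a0].
    by move: n1; rewrite aE -a0 scale0r dot0l => /eqP; rewrite eq_sym oner_eq0.
  have ng : 0 < dot (normal x) (bgrad (vtx F.1) F.2).
    by rewrite aE dotZl mulr_gt0.
  have : \forall s \near 0^'+, ~ closure Omega (x + s *: normal x) /\
      sint (vtx F.1) (x + s *: normal x).
    by apply: filterI => //; exact: sface_near ng.
  move=> /filter_ex[s [ns ss]]; apply: ns; apply: (simplex_closure mesh).
  exact: sint_sub (free F.1) _ ss.
rewrite aE; congr (_ *: _); have e0 : 0 < enorm (fgrad vtx F) by rewrite sqrtr_gt0.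
apply: (mulIf (lt0r_neq0 e0)); rewrite mulNr mulVf ?gt_eqF//.
have : `|a| * enorm (fgrad vtx F) = 1.
  rewrite /enorm -sqrtr_sqr -sqrtrM ?sqr_ge0// expr2 -mulrA -dotZr -dotZl -aE n1.
  exact: sqrtr1.
by rewrite ltr0_norm// mulNr => /eqP; rewrite eqr_oppLR => /eqP.
Qed.

Variable d : 'I_n.+1.

(** The Jacobian matrix of the face parametrization followed by the projection along the axis
    [d]. *)
Definition face_shadow (F : face) : 'M[R]_n := col' d (face_edges vtx F).

Lemma face_shadow_inj (F : face) (t : 'rV[R]_n) : fgrad vtx F 0 d != 0 ->
  t *m face_shadow F = 0 -> t = 0.
Proof.
move=> cF tG; apply: (@face_edges_inj F).
have wd k : (t *m face_edges vtx F) 0 (lift d k) = 0.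
  transitivity ((t *m face_shadow F) 0 k); last by rewrite tG mxE.
  by rewrite !mxE; apply: eq_bigr => j _; rewrite !mxE.
have := dot_mul t (face_edges vtx F) (fgrad vtx F).
rewrite [RHS]big1; last by move=> j _; rewrite edge_fgrad mulr0.
rewrite /dot (bigD1_ord d)//= [X in _ + X]big1 ?addr0; last first.
  by move=> k _; rewrite wd mul0r.
move=> /eqP; rewrite mulf_eq0 (negPf cF) orbF => /eqP wd0.
apply/rowP => k; rewrite [RHS]mxE; case: (unliftP d k) => [l|] ->; [exact: wd|exact: wd0].
Qed.

Lemma det_face_shadow_neq0 (F : face) : fgrad vtx F 0 d != 0 -> \det (face_shadow F) != 0.
Proof.
move=> cF; rewrite -unitfE -unitmxE -row_free_unit.
by apply: inj_row_free => v; exact: face_shadow_inj.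
Qed.

(* With [A], [B] the matrices whose first row is the [d]-th basis vector, resp. the
   unit normal [nu], and whose other rows are the edges, [A B^T] and [B B^T] are
   block triangular. *)
Lemma det_face_shadow (F : face) (nu : 'rV[R]_n.+1) :
  dot nu nu = 1 -> (forall j, dot nu (row j (face_edges vtx F)) = 0) ->
  `|\det (face_shadow F)| =
  Num.sqrt (\det (face_edges vtx F *m (face_edges vtx F)^T)) * `|nu 0 d|.
Proof.
set G := face_edges vtx F => nu1 nuG.
have GnuT : G *m nu^T = 0.
  apply/matrixP => j k; rewrite !mxE ord1 -[RHS](nuG j) dotC.
  by apply: eq_bigr => l _; rewrite !mxE.
have nuGT : nu *m G^T = 0 by rewrite -[LHS]trmxK trmx_mul trmxK GnuT trmx0.
pose A : 'M[R]_(1 + n) := col_mx (delta_mx 0 d) G.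
pose B : 'M[R]_(1 + n) := col_mx nu G.
have detA : `|\det A| = `|\det (face_shadow F)|.
  rewrite (expand_det_row A (lshift n 0)) (bigD1 d)//= big1 ?addr0; last first.
    by move=> k kd; rewrite /A col_mxEu mxE (negPf kd) andbF mul0r.
  rewrite /A col_mxEu mxE !eqxx mul1r /cofactor normrM normrX normrN1 expr1n mul1r.
  congr `|\det _|; apply/matrixP => j k; rewrite [LHS]mxE [LHS]mxE [RHS]mxE.
  have -> : lift (lshift n 0) j = rshift 1 j by exact: val_inj.
  by rewrite col_mxEd.
have nunu : nu *m nu^T = 1%:M.
  rewrite [LHS]mx11_scalar; congr (_%:M); rewrite mxE -[RHS]nu1.
  by apply: eq_bigr => l _; rewrite !mxE.
have BB : \det B * \det B = \det (G *m G^T).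
  rewrite -{2}det_tr -det_mulmx /B tr_col_mx mul_col_row nuGT GnuT nunu.
  by rewrite det_ublock det1 mul1r.
have AB : \det A * \det B = nu 0 d * \det (G *m G^T).
  rewrite -[X in _ * X]det_tr -det_mulmx /A /B tr_col_mx mul_col_row GnuT det_ublock.
  congr (_ * _); rewrite det_mx11 mxE (bigD1 d)//= big1 ?addr0; last first.
    by move=> k kd; rewrite !mxE (negPf kd) andbF mul0r.
  by rewrite !mxE !eqxx mul1r.
have B0 : \det B != 0.
  rewrite -unitfE -unitmxE -row_free_unit; apply: inj_row_free => v.
  rewrite -[v]hsubmxK /B mul_row_col => E0.
  have l0 : lsubmx v = 0.
    by have := congr1 (mulmxr nu^T) E0; rewrite /= mulmxDl -!mulmxA nunu GnuT mulmx0 addr0 mulmx1 mul0mx.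
  move: E0; rewrite l0 mul0mx add0r => /face_edges_inj ->.
  exact: row_mx0.
rewrite -detA -BB -expr2 sqrtr_sqr -normrM.
apply: (mulIf (_ : `|\det B| != 0)); first by rewrite normr_eq0.
by rewrite -!normrM AB -BB; congr `|_|; ring.
Qed.

(** Projecting the face along the axis [d] contracts its area by [|nu 0 d|], as in
    [det_face_shadow], and the sign in [boundary_trace] is that of [nu 0 d]; together they restore
    the normal component. For a face parallel to the axis both sides vanish. *)
Lemma boundary_trace_surface (f : 'rV[R]_n.+1 -> R) (F : face) :
  pwlip vtx f -> boundary_face Omega vtx F ->
  boundary_trace vtx d f F =
  Num.sqrt (\det (face_edges vtx F *m (face_edges vtx F)^T)) *
  \int[lam n]_(t in @ref_simplex R n) (normal (face_map vtx F t) 0 d * f (face_map vtx F t)).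
Proof.
move=> /(_ F.1)[L fL] bF.
set g := fgrad vtx F; pose nu : 'rV[R]_n.+1 := - (enorm g)^-1 *: g.
have gg : 0 < dot g g := dot_gt0 (fgrad_neq0 mesh F).
have e0 : 0 < enorm g by rewrite sqrtr_gt0.
have -> : \int[lam n]_(t in @ref_simplex R n) (normal (face_map vtx F t) 0 d * f (face_map vtx F t)) =
   \int[lam n]_(t in @ref_simplex R n) (nu 0 d * f (face_map vtx F t)).
  apply: eq_Rintegral => t /set_mem tr; rewrite (boundary_normal bF)//.
  by exists t.
have nudE : nu 0 d = - (enorm g)^-1 * g 0 d by rewrite mxE.
have [c0|cF] := eqVneq (g 0 d) 0.
  rewrite /boundary_trace -/g c0 sgr0 oppr0 mul0r (_ : \int[_]_(t in _) _ = 0) ?mulr0//.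
  rewrite /Rintegral integral0_eq// => t _.
  by rewrite nudE c0 mulr0 mul0r.
have detS := det_face_shadow_neq0 cF.
pose b := col' d (vtx F.1 (lift F.2 ord0)).
have shadowE t : b + t *m face_shadow F = col' d (face_map vtx F t).
  apply/rowP => k; rewrite /face_map !mxE; congr (_ + _).
  by apply: eq_bigr => j _; rewrite !mxE.
have liftE t : flift d (vtx F.1) F.2 (b + t *m face_shadow F) = face_map vtx F t.
  rewrite shadowE -[RHS](ins_col' d); apply: flift_uniq => //.
  by rewrite ins_col' (bary_face_map0 mesh).
have traceE (h : 'rV[R]_n.+1 -> R) M : lip_on (simplex vtx F.1) M h ->
    \int[lam n]_v ftrace d (vtx F.1) h F.2 v =
    `|\det (face_shadow F)| * \int[lam n]_(t in @ref_simplex R n) h (face_map vtx F t).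
  move=> hM; have iT := integrable_ftrace d (free F.1) hM F.2.
  rewrite (Rintegral_affine b detS iT); congr (_ * _).
  rewrite /Rintegral; congr fine; rewrite [RHS]integral_mkcond; apply: eq_integral => t _.
  rewrite patchE /= /ftrace; case: lhitP => [[_]|H].
    by rewrite liftE => /(face_map_sface mesh F) tr; rewrite mem_set.
  rewrite memNset// => /(face_map_sface mesh F) tr; apply: H; split=> //.
  by rewrite liftE.
have nu1 : dot nu nu = 1.
  by rewrite dotZl dotZr mulrA mulrNN -expr2 exprVn /enorm sqr_sqrtr ?(ltW gg)// mulVf// gt_eqF.
have nuG j : dot nu (row j (face_edges vtx F)) = 0.
  by rewrite dotZl dotC edge_fgrad mulr0.
have fnuL : lip_on (simplex vtx F.1) (`|nu 0 d| * L) (fun x => nu 0 d * f x).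
  by move=> x y Kx Ky; rewrite -mulrBr normrM -mulrA ler_wpM2l//; exact: fL.
have nud0 : nu 0 d != 0 by rewrite nudE mulf_neq0// oppr_eq0 invr_eq0 gt_eqF.
have fE : \int[lam n]_v ftrace d (vtx F.1) f F.2 v =
    (nu 0 d)^-1 * \int[lam n]_v ftrace d (vtx F.1) (fun x => nu 0 d * f x) F.2 v.
  have iT := integrable_ftrace d (free F.1) fnuL F.2.
  rewrite -(RintegralZl _ measurableT iT).
  apply: eq_Rintegral => v _; rewrite /ftrace; case: ifP => _; last by rewrite mulr0.
  by rewrite mulKf.
transitivity (- Num.sg (g 0 d) * \int[lam n]_v ftrace d (vtx F.1) f F.2 v); first by [].
rewrite fE (traceE _ _ fnuL) (det_face_shadow nu1 nuG) -/g.
have sgE : - Num.sg (g 0 d) * (nu 0 d)^-1 = `|nu 0 d|^-1.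
  have <- : Num.sg (nu 0 d) = - Num.sg (g 0 d).
    by rewrite nudE sgrM sgrN gtr0_sg ?invr_gt0// mulN1r.
  by rewrite {2}[nu 0 d]numEsg invfM mulrA mulfV ?sgr_eq0// mul1r.
rewrite !mulrA sgE [_^-1 * _]mulrC mulfVK ?normr_eq0//.
Qed.

End surface.

(** * Finite element functions *)

Section finite_elements.
Variables (R : realType) (n : nat) (Omega : set 'rV[R]_n.+1).
Variables (E : finType) (vtx : E -> 'I_n.+2 -> 'rV[R]_n.+1).
Hypothesis mesh : conforming_mesh Omega vtx.
Local Notation Pk := (Pk Omega vtx).

Lemma meval_pwlip (p : mpoly.mpoly n.+1 R) :
  pwlip vtx (fun x => mpoly.meval (fun i => x 0 i) p).
Proof.
apply: pwlip_eq (fun K x _ => esym (mpoly.mevalE _ _)) _.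
apply: pwlip_sum => m _; apply: (pwlipM mesh); first exact: pwlip_cst.
apply: (pwlip_prod mesh) => i; apply: (pwlipX mesh); exact: pwlip_coord.
Qed.

Lemma Pk_pwlip k v : Pk k v -> pwlip vtx v.
Proof.
move=> [_ vP] K; have [p [_ pE]] := vP K; have [L HL] := meval_pwlip p K.
by exists L => x y Kx Ky; rewrite !pE//; exact: HL.
Qed.

Lemma lipschitz_pwlip (kappa : 'rV[R]_n.+1 -> R) :
  [lipschitz kappa x | x in closure Omega] -> pwlip vtx kappa.
Proof.
move=> [M0 [_ H]] K; exists (`|M0| + 1) => x y Kx Ky.
have := H (`|M0| + 1); rewrite (le_lt_trans (ler_norm _)) ?ltrDl// => /(_ isT).
move=> /(_ (x, y)) /=; apply.
by split; apply: (simplex_closure mesh); [exact: Kx|exact: Ky].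
Qed.

Lemma PkD k v w : Pk k v -> Pk k w -> Pk k (fun x => v x + w x).
Proof.
move=> [cv vP] [cw wP]; split.
  by move=> x; apply: cvgD; [exact: cv|exact: cw].
move=> K; have [p [sp pE]] := vP K; have [q [sq qE]] := wP K; exists (p + q); split.
  by rewrite (leq_trans (mpoly.msizeD_le _ _))// geq_max sp.
by move=> x Kx; rewrite mpoly.mevalD pE// qE.
Qed.

Lemma PkZ k c v : Pk k v -> Pk k (fun x => c * v x).
Proof.
move=> [cv vP]; split.
  by move=> x; apply: cvgM; [exact: cvg_cst|exact: cv].
move=> K; have [p [sp pE]] := vP K; exists (c *: p); split.
  by rewrite (leq_trans (mpoly.msizeZ_le _ _)).
by move=> x Kx; rewrite mpoly.mevalZ pE.
Qed.

Lemma PkB k v w : Pk k v -> Pk k w -> Pk k (fun x => v x - w x).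
Proof.
move=> kv kw; rewrite (_ : (fun _ => _) = (fun x => v x + -1 * w x)).
  by apply: PkD => //; exact: PkZ.
by apply/funext => x; rewrite mulN1r.
Qed.

Lemma Pk_cst k c : Pk k (fun=> c).
Proof.
split; first by move=> x; exact: cvg_cst.
move=> K; exists (mpoly.mpolyC _ c); split; last by move=> x _; rewrite mpoly.mevalC.
by rewrite mpoly.msizeC; case: (_ != _).
Qed.

Lemma Pk_coord k i : (1 <= k)%N -> Pk k (fun x => x 0 i).
Proof.
move=> k1; split; first by apply: continuous_subspaceT => x; exact: coord_continuous.
move=> K; exists (mpoly.mpolyX R (mpoly.mnm1 i)); split.
  by rewrite mpoly.msizeX mpoly.mdeg1.
by move=> x _; rewrite mpoly.mevalXU.
Qed.

End finite_elements.

(* The [p j] are chosen so that the values of the [e i] at them have maximal rank. *)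
Lemma interpolation (R : realType) (T : Type) (X : set T) (I : finType) (e : I -> T -> R) :
  exists m (p : 'I_m -> T) (C : 'M[R]_(#|I|, m)), (forall j, X (p j)) /\
  forall x, X x -> forall i,
    e i x = \sum_j (\sum_l e (enum_val l) x * C l j) * e i (p j).
Proof.
pose ev x : 'rV[R]_#|I| := \row_l e (enum_val l) x.
pose P r := `[< exists m (p : 'I_m -> T),
  (forall j, X (p j)) /\ \rank (\matrix_(j < m) ev (p j)) = r >].
have exP : exists r, P r.
  exists 0%N; apply/asboolP; exists 0%N, (fun j : 'I_0 => match j with Ordinal _ H => match notF H with end end).
  by split=> [[]//|]; apply/eqP; rewrite -leqn0 rank_leq_row.
have ubP r : P r -> (r <= #|I|)%N.
  by move=> /asboolP[m [p [_ <-]]]; exact: rank_leq_col.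
case: (ex_maxnP exP ubP) => r /asboolP[m [p [Xp rE]]] rmax.
set M := \matrix_(j < m) _ in rE.
exists m, p, (pinvmx M); split=> // x Xx i.
have xM : (ev x <= M)%MS.
  (* Adjoining [x] to the points cannot raise the maximal rank, so [ev x] already lies in the row
     space of [M]. *)
  pose p' (j : 'I_m.+1) := oapp p x (unlift ord0 j).
  pose M' := \matrix_(j < m.+1) ev (p' j).
  have MM' : (M <= M')%MS.
    apply/row_subP => j; rewrite rowK.
    have -> : ev (p j) = row (lift ord0 j) M' by rewrite rowK /p' liftK.
    exact: row_sub.
  have M'M : (M' <= M)%MS.
    rewrite -(mxrank_leqif_sup MM').2 eqn_leq mxrankS//= rE; apply: rmax.
    apply/asboolP; exists m.+1, p'; split=> // j; rewrite /p'.
    by case: unliftP => [j'|] _ //=.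
  apply: submx_trans M'M; have -> : ev x = row ord0 M' by rewrite rowK /p' unlift_none.
  exact: row_sub.
transitivity (ev x 0 (enum_rank i)); first by rewrite mxE enum_rankK.
rewrite -[in LHS](mulmxKpV xM) mxE; apply: eq_bigr => j _; rewrite !mxE enum_rankK.
by congr (_ * _); apply: eq_bigr => l _; rewrite mxE.
Qed.

Section finite_element_interpolation.
Variables (R : realType) (n : nat) (n_gt0 : (0 < n)%N) (Omega : set 'rV[R]_n.+1).
Variables (E : finType) (vtx : E -> 'I_n.+2 -> 'rV[R]_n.+1).
Hypothesis Omega_lip : bounded_lipschitz_domain Omega.
Hypothesis mesh : conforming_mesh Omega vtx.

(* A single finite family [phi], independent of [v]: this separates time and space
   in the discrete solution. *)
Lemma Pk_interpolation k : exists m (p : 'I_m -> 'rV[R]_n.+1) (phi : 'I_m -> 'rV[R]_n.+1 -> R),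
  [/\ forall j, closure Omega (p j), forall j, bae Omega (phi j) &
      forall v, Pk Omega vtx k v -> forall x, closure Omega x ->
        v x = \sum_j v (p j) * phi j x].
Proof.
(* One simplex containing it is chosen for each point of the closure. On shared faces the choice is
   arbitrary but harmless, as all the local polynomials of [v] agree with [v] there. *)
have /choice[c cP] : forall x, exists K, closure Omega x -> exists2 L, K = Some L & simplex vtx L x.
  move=> x; have [Ox|Ox] := pselect (closure Omega x); last by exists None.
  by have [L Lx] := closure_simplex mesh Ox; exists (Some L) => _; exists L.
(* The bound on the degree is strict: these are the monomials of total degree at most [k]. *)
pose mon (m : mpoly.bmultinom n.+1 k.+1) (x : 'rV[R]_n.+1) :=
  mpoly.meval (fun i => x 0 i) (mpoly.mpolyX R (mpoly.bmnm m)).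
pose e (Km : E * mpoly.bmultinom n.+1 k.+1) x := (c x == Some Km.1)%:R * mon Km.2 x.
have [m [p [C [Xp pE]]]] := interpolation (closure Omega) e.
exists m, p, (fun j x => \sum_l e (enum_val l) x * C l j); split=> //.
  move=> j; apply: bae_sum => l _; apply: baeM; last exact: bae_cst.
  case: (enum_val l) => K mm; apply: baeM; last first.
    exact: (pwlip_bae mesh (meval_pwlip mesh _)).
  (* Off the skeleton a point lies in only one simplex, so the cut-off defined by the choice [c] is
     the indicator of an open simplex. *)
  apply: (@bae_null _ _ _ (\1_(sint (vtx K))) _ _ (measurable_skeleton vtx) (skeleton0 mesh)).
    move=> x Ox sx; have [L Lx] := off_skeleton mesh Ox sx.
    have [M cM Mx] := cP x (subset_closure Ox).
    have ML : M = L.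
      apply: (sint_disjoint mesh _ Lx) => i; rewrite lt_neqAle.
      rewrite ((simplexP (mesh_free mesh M) x).1 Mx i) andbT eq_sym.
      by apply/eqP => x0; apply: sx; exists (M, i).
    rewrite indicE cM ML /=; congr (_%:R); congr nat_of_bool; apply/idP/eqP.
      by move=> /set_mem Kx; congr Some; exact: (sint_disjoint mesh Lx Kx).
    by move=> [<-]; exact/mem_set.
  exists (\1_(sint (vtx K))), set0, 1; split=> //.
    exact: measurable_indic (measurable_sint _).
  by move=> x; rewrite indicE; case: (_ \in _); rewrite ?normr1 ?normr0.
move=> v [_ /choice[q qP]] x Ox.
have vE z : closure Omega z -> v z = \sum_Km mpoly.mcoeff (mpoly.bmnm Km.2) (q Km.1) * e Km z.
  move=> Oz; have [L cL Lz] := cP z Oz; have [sq ->//] := qP L.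
  rewrite -(pair_bigA _ (fun K m => mpoly.mcoeff (mpoly.bmnm m) (q K) * e (K, m) z))/=.
  rewrite (bigD1 L)//= [X in _ + X]big1 ?addr0; last first.
    move=> K KL; apply: big1 => m' _; rewrite /e cL/= (_ : _ == _ = false) ?mul0r ?mulr0//.
    by apply/eqP => -[LK]; rewrite LK eqxx in KL.
  rewrite {1}(mpoly.mpolywE sq) raddf_sum; apply: eq_bigr => m' _.
  by rewrite /e cL eqxx mul1r /= mpoly.mevalZ.
rewrite vE//; transitivity (\sum_Km \sum_j mpoly.mcoeff (mpoly.bmnm Km.2) (q Km.1) * ((\sum_l e (enum_val l) x * C l j) * e Km (p j))).
  by apply: eq_bigr => Km _; rewrite (pE _ Ox) mulr_sumr.
rewrite exchange_big/=.
apply: eq_bigr => j _.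
rewrite vE//.
by rewrite [RHS]mulr_suml; apply: eq_bigr => Km _; rewrite mulrCA mulrC.
Qed.

End finite_element_interpolation.

(** * Derivatives in time *)

Lemma is_derive1_sum (R : realType) m (h : 'I_m -> R -> R) (dh : 'I_m -> R) (t : R) :
  (forall j, is_derive t (1 : R) (h j) (dh j)) ->
  is_derive t (1 : R) (fun s => \sum_j h j s) (\sum_j dh j).
Proof.
move=> H; rewrite (_ : (fun _ => _) = \sum_j h j); first exact: is_derive_sum.
by apply/funext => s; rewrite fct_sumE.
Qed.

Lemma is_derive1M (R : realType) (f g : R -> R) (t df dg : R) :
  is_derive t (1 : R) f df -> is_derive t (1 : R) g dg ->
  is_derive t (1 : R) (fun s => f s * g s) (f t * dg + df * g t).
Proof. by move=> Hf Hg; rewrite [df * _]mulrC; exact: is_deriveM. Qed.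

Lemma is_derive1Mr (R : realType) (f : R -> R) (t df c : R) :
  is_derive t (1 : R) f df -> is_derive t (1 : R) (fun s => f s * c) (df * c).
Proof.
move=> Hf; rewrite -[df * c]add0r -[X in X + _](mulr0 (f t)).
exact: is_derive1M Hf (is_derive_cst _ _ _).
Qed.

Section time_derivatives.
Variables (R : realType) (n : nat) (Omega : set 'rV[R]_n.+1).
Variables (E : finType) (vtx : E -> 'I_n.+2 -> 'rV[R]_n.+1).
Hypothesis Omega_lip : bounded_lipschitz_domain Omega.
Hypothesis mesh : conforming_mesh Omega vtx.
Let mO := measurable_Omega Omega_lip.
Let bO := Omega_bounded mesh.
Variables (k : nat) (J : set R) (J_open : open J) (t : R) (Jt : J t).
Variable v : R -> 'rV[R]_n.+1 -> R.
Hypothesis v_fe : forall s, J s -> Pk Omega vtx k (v s).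
Hypothesis v_derivable : forall x, closure Omega x -> derivable (fun s => v s x) t 1.

Let nearJ : \forall s \near t, J s.
Proof. exact: open_nbhs_nbhs. Qed.

Lemma time_separation : exists m (a : 'I_m -> R -> R) (da : 'I_m -> R)
    (phi : 'I_m -> 'rV[R]_n.+1 -> R),
  [/\ forall j, bae Omega (phi j), forall j, is_derive t 1 (a j) (da j),
      forall s, J s -> forall x, Omega x -> v s x = \sum_j a j s * phi j x &
      forall x, Omega x -> time_derivative v t x = \sum_j da j * phi j x].
Proof.
have [m [p [phi [Op bphi vE]]]] := Pk_interpolation mesh k.
exists m, (fun j s => v s (p j)), (fun j => 'D_1 (fun s => v s (p j)) t), phi; split=> //.
- by move=> j; apply: derivableP; exact: v_derivable.
- by move=> s Js x /subset_closure Ox; rewrite (vE _ (v_fe Js)).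
move=> x /subset_closure Ox; rewrite /time_derivative derive1E.
have H : is_derive t 1 (fun s => \sum_j v s (p j) * phi j x)
    (\sum_j 'D_1 (fun s => v s (p j)) t * phi j x).
  apply: is_derive1_sum => j; exact: is_derive1Mr (derivableP (v_derivable (Op j))).
apply: derive_val; apply: near_eq_is_derive H.
by apply: filterS nearJ => s Js; rewrite (vE _ (v_fe Js)).
Qed.

Lemma time_derivative_bae : bae Omega (time_derivative v t).
Proof.
have [m [a [da [phi [bphi _ _ dE]]]]] := time_separation.
apply: bae_eq (fun x Ox => esym (dE x Ox)) _.
by apply: bae_sum => j _; apply: baeM => //; exact: bae_cst.
Qed.

Lemma is_derive_integral w : bae Omega w ->
  is_derive t 1 (fun s => integral_dom Omega (fun x => w x * v s x))
    (integral_dom Omega (fun x => w x * time_derivative v t x)).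
Proof.
move=> bw; have [m [a [da [phi [bphi aP vE dE]]]]] := time_separation.
have sepE c (f : 'rV[R]_n.+1 -> R) : (forall x, Omega x -> f x = \sum_j c j * phi j x) ->
    integral_dom Omega (fun x => w x * f x) =
    \sum_j c j * integral_dom Omega (fun x => w x * phi j x).
  move=> fE; rewrite (eq_integral_dom (g := fun x => \sum_j c j * (w x * phi j x))).
    rewrite (integral_dom_sum mO bO) => [|j _]; last first.
      by apply: baeM; [exact: bae_cst|exact: baeM].
    by apply: eq_bigr => j _; rewrite (integral_domZ mO bO)//; exact: baeM.
  by move=> x Ox; rewrite fE// mulr_sumr; apply: eq_bigr => j _; rewrite mulrCA.
rewrite (sepE da)//.
apply: (near_eq_is_derive (f := fun s => \sum_j a j s * integral_dom Omega (fun x => w x * phi j x))).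
  by apply: filterS nearJ => s Js; rewrite (sepE (a^~ s))//; exact: vE.
by apply: is_derive1_sum => j; exact: is_derive1Mr (aP j).
Qed.

(** After separation this is a quadratic form in the coefficients [a j], with the constant Gram
    matrix [G]; no differentiation under the integral sign is involved. *)
Lemma is_derive_integral_sqr :
  is_derive t 1 (fun s => integral_dom Omega (fun x => v s x * v s x))
    (2 * integral_dom Omega (fun x => time_derivative v t x * v t x)).
Proof.
have [m [a [da [phi [bphi aP vE dE]]]]] := time_separation.
pose G j l := integral_dom Omega (fun x => phi j x * phi l x).
have sepE c d (f h : 'rV[R]_n.+1 -> R) : (forall x, Omega x -> f x = \sum_j c j * phi j x) ->
    (forall x, Omega x -> h x = \sum_j d j * phi j x) ->
    integral_dom Omega (fun x => f x * h x) = \sum_j \sum_l c j * d l * G j l.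
  move=> fE hE.
  rewrite (eq_integral_dom (g := fun x => \sum_j \sum_l (c j * d l) * (phi j x * phi l x))).
    rewrite (integral_dom_sum mO bO) => [|j _]; last first.
      by apply: bae_sum => l _; apply: baeM; [exact: bae_cst|exact: baeM].
    apply: eq_bigr => j _; rewrite (integral_dom_sum mO bO) => [|l _]; last first.
      by apply: baeM; [exact: bae_cst|exact: baeM].
    by apply: eq_bigr => l _; rewrite (integral_domZ mO bO)//; exact: baeM.
  move=> x Ox; rewrite fE// hE// mulr_suml; apply: eq_bigr => j _.
  by rewrite mulr_sumr; apply: eq_bigr => l _; rewrite mulrACA.
have -> : 2 * integral_dom Omega (fun x => time_derivative v t x * v t x) =
    \sum_j \sum_l (a j t * da l + da j * a l t) * G j l.
  rewrite (sepE da (a^~ t))//; last exact: vE.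
  rewrite mulr2n mulrDl !mul1r.
  have -> : \sum_j \sum_l (a j t * da l + da j * a l t) * G j l =
      \sum_j \sum_l a j t * da l * G j l + \sum_j \sum_l da j * a l t * G j l.
    rewrite -big_split; apply: eq_bigr => j _; rewrite -big_split/=.
    by apply: eq_bigr => l _; rewrite mulrDl.
  congr (_ + _); rewrite exchange_big; apply: eq_bigr => j _; apply: eq_bigr => l _.
  rewrite [da l * _]mulrC; congr (_ * _); apply: eq_integral_dom => x _; exact: mulrC.
apply: (near_eq_is_derive (f := fun s => \sum_j \sum_l a j s * a l s * G j l)).
  by apply: filterS nearJ => s Js; rewrite (sepE (a^~ s) (a^~ s))//; exact: vE.
apply: is_derive1_sum => j; apply: is_derive1_sum => l.
exact: is_derive1Mr (is_derive1M (aP j) (aP l)).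
Qed.

End time_derivatives.

(** * Weak identities for the scheme *)

Section transport.
Variables (R : realType) (n : nat) (n_gt0 : (0 < n)%N) (Omega : set 'rV[R]_n.+1).
Variables (E : finType) (vtx : E -> 'I_n.+2 -> 'rV[R]_n.+1).
Hypothesis Omega_lip : bounded_lipschitz_domain Omega.
Hypothesis mesh : conforming_mesh Omega vtx.
Let mO := measurable_Omega Omega_lip.
Let bO := Omega_bounded mesh.
Local Notation "\I_ ( x ) f" := (integral_dom Omega (fun x => f))
  (at level 10, x name, f at level 9, format "\I_ ( x )  f").

Lemma partialM3 d f g h : pwlip vtx f -> pwlip vtx g -> pwlip vtx h ->
  \I_(x) (partial d (fun x => f x * g x * h x) x) =
  \I_(x) (partial d f x * g x * h x + f x * partial d g x * h x + f x * g x * partial d h x).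
Proof.
move=> /(pwlip_partial n_gt0 Omega_lip mesh d)[f' [N [C [_ _ mN N0 [Hf _]]]]].
move=> /(pwlip_partial n_gt0 Omega_lip mesh d)[g' [N' [C' [_ _ mN' N'0 [Hg _]]]]].
move=> /(pwlip_partial n_gt0 Omega_lip mesh d)[h' [M [D [_ _ mM M0 [Hh _]]]]].
apply: (@integral_dom_null _ _ _ _ _ ((N `|` N') `|` M)).
- by apply: measurableU => //; exact: measurableU.
- by apply: lebesgue_setU0 => //; [exact: measurableU|exact: lebesgue_setU0].
move=> x Ox /not_orP[/not_orP[Nx N'x] Mx].
have [df _] := Hf x Ox Nx; have [dg _] := Hg x Ox N'x; have [dh _] := Hh x Ox Mx.
rewrite /partial (deriveM (derivableM df dg) dh) (deriveM df dg) /=.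
rewrite !fctE /GRing.scale /=; ring.
Qed.

Lemma partial_cst (d : 'I_n.+1) (c : R) x : partial d (fun=> c) x = 0.
Proof. exact: derive_cst. Qed.

Lemma partial_affine d (c m : R) (v : 'rV[R]_n.+1) x :
  partial d (fun z => c * (dot z v - m)) x = c * v 0 d.
Proof.
apply: cvg_lim => //; apply: cvg_near_cst; near=> h.
have h0 : h != 0 by near: h; exact: nbhs_dnbhs_neq.
rewrite /= dotDl dotZl (_ : dot (delta_mx 0 d) v = v 0 d); last first.
  rewrite /dot (bigD1 d)//= big1 ?addr0 => [|i id]; first by rewrite mxE !eqxx mul1r.
  by rewrite mxE eqxx (negPf id) mul0r.
rewrite (_ : _ - _ = h * (c * v 0 d)); last by ring.
by rewrite /GRing.scale/= mulKf.
Unshelve. all: by end_near. Qed.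

Lemma grad_bae f i : pwlip vtx f -> bae Omega (fun x => grad f x 0 i).
Proof.
move=> fl; apply: bae_eq (partial_bae n_gt0 Omega_lip mesh i fl) => x _.
by rewrite mxE.
Qed.

Variable u : 'rV[R]_n.+1 -> 'rV[R]_n.+1.
Hypothesis u_lip : forall i, pwlip vtx (fun x => u x 0 i).
Hypothesis u_bd : forall x, boundary Omega x -> u x = 0.

Lemma vdiv_bae : bae Omega (vdiv u).
Proof. by apply: bae_sum => i _; exact: (partial_bae n_gt0 Omega_lip mesh i (u_lip i)). Qed.

Lemma dot_grad_bae f : pwlip vtx f -> bae Omega (fun x => dot (u x) (grad f x)).
Proof.
move=> fl; apply: bae_sum => i _; apply: baeM; last exact: grad_bae.
exact: (pwlip_bae mesh (u_lip i)).
Qed.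

(** The divergence of [f g u] has zero integral because [u] vanishes on the boundary, whatever [f]
    and [g] do there. *)
Lemma transport f g : pwlip vtx f -> pwlip vtx g ->
  \I_(x) (dot (u x) (grad f x) * g x) =
  - \I_(x) (vdiv u x * f x * g x) - \I_(x) (f x * dot (u x) (grad g x)).
Proof.
move=> fl gl.
have [bf bg] := (pwlip_bae mesh fl, pwlip_bae mesh gl).
have bu i := pwlip_bae mesh (u_lip i).
have bd i h hl := partial_bae n_gt0 Omega_lip mesh i (f := h) hl.
pose T i x := partial i (fun z => u z 0 i) x * f x * g x + u x 0 i * partial i f x * g x
  + u x 0 i * f x * partial i g x.
have bT i : bae Omega (T i).
  apply: baeD; [apply: baeD|]; apply: baeM => //; try apply: baeM => //; exact: bd.
have : \I_(x) (\sum_i T i x) = 0.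
  rewrite (integral_dom_sum mO bO)//; apply: big1 => i _.
  rewrite -partialM3//; apply: (mesh_divergence0 n_gt0 Omega_lip mesh).
    by apply: (pwlipM mesh) => //; exact: (pwlipM mesh).
  by move=> x /u_bd ux; rewrite ux mxE !mul0r.
have bD := vdiv_bae; have bgf := dot_grad_bae fl; have bgg := dot_grad_bae gl.
rewrite (eq_integral_dom (g := fun x => vdiv u x * f x * g x + dot (u x) (grad f x) * g x
   + f x * dot (u x) (grad g x))); last first.
  move=> x _; rewrite /T !big_split/= /vdiv /dot !mulr_suml mulr_sumr.
  by congr (_ + _ + _); apply: eq_bigr => i _; rewrite mxE// mulrA; congr (_ * _); exact: mulrC.
rewrite !(integral_domD mO bO)//; first by move=> H0; lra.
all: repeat (first [assumption | apply: baeD | apply: baeM]).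
Qed.

Lemma integral_vdiv : \I_(x) (vdiv u x) = 0.
Proof.
have d1 (x : 'rV[R]_n.+1) : dot (u x) (grad (fun=> 1 : R) x) = 0.
  by rewrite /dot big1// => i _; rewrite mxE partial_cst mulr0.
have := transport (pwlip_cst vtx (1 : R)) (pwlip_cst vtx (1 : R)).
rewrite (eq_integral_dom (g := fun=> 0)); last by move=> x _; rewrite d1 mul0r.
rewrite [X in _ - X](eq_integral_dom (g := fun=> 0)); last by move=> x _; rewrite d1 mulr0.
rewrite integral_dom0 subr0 => /esym/eqP; rewrite oppr_eq0 => /eqP I0; rewrite -[RHS]I0.
by apply: eq_integral_dom => x _; rewrite !mulr1.
Qed.

End transport.

(** * Tracer balance *)

Section balances.
Variables (R : realType) (n : nat) (n_gt0 : (0 < n)%N) (Omega : set 'rV[R]_n.+1).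
Variables (E : finType) (vtx : E -> 'I_n.+2 -> 'rV[R]_n.+1).
Hypothesis Omega_lip : bounded_lipschitz_domain Omega.
Hypothesis mesh : conforming_mesh Omega vtx.
Let mO := measurable_Omega Omega_lip.
Let bO := Omega_bounded mesh.
Local Notation "\I_ ( x ) f" := (integral_dom Omega (fun x => f))
  (at level 10, x name, f at level 9, format "\I_ ( x )  f").
Local Notation point := 'rV[R]_n.+1.
Local Notation baeO := (bae (n := n.+1) Omega).
Local Notation y := (@ycoord R n.+1).

Let IZ c f (bf : baeO f) := integral_domZ mO bO c bf.
Let ID f g (bf : baeO f) (bg : baeO g) := integral_domD mO bO bf bg.
Let IB f g (bf : baeO f) (bg : baeO g) := integral_domB mO bO bf bg.

Definition up_index : 'I_n.+1 := Ordinal (n_gt0 : (1 < n.+1)%N).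
Local Notation e1 := up_index.

Lemma yhatE i : yhat R n.+1 0 i = (i == e1)%:R.
Proof. by rewrite mxE. Qed.

Lemma dot_yhat (v : point) : dot v (yhat R n.+1) = v 0 e1.
Proof.
rewrite /dot (bigD1 e1)//= yhatE eqxx mulr1 big1 ?addr0// => i ie.
by rewrite yhatE (negPf ie) mulr0.
Qed.

Lemma grad_height c m (x : point) :
  grad (fun z => c * (y z - m)) x = c *: yhat R n.+1.
Proof. by apply/rowP => i; rewrite mxE partial_affine [RHS]mxE. Qed.

Lemma volume_neq0 : fine (lebesgue_rV R n.+1 Omega) != 0.
Proof.
have [[x Ox] oO _ _ _] := Omega_lip.
have v0 : (0 < lebesgue_rV R n.+1 Omega)%E by exact: lebesgue_open_gt0 oO Ox.
by rewrite gt_eqF// fine_gt0// v0/=; exact: lebesgue_bounded_lty mO bO.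
Qed.

Lemma integral_cst c : \I_(x) c = c * fine (lebesgue_rV R n.+1 Omega).
Proof. exact: Rintegral_cst. Qed.

Lemma integral_sub_mean f : baeO f -> \I_(x) (f x - mean Omega f) = 0.
Proof.
move=> bf; rewrite IB//; last exact: bae_cst.
by rewrite integral_cst /mean mulrAC mulVf ?volume_neq0// mul1r subrr.
Qed.

Variables (k : nat) (k_ge1 : (1 <= k)%N).
Local Notation Pk := (Pk Omega vtx k).

Lemma Pk_bae f : Pk f -> baeO f.
Proof. by move=> /(Pk_pwlip mesh)/(pwlip_bae mesh). Qed.

Lemma Pk_height c m : Pk (fun x => c * (y x - m)).
Proof.
apply: PkZ; apply: PkB; last exact: Pk_cst.
rewrite (_ : y = fun x => x 0 e1); first exact: Pk_coord.
by apply/funext => x; exact: dot_yhat.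
Qed.

Lemma Pk_y : Pk y.
Proof.
rewrite (_ : y = fun x => x 0 e1); first exact: Pk_coord.
by apply/funext => x; exact: dot_yhat.
Qed.

Variable u : point -> point.
Hypothesis u_fe : velocity_space Omega vtx k u.
Hypothesis div_eq : continuity_equation Omega vtx k u.

Lemma velocity_pwlip i : pwlip vtx (fun x => u x 0 i).
Proof. by have [/(_ 0 i)/(Pk_pwlip mesh)] := u_fe. Qed.

Let u_bd : forall x, boundary Omega x -> u x = 0 := u_fe.2.

Lemma velocity_bae i : baeO (fun x => u x 0 i).
Proof. exact: (pwlip_bae mesh (velocity_pwlip i)). Qed.

Let bdiv : baeO (vdiv u) := vdiv_bae n_gt0 Omega_lip mesh velocity_pwlip.

(* The continuity equation is only tested with mean-free functions; the mean
   contributes a multiple of the integral of [vdiv u], which vanishes. *)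
Lemma weakly_divergence_free f : Pk f -> \I_(x) (vdiv u x * f x) = 0.
Proof.
move=> kf; have bf := Pk_bae kf.
have : ip Omega (vdiv u) (fun x => f x - mean Omega f) = 0.
  apply: div_eq; split; last exact: integral_sub_mean.
  by apply: PkB => //; exact: Pk_cst.
rewrite /ip (eq_integral_dom (g := fun x => vdiv u x * f x - mean Omega f * vdiv u x)); last first.
  by move=> x _; ring.
rewrite IB; [|exact: baeM|by apply: baeM => //; exact: bae_cst].
by rewrite IZ// (integral_vdiv n_gt0 Omega_lip mesh velocity_pwlip u_bd) mulr0 subr0.
Qed.

(** The vertical velocity is [u . grad y]; an integration by parts leaves [vdiv u] against the
    height, a legitimate test function as [k >= 1]. The two constants given to [Pk_height] are
    arbitrary. *)
Lemma integral_u1 : \I_(x) (u x 0 e1) = 0.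
Proof.
have := transport n_gt0 Omega_lip mesh velocity_pwlip u_bd (pwlip_cst vtx 1)
  (Pk_pwlip mesh (Pk_height 1 1)).
rewrite (eq_integral_dom (g := fun=> 0)); last first.
  by move=> x _; rewrite /dot big1 ?mul0r// => i _; rewrite mxE partial_cst mulr0.
rewrite integral_dom0 (eq_integral_dom (g := fun x => vdiv u x * (1 * (y x - 1)))); last first.
  by move=> x _; ring.
rewrite (weakly_divergence_free (Pk_height 1 1)) oppr0 sub0r => /esym/eqP; rewrite oppr_eq0 => /eqP I0.
rewrite -[RHS]I0; apply: eq_integral_dom => x _.
by rewrite grad_height dotZr dot_yhat !mul1r.
Qed.

Section tracer.
Variables (kappa sigma h : point -> R) (C : R) (Kvms : point -> 'M[R]_n.+1).
Variables (Pi : (point -> R) -> point -> point) (phi dphi : point -> R).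
Local Notation K := (stab_diag sigma C h u).
Hypothesis kappa_lip : pwlip vtx kappa.
Hypothesis sigma_lip : pwlip vtx sigma.
Hypothesis h_lip : pwlip vtx h.
Hypothesis Kvms_bae : forall i j, baeO (fun x => Kvms x i j).
Hypothesis PiP : forall f, Pk f -> tracer_projection Omega vtx k Kvms f (Pi f).
Hypothesis phi_fe : Pk phi.
Hypothesis dphi_bae : baeO dphi.

(** The diagonal entry of the diffusion matrix in the direction of [yhat], the only one that a test
    function of the height sees. *)
Definition vertical_diffusivity (x : point) := kappa x + sigma x * C * h x * `|u x 0 e1|.
Local Notation kv := vertical_diffusivity.

Lemma vertical_diffusivity_pwlip : pwlip vtx kv.
Proof.
apply: pwlipD => //; apply: (pwlipM mesh); last exact: pwlip_norm (velocity_pwlip _).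
apply: (pwlipM mesh) => //; apply: (pwlipM mesh) => //; exact: pwlip_cst.
Qed.

Lemma vertical_flux (x : point) :
  yhat R n.+1 *m ((kappa x)%:M + K x) = kv x *: yhat R n.+1.
Proof.
apply/rowP => j; rewrite mulmxDr mul_mx_scalar mul_mx_diag !mxE /kv mulrDl.
by congr (_ + _); case: eqP => [j1|]; rewrite ?mul1r ?mulr1 ?mul0r ?mulr0//; congr (_ * `|u x 0 _|); exact: val_inj.
Qed.

(* The gradient of the test function is constant, so the difference with its
   projection is itself admissible in the definition of the projection. *)
Lemma vms_term c m : ipmx Omega (fun x => (grad phi x - Pi phi x) *m Kvms x)
  (fun x => grad (fun z => c * (y z - m)) x - Pi (fun z => c * (y z - m)) x) = 0.
Proof.
have [GP1 GP2] := PiP phi_fe; have [WP1 _] := PiP (Pk_height c m).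
set z := fun x => grad _ x - _.
have zP : Pkmx Omega vtx k z.
  move=> i j; rewrite (_ : (fun _ => _) = fun x => (c *: yhat R n.+1) i j -
    Pi (fun z => c * (y z - m)) x i j); last by apply/funext => x; rewrite /z grad_height !mxE.
  by apply: PkB; [exact: Pk_cst|exact: WP1].
have bz j : baeO (fun x => z x 0 j) := Pk_bae (zP 0 j).
have bG j : baeO (fun x => (Pi phi x *m Kvms x) 0 j).
  apply: (@bae_eq _ _ _ (fun x => \sum_l Pi phi x 0 l * Kvms x l j)).
    by move=> x _; rewrite mxE.
  by apply: bae_sum => l _; apply: baeM => //; exact: Pk_bae (GP1 0 l).
have bg j : baeO (fun x => (grad phi x *m Kvms x) 0 j).
  apply: (@bae_eq _ _ _ (fun x => \sum_l grad phi x 0 l * Kvms x l j)).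
    by move=> x _; rewrite mxE.
  apply: bae_sum => l _; apply: baeM => //; exact: (grad_bae n_gt0 Omega_lip mesh l (Pk_pwlip mesh phi_fe)).
have ipE (A : point -> point) : ipmx Omega A z = \I_(x) (\sum_j A x 0 j * z x 0 j).
  by apply: eq_integral_dom => x _; rewrite big_ord1.
have := GP2 z zP; rewrite !ipE => GE.
rewrite (eq_integral_dom (g := fun x => \sum_j (grad phi x *m Kvms x) 0 j * z x 0 j
   - \sum_j (Pi phi x *m Kvms x) 0 j * z x 0 j)); last first.
  move=> x _; rewrite -sumrB; apply: eq_bigr => j _.
  by rewrite mulmxBl mxE [in X in _ + X]mxE mulrBl.
by rewrite IB ?GE ?subrr//; apply: bae_sum => j _; exact: baeM.
Qed.

(** Integrating the transport term by parts produces minus the integral of [vdiv u * phi * w], and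
    the scheme adds half of it back, so half survives. Both mean values drop out, since [phi] and
    [w] are themselves in [Pk] and integrate to zero against [vdiv u]. *)
Lemma tracer_balance (g : R) :
  tracer_equation Omega vtx k kappa K Kvms Pi u phi dphi ->
  \I_(x) (g * (y x - mean Omega y) * dphi x) =
  2^-1 * g * \I_(x) (vdiv u x * phi x * y x) + g * \I_(x) (phi x * u x 0 e1)
  - g * \I_(x) (kv x * partial e1 phi x).
Proof.
set m := mean Omega y; move=> /(_ _ (Pk_height g m)); rewrite vms_term addr0.
set w := fun x => g * (y x - m).
have lphi := Pk_pwlip mesh phi_fe; have bphi := Pk_bae phi_fe.
have bw : baeO w := Pk_bae (Pk_height g m).
have by_ := Pk_bae Pk_y.
have bkv : baeO kv := pwlip_bae mesh vertical_diffusivity_pwlip.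
have bd := partial_bae n_gt0 Omega_lip mesh e1 lphi.
have bt := dot_grad_bae n_gt0 Omega_lip mesh velocity_pwlip lphi.
have bu1 := velocity_bae e1.
have bc c := bae_cst Omega c.
have -> : ipmx Omega (fun x => grad phi x *m ((kappa x)%:M + K x)) (grad w) =
    g * \I_(x) (kv x * partial e1 phi x).
  rewrite -IZ; last exact: baeM.
  apply: eq_integral_dom => x _; rewrite big_ord1 grad_height -/(dot _ _) dotZr dot_yhat.
  rewrite mulmxDr mul_mx_scalar mul_mx_diag !mxE /kv mulrDl; congr (_ * (_ + _)).
  exact: mulrC.
have dw0 : \I_(x) (vdiv u x * w x) = 0 by exact: weakly_divergence_free (Pk_height g m).
have dphi0 := weakly_divergence_free phi_fe.
set P := \I_(x) (vdiv u x * phi x * y x).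
have dphiw : \I_(x) (vdiv u x * phi x * w x) = g * P.
  rewrite (eq_integral_dom (g := fun x => g * (vdiv u x * phi x * y x) - g * m * (vdiv u x * phi x))); last first.
    by move=> x _; rewrite /w; ring.
  rewrite IB ?IZ ?dphi0 ?mulr0 ?subr0//.
  all: try by repeat (first [assumption | exact: bc | apply: baeM]).
have dotw : \I_(x) (dot (u x) (grad phi x) * w x) = - (g * P) - g * \I_(x) (phi x * u x 0 e1).
  rewrite (transport n_gt0 Omega_lip mesh velocity_pwlip u_bd lphi (Pk_pwlip mesh (Pk_height g m))).
  rewrite -/w dphiw -IZ; last exact: baeM.
  congr (_ - _); apply: eq_integral_dom => x _.
  by rewrite grad_height dotZr dot_yhat mulrCA.
have -> : ip Omega (fun x => dphi x + dot (u x) (grad phi x)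
    + 2^-1 * vdiv u x * (phi x - mean Omega phi)) w =
  \I_(x) (w x * dphi x) + \I_(x) (dot (u x) (grad phi x) * w x)
  + (2^-1 * \I_(x) (vdiv u x * phi x * w x) - 2^-1 * mean Omega phi * \I_(x) (vdiv u x * w x)).
  rewrite -IZ; last by repeat (first [assumption | exact: bc | apply: baeM]).
  rewrite -IZ; last by repeat (first [assumption | exact: bc | apply: baeM]).
  rewrite -IB; [|by repeat (first [assumption | exact: bc | apply: baeM])..].
  rewrite -ID; [|by repeat (first [assumption | exact: bc | apply: baeM])..].
  rewrite -ID; [|by repeat (first [assumption | exact: bc | apply: baeM | apply: baeB | apply: baeD])..].
  by apply: eq_integral_dom => x _; ring.
rewrite dotw dphiw dw0; lra.
Qed.

(** The divergence theorem for the vertical field of size [kv * c * phi]. Only the derivative of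
    [phi] occurs in the scheme; the one of [kv], which contains an absolute value, appears here and
    exists almost everywhere. *)
Lemma vertical_diffusion (normal : point -> point) c : outward_unit_normal Omega vtx normal ->
  let flux x := yhat R n.+1 *m ((kappa x)%:M + K x) in
  c * \I_(x) (kv x * partial e1 phi x) =
  ip_boundary Omega vtx (fun x => dot (normal x) (flux x)) (fun x => c * phi x)
  - ip Omega (vdiv flux) (fun x => c * phi x).
Proof.
move=> normalP flux; have lkv := vertical_diffusivity_pwlip.
have lphi := Pk_pwlip mesh phi_fe; have lc := pwlip_cst vtx c.
have bphi := Pk_bae phi_fe; have bkv : baeO kv := pwlip_bae mesh lkv.
have bc := bae_cst Omega c.
have bdk := partial_bae n_gt0 Omega_lip mesh e1 lkv.
have bdp := partial_bae n_gt0 Omega_lip mesh e1 lphi.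
have -> : flux = fun x => kv x *: yhat R n.+1 by apply/funext => x; exact: vertical_flux.
have -> : vdiv (fun x => kv x *: yhat R n.+1) = partial e1 kv.
  apply/funext => x; rewrite /vdiv (bigD1 e1)//= big1 ?addr0 => [|i ie].
    by congr partial; apply/funext => z; rewrite mxE yhatE eqxx mulr1.
  rewrite -[RHS](partial_cst i 0 x); congr partial; apply/funext => z.
  by rewrite mxE yhatE (negPf ie) mulr0.
have lf : pwlip vtx (fun x => kv x * c * phi x) by apply: (pwlipM mesh) => //; exact: (pwlipM mesh).
have -> : ip_boundary Omega vtx (fun x => dot (normal x) (kv x *: yhat R n.+1))
    (fun x => c * phi x) = \I_(x) (partial e1 (fun z => kv z * c * phi z) x).
  rewrite (mesh_divergence n_gt0 Omega_lip mesh e1 lf); apply: eq_bigr => F /asboolP bF.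
  rewrite (boundary_trace_surface mesh normalP e1 lf bF); congr (_ * _).
  by apply: eq_Rintegral => t _; rewrite dotZr dot_yhat; ring.
rewrite (partialM3 n_gt0 Omega_lip mesh e1 lkv lc lphi) /ip.
rewrite [X in _ = X - _](eq_integral_dom (g := fun x => partial e1 kv x * (c * phi x) + c * (kv x * partial e1 phi x))); last first.
  by move=> x _; rewrite partial_cst; ring.
rewrite ID; [|by repeat (first [assumption | apply: baeM])..].
by rewrite (IZ c (baeM bkv bdp)) [X in _ = X - _]addrC addrK.
Qed.

End tracer.

Lemma norm2mxE p q (A : point -> 'M[R]_(p, q)) : norm2mx Omega A ^+ 2 = ipmx Omega A A.
Proof.
rewrite sqr_sqrtr//; apply: integral_dom_ge0 => x _.
by apply: sumr_ge0 => i _; apply: sumr_ge0 => j _; rewrite -expr2 sqr_ge0.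
Qed.

Section roots.
Variables (sigma h : point -> R) (C : R).
Local Notation N := (stab_diag sigma C h u).

Lemma sandwich_root2 (A : point -> 'M[R]_n.+1) x i j : sandwich (root2 N) A x i j =
  Num.sqrt (sigma x * C * h x * `|u x 0 i|) * A x i j * Num.sqrt (sigma x * C * h x * `|u x 0 j|).
Proof.
have -> : root2 N = fun x => diag_mx (\row_i Num.sqrt (sigma x * C * h x * `|u x 0 i|)).
  apply/funext => z; apply/matrixP => a b; rewrite !mxE; case: eqP => //= _.
  by rewrite !mulr0n sqrtr0.
by rewrite /sandwich mul_diag_mx mul_mx_diag !mxE.
Qed.

Lemma sandwich_root4 (A : point -> 'M[R]_n.+1) x i j : sandwich (root4 N) A x i j =
  Num.sqrt (Num.sqrt (sigma x * C * h x * `|u x 0 i|)) * A x i j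
  * Num.sqrt (Num.sqrt (sigma x * C * h x * `|u x 0 j|)).
Proof.
have -> : root4 N = fun x => diag_mx (\row_i Num.sqrt (Num.sqrt (sigma x * C * h x * `|u x 0 i|))).
  apply/funext => z; apply/matrixP => a b; rewrite !mxE; case: eqP => //= _.
  by rewrite !mulr0n !sqrtr0.
by rewrite /sandwich mul_diag_mx mul_mx_diag !mxE.
Qed.

Lemma norm_sandwich (A : point -> 'M[R]_n.+1) :
  norm2mx Omega (sandwich (root4 N) A) ^+ 2 = ipmx Omega (sandwich (root2 N) A) A.
Proof.
rewrite norm2mxE; apply: eq_integral_dom => x Ox.
apply: eq_bigr => i _; apply: eq_bigr => j _; rewrite !sandwich_root4 sandwich_root2.
(* [a] and [b] are themselves square roots, hence nonnegative whatever stands under them, so their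
   own roots square back to them. *)
set a := Num.sqrt (_ * `|u x 0 i|); set b := Num.sqrt (_ * `|u x 0 j|).
have sa : Num.sqrt a * Num.sqrt a = a by rewrite -expr2 sqr_sqrtr// sqrtr_ge0.
have sb : Num.sqrt b * Num.sqrt b = b by rewrite -expr2 sqr_sqrtr// sqrtr_ge0.
rewrite -[in RHS]sa -[in RHS]sb; ring.
Qed.

End roots.

End balances.

(** * Momentum balance *)

Section momentum.
Variables (R : realType) (n : nat) (n_gt0 : (0 < n)%N) (Omega : set 'rV[R]_n.+1).
Variables (E : finType) (vtx : E -> 'I_n.+2 -> 'rV[R]_n.+1).
Hypothesis Omega_lip : bounded_lipschitz_domain Omega.
Hypothesis mesh : conforming_mesh Omega vtx.
Let mO := measurable_Omega Omega_lip.
Let bO := Omega_bounded mesh.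
Local Notation "\I_ ( x ) f" := (integral_dom Omega (fun x => f))
  (at level 10, x name, f at level 9, format "\I_ ( x )  f").
Local Notation point := 'rV[R]_n.+1.
Local Notation baeO := (bae (n := n.+1) Omega).
Local Notation y := (@ycoord R n.+1).
Local Notation e1 := (up_index n_gt0).
Let IZ c f (bf : baeO f) := integral_domZ mO bO c bf.
Let ID f g (bf : baeO f) (bg : baeO g) := integral_domD mO bO bf bg.

Variables (k : nat) (u : point -> point).
Hypothesis u_fe : velocity_space Omega vtx k u.
Hypothesis div_eq : continuity_equation Omega vtx k u.
Let ul : forall i, pwlip vtx (fun x => u x 0 i) := velocity_pwlip mesh u_fe.
Let bu : forall i, baeO (fun x => u x 0 i) := velocity_bae mesh u_fe.
Let bdiv : baeO (vdiv u) := vdiv_bae n_gt0 Omega_lip mesh ul.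
Local Notation uj j := (fun x : point => u x 0 j).

(** Contracted with [u], the terms [u . grad u] and [(grad u) u] both give the sum over [j] of
    [t j * u_j]. By [transport] with [f = g = u_j], twice its integral is minus that of
    [vdiv u * u_j ^+ 2], which the third convective term cancels. *)
Lemma convection (a : point -> point) : (forall j, baeO (fun x => a x 0 j)) ->
  ipmx Omega (fun x => a x + u x *m vgrad u x + u x *m (vgrad u x)^T + vdiv u x *: u x) u =
  \sum_j \I_(x) (a x 0 j * u x 0 j).
Proof.
move=> ba; pose t j x := dot (u x) (grad (uj j) x).
have bt j : baeO (t j) := dot_grad_bae n_gt0 Omega_lip mesh ul (ul j).
pose F j x := a x 0 j * u x 0 j + (2 * (t j x * u x 0 j) + vdiv u x * u x 0 j * u x 0 j).
have b1 j : baeO (fun x => a x 0 j * u x 0 j) by exact: baeM.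
have b2 j : baeO (fun x => t j x * u x 0 j) by exact: baeM.
have b3 j : baeO (fun x => vdiv u x * u x 0 j * u x 0 j) by apply: baeM => //; exact: baeM.
have b4 j : baeO (fun x => 2 * (t j x * u x 0 j)) by apply: baeM => //; exact: bae_cst.
have b5 j : baeO (fun x => 2 * (t j x * u x 0 j) + vdiv u x * u x 0 j * u x 0 j) by exact: baeD.
transitivity (\I_(x) (\sum_j F j x)).
  apply: eq_integral_dom => x _; rewrite big_ord1.
  transitivity (\sum_j (a x 0 j * u x 0 j + (u x *m vgrad u x) 0 j * u x 0 j
      + (u x *m (vgrad u x)^T) 0 j * u x 0 j + vdiv u x * u x 0 j * u x 0 j)).
    by apply: eq_bigr => j _; rewrite !mxE; ring.
  rewrite /F !big_split/= -addrA -addrA; congr (_ + _); rewrite addrA; congr (_ + _).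
  have E1 : \sum_j (u x *m vgrad u x) 0 j * u x 0 j = \sum_j t j x * u x 0 j.
    by apply: eq_bigr => j _; congr (_ * _); rewrite mxE; apply: eq_bigr => i _; rewrite !mxE.
  have E2 : \sum_j (u x *m (vgrad u x)^T) 0 j * u x 0 j = \sum_j t j x * u x 0 j.
    transitivity (\sum_j \sum_i u x 0 i * vgrad u x j i * u x 0 j).
      by apply: eq_bigr => j _; rewrite mxE mulr_suml; apply: eq_bigr => i _; rewrite mxE.
    rewrite exchange_big; apply: eq_bigr => i _ /=; rewrite /t /dot mulr_suml.
    by apply: eq_bigr => j _; rewrite !mxE; ring.
  by rewrite E1 E2 -mulr_sumr mulr2n mulrDl mul1r.
rewrite (integral_dom_sum mO bO) => [|j _]; last exact: baeD.
apply: eq_bigr => j _; rewrite ID// ID// IZ//.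
have := transport n_gt0 Omega_lip mesh ul u_fe.2 (ul j) (ul j).
rewrite [X in _ = _ - X](eq_integral_dom (g := fun x => t j x * u x 0 j)); last first.
  by move=> x _; exact: mulrC.
rewrite -/(t j) => H; lra.
Qed.

Variables (sigma h gamma delta_rho P : point -> R) (C : R).
Variables (sigma' h' : point -> R) (C' : R).
Variables (Pi : (point -> point) -> point -> 'M[R]_n.+1) (dtu : point -> point).
Local Notation N := (stab_diag sigma C h u).
Local Notation Nvms := (stab_diag sigma' C' h' u).
Local Notation D := (sym2 (vgrad u)).
Local Notation Dvms := (fun x => D x - sym2 (Pi u) x).
Hypothesis sigma_lip : pwlip vtx sigma.
Hypothesis h_lip : pwlip vtx h.
Hypothesis gamma_ge0 : forall x, Omega x -> 0 <= gamma x.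
Hypothesis P_fe : pressure_space Omega vtx k P.
Hypothesis dtu_bae : forall j, baeO (fun x => dtu x 0 j).
Hypothesis delta_bae : baeO delta_rho.

Lemma D_bae i j : baeO (fun x => D x i j).
Proof.
apply: (@bae_eq _ _ _ (fun x => partial i (uj j) x + partial j (uj i) x)).
  by move=> x _; rewrite !mxE.
by apply: baeD; [exact: (partial_bae n_gt0 Omega_lip mesh i (ul j))
  |exact: (partial_bae n_gt0 Omega_lip mesh j (ul i))].
Qed.

Let momentum_budget (g c s p gd G v V1 V2 vm W r1 r2 I1 I2 : R) :
    c - p + gd + 2^-1 * v + 2^-1 * vm = - r1 - 2^-1 * r2 ->
    c = s -> p = 0 -> gd = G -> v = V1 + V2 -> W = vm -> r1 = g * I1 -> r2 = g * I2 ->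
    s + 2^-1 * V1 + 2^-1 * V2 + G + 2^-1 * W = - (g * I1) - 2^-1 * g * I2.
Proof. by move=> Hc cs p0 gG Hv -> Hr1 Hr2; move: Hc; rewrite cs p0 gG Hv Hr1 Hr2; lra. Qed.

Lemma momentum_balance (g rho0 nu : R) : rho0 != 0 -> 0 <= nu ->
  momentum_equation Omega vtx k g rho0 nu gamma N Nvms Pi delta_rho u dtu P ->
  \sum_j \I_(x) (dtu x 0 j * u x 0 j)
  + 2^-1 * norm2mx Omega (fun x => Num.sqrt nu *: D x) ^+ 2
  + 2^-1 * norm2mx Omega (sandwich (root4 N) D) ^+ 2
  + norm2 Omega (fun x => Num.sqrt (gamma x) * vdiv u x) ^+ 2
  + 2^-1 * norm2mx Omega (sandwich (root4 Nvms) Dvms) ^+ 2 =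
  - (g * \I_(x) (delta_rho x / rho0 * u x 0 e1))
  - 2^-1 * g * \I_(x) (delta_rho x / rho0 * y x * vdiv u x).
Proof.
move=> rho0_neq0 nu_ge0 /(_ _ u_fe) /=.
have bN i j : baeO (fun x => sandwich (root2 N) D x i j * D x i j).
  apply: baeM; last exact: D_bae.
  apply: (bae_eq (fun x _ => esym (sandwich_root2 u sigma h C D x i j))).
  have br l : baeO (fun x => Num.sqrt (sigma x * C * h x * `|u x 0 l|)).
    apply: bae_sqrt; apply: (pwlip_bae mesh); apply: (pwlipM mesh); last exact: pwlip_norm.
    by apply: (pwlipM mesh) => //; apply: (pwlipM mesh) => //; exact: pwlip_cst.
  by apply: baeM => //; apply: baeM => //; exact: D_bae.
have bnu i j : baeO (fun x => (Num.sqrt nu *: D x) i j * (Num.sqrt nu *: D x) i j).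
  have H : baeO (fun x => (Num.sqrt nu *: D x) i j).
    apply: (@bae_eq _ _ _ (fun x => Num.sqrt nu * D x i j)); first by move=> x _; rewrite [RHS]mxE.
    by apply: baeM; [exact: bae_cst|exact: D_bae].
  exact: baeM.
have Psi0 : ip Omega P (vdiv u) = 0.
  by rewrite -[RHS](div_eq P_fe); apply: eq_integral_dom => x _; exact: mulrC.
have gammaE : ip Omega (fun x => gamma x * vdiv u x) (vdiv u) =
    norm2 Omega (fun x => Num.sqrt (gamma x) * vdiv u x) ^+ 2.
  rewrite sqr_sqrtr; last by apply: integral_dom_ge0 => x _; rewrite -expr2 sqr_ge0.
  apply: eq_integral_dom => x Ox.
  by rewrite mulrACA -expr2 sqr_sqrtr ?gamma_ge0// mulrA.
have viscE : ipmx Omega (fun x => nu *: D x + sandwich (root2 N) D x) D =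
    norm2mx Omega (fun x => Num.sqrt nu *: D x) ^+ 2
    + norm2mx Omega (sandwich (root4 N) D) ^+ 2.
  rewrite norm_sandwich norm2mxE -ID; [|by apply: bae_sum => i _; apply: bae_sum..].
  apply: eq_integral_dom => x _; rewrite -big_split; apply: eq_bigr => i _ /=.
  rewrite -big_split; apply: eq_bigr => j _ /=.
  rewrite [in LHS]mxE [X in (X + _) * _]mxE ![(Num.sqrt nu *: D x) i j]mxE.
  by rewrite mulrACA -expr2 sqr_sqrtr// mulrDl mulrA.
move=> H; have vmsE := norm_sandwich Omega u sigma' h' C' Dvms.
have F1 : ipmx Omega (fun x => (g * delta_rho x / rho0) *: yhat R n.+1) u =
    g * \I_(x) (delta_rho x / rho0 * u x 0 e1).
  rewrite -IZ; last by apply: baeM => //; apply: baeM => //; exact: bae_cst.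
  apply: eq_integral_dom => x _; rewrite big_ord1 -/(dot _ _) dotZl dotC (dot_yhat n_gt0).
  by rewrite !mulrA.
have F2 : ip Omega (fun x => delta_rho x / rho0 * g * y x) (vdiv u) =
    g * \I_(x) (delta_rho x / rho0 * y x * vdiv u x).
  rewrite -IZ; first by apply: eq_integral_dom => x _; ring.
  apply: baeM => //; apply: baeM; first by apply: baeM => //; exact: bae_cst.
  by apply: (Pk_bae mesh (k := 1)); exact: Pk_y.
exact (momentum_budget H (convection dtu_bae) Psi0 gammaE viscE vmsE F1 F2).
Qed.

End momentum.

(** * The energy identity *)

Section energy.
Variables (R : realType) (n : nat) (Omega : set 'rV[R]_n.+1).
Variables (E : finType) (vtx : E -> 'I_n.+2 -> 'rV[R]_n.+1).
Hypothesis Omega_lip : bounded_lipschitz_domain Omega.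
Hypothesis mesh : conforming_mesh Omega vtx.
Let mO := measurable_Omega Omega_lip.
Let bO := Omega_bounded mesh.
Local Notation "\I_ ( x ) f" := (integral_dom Omega (fun x => f))
  (at level 10, x name, f at level 9, format "\I_ ( x )  f").
Local Notation point := 'rV[R]_n.+1.
Let IZ c f (bf : bae Omega f) := integral_domZ mO bO c bf.
Let ID f g (bf : bae Omega f) (bg : bae Omega g) := integral_domD mO bO bf bg.
Lemma stab_diag_bae (sigma h : point -> R) C (v : point -> point) i j :
  bae Omega sigma -> bae Omega h -> bae Omega (fun x => v x 0 i) ->
  bae Omega (fun x => stab_diag sigma C h v x i j).
Proof.
move=> bs bh bv.
apply: (@bae_eq _ _ _ (fun x => sigma x * C * h x * `|v x 0 i| * (i == j)%:R)).
  by move=> x _; rewrite !mxE mulr_natr.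
apply: baeM; last exact: bae_cst.
apply: baeM; last exact: bae_norm.
by apply: baeM => //; apply: baeM => //; exact: bae_cst.
Qed.

(** The reference values [T0] and [S0] enter only through a constant multiple of [f], whose integral
    is zero. It serves for [f] the vertical velocity and for [f] the product of [vdiv u] and the
    height. *)
Lemma buoyancy_integral (rho0 alphaT betaS T0 S0 : R) (f a b : point -> R) :
  rho0 != 0 -> bae Omega f -> bae Omega a -> bae Omega b -> \I_(x) (f x) = 0 ->
  \I_(x) (density_perturbation rho0 alphaT betaS T0 S0 a b x / rho0 * f x) =
  - alphaT * \I_(x) (a x * f x) + betaS * \I_(x) (b x * f x).
Proof.
move=> rho0_neq0 bf ba bb f0; have bc c := bae_cst Omega c.
have baf := baeM ba bf; have bbf := baeM bb bf.
pose c := alphaT * T0 - betaS * S0.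
rewrite (eq_integral_dom (g := fun x =>
  (- alphaT * (a x * f x) + betaS * (b x * f x)) + c * f x)); last first.
  by move=> x _; rewrite /density_perturbation /c [rho0 * _]mulrC mulfK//; ring.
have bA := baeM (bc (- alphaT)) baf; have bB := baeM (bc betaS) bbf.
rewrite (ID (baeD bA bB) (baeM (bc c) bf)) (ID bA bB).
by rewrite (IZ (- alphaT) baf) (IZ betaS bbf) (IZ c bf) f0 mulr0 addr0.
Qed.

Variables (k : nat) (J : set R) (J_open : open J).
Variables (T S : R -> point -> R) (u : R -> point -> point).
Hypothesis T_fe : forall t, J t -> tracer_space Omega vtx k (T t).
Hypothesis S_fe : forall t, J t -> tracer_space Omega vtx k (S t).
Hypothesis u_fe : forall t, J t -> velocity_space Omega vtx k (u t).
Variables (t : R) (Jt : J t).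
Hypothesis T_derivable : forall x, closure Omega x -> derivable (fun s => T s x) t 1.
Hypothesis S_derivable : forall x, closure Omega x -> derivable (fun s => S s x) t 1.
Hypothesis u_derivable : forall x, closure Omega x -> derivable (fun s => u s x) t 1.
Local Notation uj j := (fun s (x : point) => u s x 0 j).

Lemma velocity_derivable j x : closure Omega x -> derivable (fun s => u s x 0 j) t 1.
Proof. by move=> /u_derivable/derivable_mxP. Qed.

Lemma time_derivative_coord j x : closure Omega x ->
  time_derivative u t x 0 j = time_derivative (uj j) t x.
Proof.
by move=> /u_derivable ux; rewrite /time_derivative !derive1E derive_mx// mxE.
Qed.

Lemma velocity_fe s j : J s -> Pk Omega vtx k.+1 (uj j s).
Proof. by move=> /u_fe[/(_ 0 j)]. Qed.

Lemma velocity_dt_bae j : bae Omega (fun x => time_derivative u t x 0 j).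
Proof.
apply: (@bae_eq _ _ _ (time_derivative (uj j) t)).
  by move=> x /subset_closure/time_derivative_coord ->.
apply: (time_derivative_bae mesh J_open Jt (k := k.+1)).
  by move=> s Js; exact: velocity_fe.
by move=> x; exact: velocity_derivable.
Qed.

Lemma energy_derivative (alphaT betaS : R) w : bae Omega w ->
  is_derive t 1 (fun s => 2^-1 * norm2mx Omega (u s) ^+ 2
     + ip Omega w (fun x => - alphaT * T s x + betaS * S s x))
  (\sum_j \I_(x) (time_derivative u t x 0 j * u t x 0 j)
   + (- alphaT * \I_(x) (w x * time_derivative T t x)
      + betaS * \I_(x) (w x * time_derivative S t x))).
Proof.
move=> bw.
pose e s := (\sum_j \I_(x) (u s x 0 j * u s x 0 j)) * 2^-1
  + (\I_(x) (w x * T s x) * - alphaT + \I_(x) (w x * S s x) * betaS).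
have nearJ : \forall s \near t, J s by exact: open_nbhs_nbhs.
apply: (near_eq_is_derive (f := e)).
  apply: filterS nearJ => s Js.
  have bT := Pk_bae mesh (T_fe Js); have bS := Pk_bae mesh (S_fe Js).
  have bc c := bae_cst Omega c.
  have bu j := Pk_bae mesh (velocity_fe j Js).
  rewrite /e norm2mxE mulrC; congr (_ * _ + _).
    rewrite -(integral_dom_sum mO bO) => [|j _]; last by apply: baeM; exact: bu.
    by apply: eq_integral_dom => x _; rewrite big_ord1.
  rewrite [X in X + _]mulrC [X in _ + X]mulrC -IZ; last exact: baeM.
  rewrite -IZ; last exact: baeM.
  rewrite -ID; [|by repeat (first [assumption | exact: bc | apply: baeM])..].
  by apply: eq_integral_dom => x _; ring.
have -> : \sum_j \I_(x) (time_derivative u t x 0 j * u t x 0 j) =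
    (\sum_j 2 * \I_(x) (time_derivative (uj j) t x * u t x 0 j)) * 2^-1.
  rewrite mulr_suml; apply: eq_bigr => j _; rewrite mulrAC divff// mul1r.
  by apply: eq_integral_dom => x /subset_closure Ox; rewrite time_derivative_coord.
rewrite [- alphaT * _]mulrC [betaS * _]mulrC.
apply: is_deriveD; last apply: is_deriveD.
- apply: is_derive1Mr; apply: is_derive1_sum => j.
  apply: (is_derive_integral_sqr Omega_lip mesh J_open Jt (k := k.+1) (v := uj j)).
    by move=> s Js; exact: velocity_fe.
  by move=> x; exact: velocity_derivable.
- by apply: is_derive1Mr; exact: (is_derive_integral Omega_lip mesh J_open Jt T_fe T_derivable bw).
- by apply: is_derive1Mr; exact: (is_derive_integral Omega_lip mesh J_open Jt S_fe S_derivable bw).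
Qed.

End energy.

(** For the tracer [T], [AT], [BT] and [DT] stand for the integrals of [vdiv u * T * y], of [T]
    times the vertical velocity and of the vertical diffusive flux; [fT] and [hT] for its volume and
    boundary terms; likewise for [S]. The buoyancy work [I1], [I2] cancels the [A] and [B] terms of
    the potential energy, and only diffusion is left. *)
Lemma energy_budget (R : realFieldType)
    (g a b AT BT DT AS BS DS dT dS U X1 X2 X3 X4 hT hS fT fS I1 I2 dE : R) :
  dT = 2^-1 * g * AT + g * BT - g * DT -> dS = 2^-1 * g * AS + g * BS - g * DS ->
  U + 2^-1 * X1 + 2^-1 * X2 + X3 + 2^-1 * X4 = - (g * I1) - 2^-1 * g * I2 ->
  I1 = - a * BT + b * BS -> I2 = - a * AT + b * AS ->
  g * a * DT = hT - fT -> g * b * DS = hS - fS -> dE = U + (- a * dT + b * dS) ->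
  dE + 2^-1 * X1 + 2^-1 * X2 + X3 + 2^-1 * X4 = - fT + fS + hT - hS.
Proof. by move=> -> -> HU I1E I2E HT HS ->; move: HU; rewrite I1E I2E; lra. Qed.

Theorem theorem4p1 (R : realType) (n : nat)
  (dim : n.+1 = 2%N \/ n.+1 = 3%N)
  (Omega : set 'rV[R]_n.+1)
  (Omega_lip : bounded_lipschitz_domain Omega)
  (E : finType) (vtx : E -> 'I_n.+2 -> 'rV[R]_n.+1)
  (mesh : conforming_mesh Omega vtx)
  (normal : 'rV[R]_n.+1 -> 'rV[R]_n.+1)
  (normalP : outward_unit_normal Omega vtx normal)
  (k : nat) (k_ge1 : (1 <= k)%N)
  (g rho0 alphaT betaS T0 S0 nu : R)
  (g_gt0 : 0 < g) (rho0_gt0 : 0 < rho0) (nu_ge0 : 0 <= nu)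
  (kappaT kappaS : 'rV[R]_n.+1 -> R)
  (kappaT_lip : [lipschitz kappaT x | x in closure Omega])
  (kappaS_lip : [lipschitz kappaS x | x in closure Omega])
  (kappaT_ge0 : forall x, closure Omega x -> 0 <= kappaT x)
  (kappaS_ge0 : forall x, closure Omega x -> 0 <= kappaS x)
  (J : set R) (J_open : open J)
  (h : 'rV[R]_n.+1 -> R)
  (h_fe : tracer_space Omega vtx k h)
  (h_ge0 : forall x, closure Omega x -> 0 <= h x)
  (Cmax Cmax_vms : R) (Cmax_ge0 : 0 <= Cmax) (Cmax_vms_ge0 : 0 <= Cmax_vms)
  (sigmaT sigmaS sigmau : R -> 'rV[R]_n.+1 -> R)
  (sigma_fe : forall t, J t ->
    [/\ tracer_space Omega vtx k (sigmaT t), tracer_space Omega vtx k (sigmaS t)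
      & tracer_space Omega vtx k (sigmau t)])
  (sigma_01 : forall t, J t -> forall x, closure Omega x ->
    [/\ 0 <= sigmaT t x <= 1, 0 <= sigmaS t x <= 1 & 0 <= sigmau t x <= 1])
  (T S : R -> 'rV[R]_n.+1 -> R)
  (u : R -> 'rV[R]_n.+1 -> 'rV[R]_n.+1)
  (P : R -> 'rV[R]_n.+1 -> R)
  (T_fe : forall t, J t -> tracer_space Omega vtx k (T t))
  (S_fe : forall t, J t -> tracer_space Omega vtx k (S t))
  (u_fe : forall t, J t -> velocity_space Omega vtx k (u t))
  (P_fe : forall t, J t -> pressure_space Omega vtx k (P t))
  (T_C1 : forall x, closure Omega x -> C1_on J (fun t => T t x))
  (S_C1 : forall x, closure Omega x -> C1_on J (fun t => S t x))
  (u_C1 : forall x, closure Omega x -> C1_on J (fun t => u t x)) :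
  let KT t := stab_diag (sigmaT t) Cmax h (u t) in
  let KS t := stab_diag (sigmaS t) Cmax h (u t) in
  let N t := stab_diag (sigmau t) Cmax h (u t) in
  let KTvms t := stab_diag (compl_indicator (sigmaT t)) Cmax_vms h (u t) in
  let KSvms t := stab_diag (compl_indicator (sigmaS t)) Cmax_vms h (u t) in
  let Nvms t := stab_diag (compl_indicator (sigmau t)) Cmax_vms h (u t) in
  let gamma t := grad_div_coef Cmax h (u t) in
  let delta_rho t := density_perturbation rho0 alphaT betaS T0 S0 (T t) (S t) in
  forall
  (PiT PiS : R -> ('rV[R]_n.+1 -> R) -> 'rV[R]_n.+1 -> 'rV[R]_n.+1)
  (Piu : R -> ('rV[R]_n.+1 -> 'rV[R]_n.+1) -> 'rV[R]_n.+1 -> 'M[R]_n.+1)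
  (PiTP : forall t, J t -> forall phi, tracer_space Omega vtx k phi ->
    tracer_projection Omega vtx k (KTvms t) phi (PiT t phi))
  (PiSP : forall t, J t -> forall phi, tracer_space Omega vtx k phi ->
    tracer_projection Omega vtx k (KSvms t) phi (PiS t phi))
  (PiuP : forall t, J t -> forall v, velocity_space Omega vtx k v ->
    velocity_projection Omega vtx k (Nvms t) v (Piu t v))
  (T_eq : forall t, J t ->
    tracer_equation Omega vtx k kappaT (KT t) (KTvms t) (PiT t) (u t)
      (T t) (time_derivative T t))
  (S_eq : forall t, J t ->
    tracer_equation Omega vtx k kappaS (KS t) (KSvms t) (PiS t) (u t)
      (S t) (time_derivative S t))
  (u_eq : forall t, J t ->
    momentum_equation Omega vtx k g rho0 nu (gamma t) (N t) (Nvms t) (Piu t)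
      (delta_rho t) (u t) (time_derivative u t) (P t))
  (div_eq : forall t, J t -> continuity_equation Omega vtx k (u t)),
  let y := @ycoord R n.+1 in
  let Du t := sym2 (vgrad (u t)) in
  let DPiu t := sym2 (Piu t (u t)) in
  let energy t :=
    2^-1 * norm2mx Omega (u t) ^+ 2
    + ip Omega (fun x => g * (y x - mean Omega y))
               (fun x => - alphaT * T t x + betaS * S t x) in
  let fluxT t := fun x => yhat R n.+1 *m ((kappaT x)%:M + KT t x) in
  let fluxS t := fun x => yhat R n.+1 *m ((kappaS x)%:M + KS t x) in
  forall t, J t ->
    derivable energy t 1 /\
    derive1 energy t
    + 2^-1 * norm2mx Omega (fun x => Num.sqrt nu *: Du t x) ^+ 2
    + 2^-1 * norm2mx Omega (sandwich (root4 (N t)) (Du t)) ^+ 2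
    + norm2 Omega (fun x => Num.sqrt (gamma t x) * vdiv (u t) x) ^+ 2
    + 2^-1 * norm2mx Omega
        (sandwich (root4 (Nvms t)) (fun x => Du t x - DPiu t x)) ^+ 2
    = - ip Omega (vdiv (fluxT t)) (fun x => g * alphaT * T t x)
      + ip Omega (vdiv (fluxS t)) (fun x => g * betaS * S t x)
      + ip_boundary Omega vtx (fun x => dot (normal x) (fluxT t x))
          (fun x => g * alphaT * T t x)
      - ip_boundary Omega vtx (fun x => dot (normal x) (fluxS t x))
          (fun x => g * betaS * S t x).
Proof.
move=> KT KS N KTvms KSvms Nvms gamma delta_rho PiT PiS Piu PiTP PiSP PiuP T_eq S_eq u_eq div_eq
  y Du DPiu energy fluxT fluxS t Jt.
have n_gt0 : (0 < n)%N by case: dim => -[->].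
have T_dt x (Ox : closure Omega x) := (T_C1 x Ox t Jt).1.
have S_dt x (Ox : closure Omega x) := (S_C1 x Ox t Jt).1.
have u_dt x (Ox : closure Omega x) := (u_C1 x Ox t Jt).1.
have bw : bae Omega (fun x => g * (y x - mean Omega y)).
  by apply: (Pk_bae mesh (k := k)); exact: Pk_height.
have dE := energy_derivative Omega_lip mesh J_open T_fe S_fe u_fe Jt T_dt S_dt u_dt alphaT betaS bw.
split; first by case: dE.
have [sT_fe sS_fe su_fe] := sigma_fe t Jt.
have lh := Pk_pwlip mesh h_fe.
have lsT := Pk_pwlip mesh sT_fe; have lsS := Pk_pwlip mesh sS_fe; have lsu := Pk_pwlip mesh su_fe.
have lkT := lipschitz_pwlip mesh kappaT_lip; have lkS := lipschitz_pwlip mesh kappaS_lip.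
have uP := u_fe t Jt; have dP := div_eq t Jt.
have TP := T_fe t Jt; have SP := S_fe t Jt.
have bT := Pk_bae mesh TP; have bS := Pk_bae mesh SP.
have bdT := time_derivative_bae mesh J_open Jt T_fe T_dt.
have bdS := time_derivative_bae mesh J_open Jt S_fe S_dt.
have bh := Pk_bae mesh h_fe.
have bu i := velocity_bae mesh uP i.
have vms_bae (s : 'rV[R]_n.+1 -> R) i j : tracer_space Omega vtx k s ->
    bae Omega (fun x => stab_diag (compl_indicator s) Cmax_vms h (u t) x i j).
  by move=> /(Pk_bae mesh) bs; apply: stab_diag_bae => //; apply: baeB => //; exact: bae_cst.
have vmsT i j := vms_bae _ i j sT_fe.
have vmsS i j := vms_bae _ i j sS_fe.
have ET := tracer_balance n_gt0 Omega_lip mesh k_ge1 uP dP lkT lsT lh vmsT (PiTP t Jt) TP bdT g (T_eq t Jt).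
have ES := tracer_balance n_gt0 Omega_lip mesh k_ge1 uP dP lkS lsS lh vmsS (PiSP t Jt) SP bdS g (S_eq t Jt).
have HT := vertical_diffusion n_gt0 Omega_lip mesh uP Cmax lkT lsT lh TP (g * alphaT) normalP.
have HS := vertical_diffusion n_gt0 Omega_lip mesh uP Cmax lkS lsS lh SP (g * betaS) normalP.
have gamma_ge0 x : Omega x -> 0 <= gamma t x.
  by move=> /subset_closure/h_ge0 hx; rewrite !mulr_ge0// sqrtr_ge0.
have bdelta : bae Omega (delta_rho t).
  by repeat (first [assumption | exact: bae_cst | apply: baeM | apply: baeB | apply: baeD]).
have du_bae j := velocity_dt_bae mesh J_open u_fe Jt u_dt j.
have EU := momentum_balance n_gt0 Omega_lip mesh uP dP lsu lh gamma_ge0 (P_fe t Jt) du_bae bdelta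
  (lt0r_neq0 rho0_gt0) nu_ge0 (u_eq t Jt).
have dEE := etrans (derive1E energy t) (@derive_val _ _ _ _ _ _ _ dE).
have I1 := buoyancy_integral Omega_lip mesh alphaT betaS T0 S0 (lt0r_neq0 rho0_gt0)
  (bu (up_index n_gt0)) bT bS (integral_u1 n_gt0 Omega_lip mesh k_ge1 uP dP).
have I2 : integral_dom Omega (fun x => delta_rho t x / rho0 * y x * vdiv (u t) x) =
    - alphaT * integral_dom Omega (fun x => vdiv (u t) x * T t x * y x)
    + betaS * integral_dom Omega (fun x => vdiv (u t) x * S t x * y x).
  have y_fe : Pk Omega vtx k y by exact: Pk_y.
  have bdiv := vdiv_bae n_gt0 Omega_lip mesh (velocity_pwlip mesh uP).
  have := buoyancy_integral Omega_lip mesh alphaT betaS T0 S0 (lt0r_neq0 rho0_gt0)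
    (baeM bdiv (Pk_bae mesh y_fe)) bT bS (weakly_divergence_free n_gt0 Omega_lip mesh uP dP y_fe).
  have swap (a : 'rV[R]_n.+1 -> R) : integral_dom Omega (fun x => vdiv (u t) x * a x * y x) =
      integral_dom Omega (fun x => a x * (vdiv (u t) x * y x)).
    by apply: eq_integral_dom => x _; rewrite mulrCA mulrA.
  rewrite !swap => <-; apply: eq_integral_dom => x _.
  by rewrite -[LHS]mulrA [y x * _]mulrC.
exact (energy_budget ET ES EU I1 I2 HT HS dEE).
Qed.
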